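(* Consider a tiling of the plane $\mathbb{R}^2$ which is either a tiling with regular hexagons, or a tiling with congruent parallelograms whose vertices form a lattice. Then one obtains a balanced configuration of points in $\mathbb{R}^2$ by taking the union of any one, any two, or all three of the following sets: (i) the set of vertices of the tiles; (ii) the set of midpoints of the edges of the tiles; (iii) the set of centers of the faces of the tiles. Moreover, every balanced configuration of points $\mathcal{C}\subseteq\mathbb{R}^2$ that satisfies the minimal distance property and is not contained in a single line arises in this manner, i.e. it is the union of one, two, or all three of the sets (i), (ii), (iii) for some such tiling.
   Context: A configuration is a set of points $\mathcal{C}\subseteq\mathbb{R}^2$. It is balanced if for every $P\in\mathcal{C}$ and every distance $d$, the points $P_1,\dots,P_m\in\mathcal{C}$ at distance exactly $d$ from $P$ satisfy $\overrightarrow{PP_1}+\dots+\overrightarrow{PP_m}=\vec{0}$ (the empty sum being $\vec 0$). A configuration $\mathcal{C}$ has the minimal distance property if there is some $d>0$ such that any two distinct points $x,y\in\mathcal{C}$ are at distance at least $d$, and some pair of points $x,y\in\mathcal{C}$ is at distance exactly $d$. A tiling with regular hexagons is the standard edge-to-edge tiling of $\mathbb{R}^2$ by congruent regular hexagons (of any side length, position and orientation). A tiling with congruent parallelograms whose vertices form a lattice is an edge-to-edge tiling by the translates $a+iu+jv+\{su+tv: 0\le s,t\le 1\}$, $i,j\in\mathbb{Z}$, for some point $a\in\mathbb{R}^2$ and linearly independent vectors $u,v\in\mathbb{R}^2$; its set of vertices is $a+\mathbb{Z}u+\mathbb{Z}v$ (a lattice, up to translation). The center of a face is the center of symmetry of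 the tile. *)

(* Defs.v *)
From HB Require Import structures.
From mathcomp Require Import all_boot all_order all_algebra.
From mathcomp Require Import all_classical all_reals.

Set Implicit Arguments.
Unset Strict Implicit.
Unset Printing Implicit Defensive.

Import Order.TTheory GRing.Theory Num.Theory.

Local Open Scope classical_set_scope.
Local Open Scope ring_scope.

Notation plane R := 'rV[R]_2.

Section Configurations.
Variable R : realType.
Implicit Types (C : set (plane R)) (P Q : plane R).

(* The norm that the library puts on matrices is the sup norm. *)
Definition dist P Q : R := Num.sqrt (\sum_(i < 2) (Q 0 i - P 0 i) ^+ 2).

Definition at_dist C P (d : R) : set (plane R) := [set Q | C Q /\ dist P Q = d].

(* The sum over a set is a junk value when infinitely many terms are nonzero,
   hence the separate finiteness requirement. *)
Definition balanced C : Prop :=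
  forall P (d : R), C P ->
    finite_set (at_dist C P d) /\ \sum_(Q \in at_dist C P d) (Q - P) = 0.

Definition minimal_distance_property C : Prop :=
  exists2 d : R, 0 < d &
    (forall P Q, C P -> C Q -> P != Q -> d <= dist P Q) /\
    (exists P Q, [/\ C P, C Q & dist P Q = d]).

Definition contained_in_line C : Prop :=
  exists P (u : plane R), u != 0 /\ C `<=` range (fun t : R => P + t *: u).

End Configurations.

Section Polygons.
Variable R : realType.

(* A polygon is the list of its vertices, in cyclic order along the boundary. *)
Definition polygon := seq (plane R).
Implicit Types p : polygon.

Definition region p : set (plane R) :=
  [set x | exists w : 'I_(size p) -> R,
     [/\ forall i, 0 <= w i, \sum_i w i = 1 & x = \sum_i w i *: p`_i]].

Definition edges p : seq (plane R * plane R) := zip p (rot 1 p).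

Definition midpoint (e : plane R * plane R) : plane R := 2^-1 *: (e.1 + e.2).

Definition center_of_symmetry p (c : plane R) : Prop :=
  forall x, region p x <-> region p (2 *: c - x).

End Polygons.

Section Tilings.
Variable R : realType.
Implicit Types (T : set (polygon R)) (a c e u v x : plane R).

Definition parallelogram a u v : polygon R :=
  [:: a; a + u; a + u + v; a + v].

Definition parallelogram_tiles a u v : set (polygon R) :=
  [set p | exists i j : int, p = parallelogram (a + i%:~R *: u + j%:~R *: v) u v].

Definition parallelogram_tiling T : Prop :=
  exists a u v, free [:: u; v] /\ T = parallelogram_tiles a u v.

(* Counterclockwise rotation by pi / 3 about the origin. *)
Definition rot60 v : plane R :=
  \row_(j < 2) if j == 0 then 2^-1 * v 0 0 - Num.sqrt 3 / 2 * v 0 1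
               else Num.sqrt 3 / 2 * v 0 0 + 2^-1 * v 0 1.

(* The regular hexagon with center c having c + e as a vertex. *)
Definition hexagon c e : polygon R := [seq c + iter k rot60 e | k <- iota 0 6].

(* The reflections of the center c of a tile in two adjacent edges are
   c + (e + rot60 e) and c + (rot60 e + rot60 (rot60 e)); the tiles are the
   translates of hexagon c e along the lattice spanned by these two vectors. *)
Definition hexagon_tiles c e : set (polygon R) :=
  [set p | exists i j : int,
     p = hexagon (c + i%:~R *: (e + rot60 e)
                    + j%:~R *: (rot60 e + rot60 (rot60 e))) e].

Definition hexagonal_tiling T : Prop :=
  exists c e, e != 0 /\ T = hexagon_tiles c e.

Inductive feature := Vertices | EdgeMidpoints | FaceCenters.

Definition feature_points T (k : feature) : set (plane R) :=
  match k with
  | Vertices => [set x | exists2 p, T p & x \in p]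
  | EdgeMidpoints => [set x | exists2 p, T p & x \in map (@midpoint R) (edges p)]
  | FaceCenters => [set x | exists2 p, T p & center_of_symmetry p x]
  end.

Definition features_union T (S : set feature) : set (plane R) :=
  \bigcup_(k in S) feature_points T k.

End Tilings.

(* Main.v *)
Require Import Defs.
From HB Require Import structures.
From mathcomp Require Import all_boot all_order all_algebra.
From mathcomp Require Import all_classical all_reals.
From mathcomp Require Import ring lra zify.

Set Implicit Arguments.
Unset Strict Implicit.
Unset Printing Implicit Defensive.

Import Order.TTheory GRing.Theory Num.Theory.

Local Open Scope ring_scope.

(** Balancedness. With half the sides of a tile as basis, each of the sets (i), (ii), (iii) is given
    by congruences on the coordinates, so any union of them is preserved by many rotations about its
    own points. For parallelograms the half turn about any point works. For hexagons the half turn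
    works about edge midpoints and face centers, and the rotation by [2 pi / 3] about vertices. The
    sum of a ring is fixed by such a rotation, hence zero ([lattice_balanced]).

    Classification. The minimal distance is scaled to 1 and coordinates are taken along a closest
    pair. In a ring, that is, the points at a given distance from a point, antipodal pairs cancel,
    so only the asymmetric part matters. Separation by 1 leaves room for few asymmetric points, and
    few vectors of equal length with sum zero are rigid: two are antipodal, three are equilateral,
    four split into antipodal pairs. For unit rings this leaves a centrally symmetric ring, an
    equilateral triangle, or five asymmetric vectors. The last case is excluded by constructing,
    beyond the two closest of the five, two further points that are too near to each other
    ([five_false]). The outcome is [star]: every unit ring is symmetric or a triangle.

    If all unit rings are symmetric, a closest pair extends to a line of equally spaced points.
    Symmetry about these points propagates upwards through the whole plane ([line_symP]). The next
    row parallel to the line has spacing 1 or 2. Spacing 1 gives a lattice. With spacing 2 the row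
    after it is shown to be full again, so that the configuration is a lattice without one of its
    four parity classes, which is the set of vertices and edge midpoints of a parallelogram tiling
    ([line_class]).

    If some unit ring is a triangle, its three neighbours are of the same kind. When they are
    triangles too, the configuration is the vertex set of a honeycomb ([hex1_class]). When they are
    symmetric, the points behind them are triangles again ([two_anti_row]) and the configuration
    contains the vertices and edge midpoints of a honeycomb. Any other point lies in a small disc
    about a face center, and balance in one suitable ring forces it to be the center ([no_core],
    [hex2_class]). The symmetries of the honeycomb reduce these statements to a fundamental triangle
    ([tri_reduce]). The remaining unions for hexagonal tilings are lattices or lattices without one
    parity class, and so are covered by parallelograms. *)

(** * Chords and rigid sums of vectors of equal length *)

Lemma sqr_le (R : realDomainType) (a b : R) : - b <= a -> a <= b -> a^+2 <= b^+2.
Proof. by move=> l r; have : 0 <= (b - a) * (b + a) by [apply: mulr_ge0; lra]; lra. Qed.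

(** Since [|x| <= x'], the point [(x, y)] is the higher one, so [y * y' >= y'^2 = t - x'^2]. The
    squared chord [2 * t - 2 * (x * x' + y * y')] is then bounded by the right-hand side. *)
Lemma chord_le (R : realFieldType) (t x y x' y' : R) : 0 < y -> 0 < y' ->
  x^+2 + y^+2 = t -> x'^+2+y'^+2 = t -> -x' <= x -> x <= x' ->
  (x-x')^+2+(y-y')^+2 <= 2 * (x'-x)*x'.
Proof.
move=> y0 y'0 e e' l r.
have yy : y' <= y by nra.
nra.
Qed.
Lemma chord_lt (R : realFieldType) (t x y x' y' : R) : 0 < y -> 0 < y' ->
  x^+2 + y^+2 = t -> x'^+2+y'^+2 = t -> -x' < x -> x < x' ->
  (x-x')^+2+(y-y')^+2 < 2 * (x'-x)*x'.
Proof.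
move=> y0 y'0 e e' l r.
have yy : y' < y by nra.
nra.
Qed.
(* pair sum *)
Lemma pair_sum (R : realFieldType) (t a b c d x y z w : R) : 
  a^+2+b^+2 = t -> c^+2+d^+2 = t -> x^+2+y^+2=t -> z^+2+w^+2=t ->
  a + c = x + z -> b + d = y + w -> b + d != 0 -> (a = x /\ b = y) \/ (a = z /\ b = w).
Proof.
move=> e1 e2 e3 e4 ex ey n0.
(* The differences [(a - x, b - y)] and [(a - z, b - w)] are both orthogonal to the nonzero common
   sum, hence parallel; they are also orthogonal to each other, so one of them vanishes. *)
have o1 : (a - x) * (a+c) + (b-y)*(b+d) = 0 by nra.
have o2 : (a - z) * (a+c) + (b-w)*(b+d) = 0 by nra.
have o3 : (a - x) * (a - z) + (b-y)*(b-w) = 0 by nra.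
have o4 : (a-x)*(a-z)*((a+c)^+2+(b+d)^+2) = 0. 
  have -> : (a - x) * (a - z) * ((a + c) ^+ 2 + (b + d) ^+ 2) = (b+d)^+2 * ((a - x) * (a - z) + (b-y)*(b-w)) - ((b-y)*(b+d)) * ((b-w)*(b+d)) + ((a - x) * (a + c)) *((a-z)*(a+c)) by ring.
  have -> : (b-y)*(b+d) = - ((a - x) * (a+c)) by lra.
  have -> : (b-w)*(b+d) = - ((a - z) * (a+c)) by lra.
  rewrite o3; ring.
move/eqP: o4; rewrite !mulf_eq0 !subr_eq0 => /orP[/orP[]|] /eqP h.
- left; split=> //; move: o1; rewrite h subrr mul0r add0r => /eqP; rewrite mulf_eq0 (negPf n0) orbF subr_eq0 => /eqP //.
- right; split=> //; move: o2; rewrite h subrr mul0r add0r => /eqP; rewrite mulf_eq0 (negPf n0) orbF subr_eq0 => /eqP //.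
have := sqr_ge0 (a+c). have : 0 < (b+d)^+2 by rewrite exprn_even_gt0.
lra.
Qed.
(** The zero sum fixes the inner product of two of the vectors at [-t/2], hence their cross product
    at [k * t] up to sign. The vectors form an equilateral triangle, and the sign is its
    orientation. *)
Lemma triple_sum (R : realFieldType) (t a b c d x y k : R) : k^+2 = 3/4 ->
  a^+2+b^+2 = t -> c^+2+d^+2 = t -> x^+2+y^+2=t -> a+c+x=0 -> b+d+y=0 ->
  [/\ c = -a/2 - k*b, d = -b/2+k*a, x = -a/2+k*b & y = -b/2-k*a] \/
  [/\ x = -a/2 - k*b, y = -b/2+k*a, c = -a/2+k*b & d = -b/2-k*a].
Proof.
move=> hk e1 e2 e3 ex ey.
have hx : x = - a - c by lra. have hy : y = -b -d by lra.
subst x y.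
have o1 : a * c + b * d = - t/2 by nra.
have o2 : (a*d-b*c)^+2 = (k*t)^+2. 
  have -> : (a*d-b*c)^+2 = (a^+2+b^+2)*(c^+2+d^+2) - (a*c+b*d)^+2 by ring.
  have -> : (k*t)^+2 = k^+2*t^+2 by ring.
  by rewrite e1 e2 o1 hk; field.
have [t0|tn0] := eqVneq t 0.
  have a0 : a = 0 by nra.
  have b0 : b = 0 by nra.
  have c0 : c = 0 by nra.
  have d0 : d = 0 by nra.
  by left; rewrite a0 b0 c0 d0; split; ring.
have d1 : t * c = a * (a*c+b*d) - b * (a*d-b*c) by rewrite -e1; ring.
have d2 : t * d = b * (a*c+b*d) + a * (a*d-b*c) by rewrite -e1; ring.
move/eqP: o2; rewrite eqf_sqr => /orP[] /eqP o2; rewrite o1 o2 in d1 d2; [left|right].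
  have hc : c = -a/2 - k*b by apply: (mulfI tn0); rewrite d1; field.
  have hd : d = -b/2 + k*a by apply: (mulfI tn0); rewrite d2; field.
  by rewrite hc hd; split => //; field.
have hc : c = -a/2 + k*b by apply: (mulfI tn0); rewrite d1; field.
have hd : d = -b/2 - k*a by apply: (mulfI tn0); rewrite d2; field.
by rewrite hc hd; split => //; field.
Qed.

Lemma size_le2 (T : eqType) (s : seq T) : uniq s ->
  (forall a b c, a \in s -> b \in s -> c \in s -> a != b -> a != c -> b != c -> False) ->
  (size s <= 2)%N.
Proof.
case: s => [|a [|b [|c s]]] //; rewrite /= !inE !negb_or.
move=> /andP[/and3P[ab ac _] /andP[/andP[bc _] _]] h.
by case: (h a b c) => //; rewrite !inE eqxx ?orbT.
Qed.

Lemma mem_second (T : eqType) (a b : T) s : b \in [:: a, b & s].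
Proof. by rewrite !inE eqxx orbT. Qed.

(** * Configurations in coordinates and the asymmetric parts of rings *)

Section Config.
Variable R : realType.
Implicit Types (K : R -> R -> Prop) (v : R * R).

Definition ring_seq K a b t (s : seq (R * R)) :=
  uniq s /\ forall v, v \in s <-> K (a + v.1) (b + v.2) /\ v.1^+2 + v.2^+2 = t.

(** Balanced configurations with separation normalised to 1. Predicates on coordinates and squared
    distances keep the later arguments polynomial, and a ring given as a sequence of displacements
    has finiteness built in. *)
Definition conf K :=
  (forall a b c d, K a b -> K c d -> (c-a)^+2 + (d-b)^+2 < 1 -> c = a /\ d = b) /\
  (forall a b t, K a b -> exists2 s, ring_seq K a b t s &
     \sum_(v <- s) v.1 = 0 /\ \sum_(v <- s) v.2 = 0).

(** For [c^2 + s^2 = 1] this is [K] read in the orthonormal frame with origin [(a, b)] and first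
    axis [(c, s)]. *)
Definition move K a b c s x y := K (a + c*x - s*y) (b + s*x + c*y).

Lemma conf_move K a b c s : c^+2+s^+2 = 1 -> conf K -> conf (move K a b c s).
Proof.
move=> h [sep bal]; split=> [x y x' y' k k' l|x y t k].
  have e0 : (a + c*x' - s*y' - (a + c*x - s*y))^+2 + (b + s*x' + c*y' - (b + s*x + c*y))^+2 < 1.
    have -> : (a + c*x' - s*y' - (a + c*x - s*y))^+2 + (b + s*x' + c*y' - (b + s*x + c*y))^+2
       = (c^+2+s^+2) * ((x'-x)^+2+(y'-y)^+2) by ring.
    by rewrite h mul1r.
  have [e1 e2] := sep _ _ _ _ k k' e0.
  have f1 : (c^+2+s^+2)*(x'-x) = c * (c * (x'-x) - s*(y'-y)) + s *(s*(x'-x)+c*(y'-y)) by ring.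
  have f2 : (c^+2+s^+2)*(y'-y) = - s * (c * (x'-x) - s*(y'-y)) + c *(s*(x'-x)+c*(y'-y)) by ring.
  have g1 : c * (x'-x) - s*(y'-y) = 0 by lra.
  have g2 : s * (x'-x) + c*(y'-y) = 0 by lra.
  by move: f1 f2; rewrite h g1 g2; lra.
have [q [uq mq] [sx sy]] := bal _ _ t k.
pose f (v : R * R) := (c * v.1 + s * v.2, c * v.2 - s * v.1).
pose g (v : R * R) := (c * v.1 - s * v.2, c * v.2 + s * v.1).
have fg v : g (f v) = v.
  case: v => v1 v2; rewrite /f/g /=; congr pair.
    by rewrite -[RHS]mul1r -h; ring.
  by rewrite -[RHS]mul1r -h; ring.
have gf v : f (g v) = v.
  case: v => v1 v2; rewrite /f/g /=; congr pair.
    by rewrite -[RHS]mul1r -h; ring.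
  by rewrite -[RHS]mul1r -h; ring.
exists (map f q).
  split; first by rewrite map_inj_uniq //; exact: can_inj fg.
  move=> v; rewrite -{1}(gf v) mem_map; last exact: can_inj fg.
  rewrite mq /move /g /=.
  have -> : a + c * (x + v.1) - s * (y + v.2) = a + c * x - s * y + (c * v.1 - s * v.2) by ring.
  have -> : b + s * (x + v.1) + c * (y + v.2) = b + s * x + c * y + (c * v.2 + s * v.1) by ring.
  have -> : (c * v.1 - s * v.2)^+2 + (c * v.2 + s * v.1)^+2 = (c^+2+s^+2)*(v.1^+2+v.2^+2) by ring.
  by rewrite h mul1r.
rewrite !big_map /= big_split /= sumrB -!mulr_sumr sx sy; split; ring.
Qed.

Lemma conf_flip K : conf K -> conf (fun x y => K x (-y)).
Proof.
move=> [sep bal]; split=> [x y x' y' k k' l|x y t k].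
  have [] := sep _ _ _ _ k k'; first by lra.
  by lra.
have [q [uq mq] [sx sy]] := bal _ _ t k.
pose f (v : R * R) := (v.1, - v.2).
have ff v : f (f v) = v by case: v => v1 v2; rewrite /f /= opprK.
exists (map f q).
  split; first by rewrite map_inj_uniq //; exact: can_inj ff.
  move=> v; rewrite -{1}(ff v) mem_map; last exact: can_inj ff.
  by rewrite mq /f /= sqrrN opprD.
rewrite !big_map /= sumrN sx sy oppr0; split; ring.
Qed.

Lemma sep0 K x y : conf K -> K 0 0 -> K x y -> x = 0 /\ y = 0 \/ 1 <= x^+2+y^+2.
Proof.
move=> [sep _] k0 k; have [|l] := leP 1 (x^+2+y^+2); first by right.
by left; apply: sep k0 k _; rewrite !subr0.
Qed.

Lemma sepP K a b c d : conf K -> K a b -> K c d -> 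
  c = a /\ d = b \/ 1 <= (c-a)^+2+(d-b)^+2.
Proof.
move=> [sep _] k0 k; have [|l] := leP 1 ((c-a)^+2+(d-b)^+2); first by right.
by left; apply: sep k0 k _.
Qed.

(* asymmetric part of the ring of radius^2 t about the origin *)
Definition asym K t x y := [/\ K x y, x^+2+y^+2 = t & ~ K (-x) (-y)].

Lemma ring0 K t : conf K -> K 0 0 -> exists2 s, uniq s & [/\ 
   forall x y, (x, y) \in s <-> K x y /\ x^+2+y^+2 = t,
  \sum_(v <- s) v.1 = 0 & \sum_(v <- s) v.2 = 0].
Proof.
move=> [_ bal] k0; have [s [us ms] [sx sy]] := bal _ _ t k0.
by exists s => //; split=> // x y; rewrite ms /= !add0r.
Qed.

Lemma asym_seq K t : conf K -> K 0 0 -> exists2 s, uniq s &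
  [/\ forall x y, (x, y) \in s <-> asym K t x y,
   \sum_(v <- s) v.1 = 0 & \sum_(v <- s) v.2 = 0].
Proof.
move=> ck k0; have [s us [ms sx sy]] := ring0 t ck k0.
pose P v := ~~ `[< K (- v.1) (- v.2) >].
exists [seq v <- s | P v]; first exact: filter_uniq.
have z (f : R * R -> R) : (forall v, f (- v) = - f v) -> \sum_(v <- s) f v = 0 -> \sum_(v <- [seq v <- s | P v]) f v = 0.
  move=> fN; rewrite (bigID P) /= -big_filter => e.
  suff h : \sum_(v <- s | ~~ P v) f v = 0 by move: e; rewrite h addr0.
  have pe : perm_eq [seq v <- s | ~~ P v] (map -%R [seq v <- s | ~~ P v]).
    apply: uniq_perm; first exact: filter_uniq.
      by rewrite map_inj_uniq ?filter_uniq //; exact: oppr_inj.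
    have sub v : v \in [seq v <- s | ~~ P v] -> - v \in [seq v <- s | ~~ P v].
      case: v => x y; rewrite !mem_filter /P /= !negbK => /andP[/asboolP k /ms[k' e']].
      apply/andP; split; first by apply/asboolP; rewrite !opprK.
      by apply/ms; rewrite !sqrrN.
    move=> v; apply/idP/mapP => [h|[w h ->]]; last exact: sub.
    by exists (- v); rewrite ?opprK //; exact: sub.
  have := perm_big _ pe (P := xpredT) (F := f) : \sum_(v <- _) _ = \sum_(v <- _) _.
  rewrite big_map; under [in RHS]eq_bigr do rewrite fN.
  by rewrite sumrN !big_filter; lra.
split; [|exact: z sx|exact: z sy].
move=> x y; rewrite mem_filter /P /=; split.
  by move=> /andP[/asboolP n /ms [k e]].
by move=> [k e n]; apply/andP; split; [apply/asboolP|apply/ms].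
Qed.

Lemma asymN K t x y x' y' : asym K t x y -> asym K t x' y' -> x' = -x -> y' = -y -> False.
Proof. by move=> [k1 _ n1] [k2 _ n2] e1 e2; apply: n1; rewrite -e1 -e2. Qed.

Lemma asym_split K t : conf K -> K 0 0 -> (forall x y, asym K t x y -> y != 0) ->
  exists T B : seq (R * R), [/\ uniq T, uniq B,
   forall x y, (x, y) \in T <-> asym K t x y /\ 0 < y,
   forall x y, (x, y) \in B <-> asym K t x y /\ y < 0 &
   \sum_(v <- T) v.1 + \sum_(v <- B) v.1 = 0 /\
   \sum_(v <- T) v.2 + \sum_(v <- B) v.2 = 0].
Proof.
move=> ck k0 n0; have [s us [ms sx sy]] := asym_seq t ck k0.
exists [seq v <- s | 0 < v.2], [seq v <- s | ~~ (0 < v.2)]; split.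
- exact: filter_uniq.
- exact: filter_uniq.
- by move=> x y; rewrite mem_filter /=; split=> [/andP[p /ms]|[/ms -> ->]].
- move=> x y; rewrite mem_filter /=; split=> [/andP[p /ms h]|[h p]].
    by split=> //; rewrite lt_neqAle (n0 _ _ h) /= leNgt.
  by apply/andP; split; [rewrite -leNgt ltW|apply/ms].
- by split; rewrite !big_filter; [rewrite -[RHS]sx|rewrite -[RHS]sy]; rewrite [RHS](bigID (fun v : R * R => 0 < v.2)).
Qed.

(* sums over T, B determine the ring when at most two points lie on each side *)
Lemma sym_of_two K t (h : R) : conf K -> K 0 0 -> 0 < h -> t < 4 * h^+2 ->
  (forall x y, asym K t x y -> h <= y \/ y <= - h) ->
  (forall e x1 y1 x2 y2 x3 y3 : R, (e == 1) || (e == -1) ->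
     asym K t x1 y1 -> asym K t x2 y2 -> asym K t x3 y3 ->
     0 < e * y1 -> 0 < e * y2 -> 0 < e * y3 ->
     (x1, y1) != (x2, y2) -> (x1, y1) != (x3, y3) -> (x2, y2) != (x3, y3) -> False) ->
  forall x y, ~ asym K t x y.
Proof.
move=> ck k0 h0 th ah no3.
have n0 x y : asym K t x y -> y != 0 by move=> /ah [] ?; apply/eqP; lra.
have [T [B [uT uB mT mB [sx sy]]]] := asym_split ck k0 n0.
have aT v : v \in T -> asym K t v.1 v.2 /\ 0 < v.2 by case: v => ? ? /mT.
have aB v : v \in B -> asym K t v.1 v.2 /\ v.2 < 0 by case: v => ? ? /mB.
have at_ v : asym K t v.1 v.2 -> v.1^+2+v.2^+2=t by case.
suff: T = [::] /\ B = [::].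
  move=> [eT eB] x y a; have [l|l|e] := ltrgt0P y; last by have := n0 _ _ a; rewrite e eqxx.
    by have /mT : asym K t x y /\ 0 < y by []; rewrite eT.
  by have /mB : asym K t x y /\ y < 0 by []; rewrite eB.
have hT v : v \in T -> h <= v.2 by move=> /aT[/ah []]; lra.
have hB v : v \in B -> v.2 <= -h by move=> /aB[/ah []]; lra.
have sT : (size T <= 2)%N.
  apply: size_le2 => // -[? ?] [? ?] [? ?] /mT[a1 p1] /mT[a2 p2] /mT[a3 p3] ab ac bc.
  by case: (no3 1 _ _ _ _ _ _ _ a1 a2 a3) => //; rewrite ?mul1r ?eqxx.
have sB : (size B <= 2)%N.
  apply: size_le2 => // -[? ?] [? ?] [? ?] /mB[a1 p1] /mB[a2 p2] /mB[a3 p3] ab ac bc.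
  by case: (no3 (-1) _ _ _ _ _ _ _ a1 a2 a3) => //; rewrite ?mulN1r ?oppr_gt0 ?eqxx ?orbT.
have yt v : asym K t v.1 v.2 -> v.2 < 2 * h /\ - (2 * h) < v.2.
  by move=> /at_ e; split; nra.
(* By the sum of heights neither side can be empty alone. One point against one is an antipodal
   pair. One against two fails because [t < 4 * h^2] keeps the height of the single point below
   [2 * h]. Two against two are antipodal in pairs by [pair_sum]. *)
case: T uT sT aT hT sx sy {mT} => [|a [|b [|? ?]]] //= uT _ aT hT;
case: B uB sB aB hB {mB} => [|c [|d [|? ?]]] //= uB _ aB hB; rewrite ?big_cons ?big_nil => sx sy //; exfalso.
- by have := hB c (seq.mem_head _ _); lra.
- have := hB c (seq.mem_head _ _); have := hB d (mem_second _ _ _) => /= ? ?; lra.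
- by have := hT a (seq.mem_head _ _); lra.
- have [a1 _] := aT a (seq.mem_head _ _); have [a2 _] := aB c (seq.mem_head _ _).
  by case: (asymN a1 a2); lra.
- have [/yt[? ?] _] := aT a (seq.mem_head _ _).
  have := hB c (seq.mem_head _ _); have := hB d (mem_second _ _ _) => /= ? ?; lra.
- have := hT a (seq.mem_head _ _); have := hT b (mem_second _ _ _) => /= ? ?; lra.
- have [/yt[? ?] _] := aB c (seq.mem_head _ _).
  have := hT a (seq.mem_head _ _); have := hT b (mem_second _ _ _) => /= ? ?; lra.
have [a1 p1] := aT a (seq.mem_head _ _); have [a2 p2] := aT b (mem_second _ _ _).
have [a3 p3] := aB c (seq.mem_head _ _); have [a4 p4] := aB d (mem_second _ _ _).
have e1 := at_ _ a1; have e2 := at_ _ a2; have e3 := at_ _ a3; have e4 := at_ _ a4.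
have [|||||[f1 f2]|[f1 f2]] :=
  @pair_sum R t a.1 a.2 b.1 b.2 (-c.1) (-c.2) (-d.1) (-d.2) e1 e2.
- by rewrite !sqrrN.
- by rewrite !sqrrN.
- lra.
- lra.
- by apply/eqP; lra.
- by case: (asymN a1 a3); lra.
by case: (asymN a1 a4); lra.
Qed.

End Config.

Lemma three_close (R : realFieldType) (l c x1 x2 x3 : R) :
  l <= x1 <= l + 2*c -> l <= x2 <= l + 2*c -> l <= x3 <= l + 2*c ->
  [\/ - c <= x1 - x2 <= c, - c <= x1 - x3 <= c | - c <= x2 - x3 <= c].
Proof.
move=> /andP[? ?] /andP[? ?] /andP[? ?].
have [a|a] := boolP (- c <= x1 - x2 <= c); first exact: Or31.
have [b|b] := boolP (- c <= x1 - x3 <= c); first exact: Or32.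
apply: Or33; move: a b; rewrite !negb_and -!ltNge => /orP a /orP b.
by apply/andP; case: a => ?; case: b => ?; split; lra.
Qed.

(** * Small rings around the middle of three collinear points *)

Section Rings.
Variable R : realType.
Implicit Types (K : R -> R -> Prop).

Lemma asym_sep K t x y x' y' : conf K -> asym K t x y -> asym K t x' y' ->
  (x, y) != (x', y') -> 1 <= (x' - x)^+2 + (y' - y)^+2.
Proof.
move=> ck [k _ _] [k' _ _]; case: (sepP ck k k') => // -[-> ->].
by rewrite eqxx.
Qed.

(** Of three points on one side, two have abscissas within [c] of each other ([three_close]), hence
    lie at distance less than 1. So each side carries at most two asymmetric points and [sym_of_two]
    applies. *)
Lemma sym_band K t c h : conf K -> K 0 0 -> 0 < h -> t < 4 * h^+2 ->
  (forall x y, asym K t x y -> -c <= x <= c /\ (h <= y \/ y <= - h)) ->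
  (forall x y x' y', x^+2+y^+2 = t -> x'^+2+y'^+2 = t -> h <= y' -> y' <= y ->
     -c <= x <= c -> -c <= x' <= c -> -c <= x - x' <= c -> (x-x')^+2+(y-y')^+2 < 1) ->
  forall x y, ~ asym K t x y.
Proof.
move=> ck k0 h0 th ah pc.
apply: (sym_of_two ck k0 h0 th) => [x y /ah[]//|e x1 y1 x2 y2 x3 y3 he a1 a2 a3 p1 p2 p3 n12 n13 n23].
have key x y x' y' : asym K t x y -> asym K t x' y' -> 0 < e*y -> 0 < e * y' -> (x,y) != (x',y') -> -c <= x - x' <= c -> False.
  move=> a a' p p' n cl; have s := asym_sep ck a a' n.
  have [xc yh] := ah _ _ a; have [x'c y'h] := ah _ _ a'.
  have [_ t1 _] := a; have [_ t2 _] := a'.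
  have cl' : -c <= x' - x <= c by move/andP: cl => [? ?]; apply/andP; split; lra.
  have ee : e^+2 = 1 by case/orP: he => /eqP ->; rewrite ?sqrrN expr1n.
  have hh z : 0 < e * z -> h <= z \/ z <= - h -> h <= e * z.
    case/orP: he => /eqP -> ; lra.
  have t1' : x^+2+(e*y)^+2 = t by rewrite exprMn ee mul1r.
  have t2' : x'^+2+(e*y')^+2 = t by rewrite exprMn ee mul1r.
  have es z z' : (z-z')^+2 = (e*z-e*z')^+2 by rewrite -mulrBr exprMn ee mul1r.
  move: s; rewrite (es y' y).
  have [l|l] := leP (e * y) (e * y').
    by have := pc _ _ _ _ t2' t1' (hh _ p yh) l x'c xc cl'; lra.
  by have := pc _ _ _ _ t1' t2' (hh _ p' y'h) (ltW l) xc x'c cl; nra.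
have w z w : asym K t z w -> - c <= z <= -c + 2 * c.
  by move=> /ah[/andP[? ?] _]; apply/andP; split; lra.
case: (three_close (w _ _ a1) (w _ _ a2) (w _ _ a3)) => [q|q|q].
- exact: key a1 a2 p1 p2 n12 q.
- exact: key a1 a3 p1 p3 n13 q.
exact: key a2 a3 p2 p3 n23 q.
Qed.

Lemma sym_ring K t x y : (forall x y, ~ asym K t x y) -> K x y -> x^+2+y^+2 = t -> K (-x) (-y).
Proof.
by move=> na k e; have [//|n] := pselect (K (-x) (-y)); case: (na x y).
Qed.

(** A distance of at least 1 to [(1, 0)] reads [2 * x <= t], and likewise for [(-1, 0)]. The two
    points themselves are excluded because they are antipodal. *)
Lemma asym_near1 K t x y : conf K -> K 1 0 -> K (-1) 0 -> asym K t x y -> - (t/2) <= x <= t/2.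
Proof.
move=> ck k1 k2 [k e n].
case: (sepP ck k1 k) => [[e1 e2]|s1]; first by case: n; rewrite e1 e2 oppr0.
case: (sepP ck k2 k) => [[e1 e2]|s2]; first by case: n; rewrite e1 e2 oppr0 opprK.
by apply/andP; split; lra.
Qed.

Lemma asym_ge1 K t x y : conf K -> K 0 0 -> asym K t x y -> 1 <= t.
Proof.
move=> ck k0 [k <- n]; case: (sep0 ck k0 k) => // -[e1 e2].
by case: n; rewrite e1 e2 oppr0.
Qed.

(** If the distance were at least 1, then [(y - y')^2 >= 1 - t^2/4], while [y^2 - y'^2 <= t^2/4]
    keeps [(y - y') * y'] small. Comparing squares gives [4 * (1 - t^2/4) * (t - t^2/4) <= (t^2/2 -
    1)^2], which fails on [[1, 9/5]]. *)
Lemma arc_pair_close (t x y x' y' : R) : 1 <= t -> t <= 9/5 ->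
  x^+2+y^+2 = t -> x'^+2+y'^+2 = t -> 6/7 <= y' -> y' <= y ->
  - (t/2) <= x <= t/2 -> - (t/2) <= x' <= t/2 -> - (t/2) <= x - x' <= t/2 ->
  (x-x')^+2+(y-y')^+2 < 1.
Proof.
move=> t1 t2 e e' h l /andP[a b] /andP[a' b'] /andP[c d].
have d2 : (x-x')^+2 <= t^+2/4 by nra.
have y2 : t - t^+2/4 <= y'^+2 by nra.
have x2 : y^+2 - y'^+2 <= t^+2/4 by nra.
rewrite ltNge; apply/negP => n.
have dd : 1 - t^+2/4 <= (y-y')^+2 by lra.
have e2 : (y - y')^+2 + 2 * ((y-y')*y') <= t^+2/4 by nra.
have m : (1 - t^+2/4) * (t - t^+2/4) <= ((y-y')*y')^+2.
  by rewrite exprMn ler_pM //; nra.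
have m2 : 2 * ((y-y')*y') <= t^+2/2 - 1 by lra.
have m3 : 0 <= (y-y')*y' by rewrite mulr_ge0 //; lra.
have m4 : (2 * ((y-y')*y'))^+2 <= (t^+2/2-1)^+2 by nra.
nra.
Qed.

(** The two unit neighbours confine asymmetric points to [|x| <= t/2], where the height satisfies
    [y^2 >= t - t^2/4 >= 3/4]; the constant [6/7] is a rational bound just below [sqrt 3 / 2]. On
    these two arcs [sym_band] applies. *)
Lemma ball_sym K x y : conf K -> K 0 0 -> K 1 0 -> K (-1) 0 -> x^+2+y^+2 <= 9/5 ->
  K x y -> K (-x) (-y).
Proof.
move=> ck k0 k1 k2 l k; apply: sym_ring k erefl => u v a.
have t1 := asym_ge1 ck k0 a.
apply: (sym_band ck k0 (c := (x^+2+y^+2)/2) (h := 6/7)) a; [lra|lra| |].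
  move=> {}u {}v a; have b := asym_near1 ck k1 k2 a.
  split=> //; case: a => _ e _; move/andP: b => [? ?].
  have : (6/7)^+2 <= v^+2 by nra.
  by have [?|?] := leP (6/7) v; [left|right; nra].
move=> p q p' q'; exact: arc_pair_close.
Qed.
End Rings.

(** * Rings around a point whose unit ring is an equilateral triangle *)

Section Triple.
Variable R : realType.
Implicit Types (K : R -> R -> Prop).

Definition s3 : R := Num.sqrt 3 / 2.

Lemma s3_gt0 : 0 < s3.
Proof. by rewrite divr_gt0 // sqrtr_gt0. Qed.

Lemma s3_sq : s3^+2 = 3/4.
Proof. by rewrite exprMn sqr_sqrtr // exprVn; lra. Qed.

Lemma s3_bound : 19/22 < s3 /\ s3 < 13/15.
Proof. by have := s3_gt0; have := s3_sq; split; nra. Qed.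

Definition rot K := move K 0 0 (-1/2) s3.

Lemma rotE K x y : rot K x y = K (-x/2 - s3*y) (s3*x - y/2).
Proof. by rewrite /rot /move; congr K; field. Qed.

Lemma conf_rot K : conf K -> conf (rot K).
Proof. by apply: conf_move; rewrite s3_sq; lra. Qed.

Lemma rot2E K x y : rot (rot K) x y = K (-x/2 + s3*y) (-s3*x - y/2).
Proof.
have h := s3_sq; have hx : s3^+2 * x = 3/4*x by rewrite h.
by have hy : s3^+2 * y = 3/4*y by [rewrite h]; rewrite !rotE; congr K; lra.
Qed.

Lemma rot3E K x y : rot (rot (rot K)) x y = K x y.
Proof. have h := s3_sq; have hx : s3^+2 * x = 3/4*x by rewrite h.
by have hy : s3^+2 * y = 3/4*y by [rewrite h]; rewrite rotE rot2E; congr K; lra. Qed.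

Definition tri K := forall x y, x^+2+y^+2 = 1 -> 
  (K x y <-> [\/ x = 1 /\ y = 0, x = -1/2 /\ y = s3 | x = -1/2 /\ y = - s3]).

Lemma tri_pts K : tri K -> [/\ K 1 0, K (-1/2) s3 & K (-1/2) (-s3)].
Proof.
have h := s3_sq; move=> tK; split; apply/tK.
- by ring.
- exact: Or31.
- by rewrite h; lra.
- exact: Or32.
- by rewrite sqrrN h; lra.
exact: Or33.
Qed.

Lemma tri_rot K : tri K -> tri (rot K).
Proof.
have h := s3_sq; move=> tK x y e; rewrite rotE tK; last first.
  by rewrite -[RHS]e; nra.
have w0 := s3_gt0.
split=> -[[e1 e2]|[e1 e2]|[e1 e2]].
- by apply: Or33; split; nra.
- by apply: Or31; split; nra.
- by apply: Or32; split; nra.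
- by apply: Or32; rewrite e1 e2; split; lra.
- by apply: Or33; rewrite e1 e2; split; nra.
by apply: Or31; rewrite e1 e2; split; nra.
Qed.

(** Here [x] is the smallest of the three projections on the vertices of the triangle, and the other
    two are at most [t/2] because those vertices are at distance at least 1. This pins the point to
    within [1/2] of the axis opposite to the first vertex. *)
Lemma sector_narrow (t x y w : R) : w^+2 = 3/4 -> 0 < w -> 1 <= t -> t <= 9/4 -> x^+2+y^+2 = t ->
  x <= -x/2 + w * y -> x <= -x/2 - w*y -> -x/2 + w*y <= t/2 -> -x/2-w*y <= t/2 ->
  [/\ x < 0, 4*y^+2 < 1 & t - 1/4 < x^+2].
Proof.
move=> hw w0 t1 t2 e a b c d.
have x0 : x < 0.
  have : x <= 0 by lra.
  rewrite le_eqVlt => /orP[/eqP x0|//]; have : y = 0 by nra.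
  by move=> y0; move: e; rewrite x0 y0; lra.
suff h : 4 * y^+2 < 1 by split=> //; lra.
rewrite ltNge; apply/negP => n.
have a1 : 3 * y^+2 <= 9 * x^+2.
  have : (2*w*y)^+2 <= (3*x)^+2 by nra.
  by rewrite !exprMn hw; lra.
have x2 : t <= 4 * x^+2 by lra.
have c1 : 3 * y^+2 <= (t+x)^+2.
  have : (2*w*y)^+2 <= (t+x)^+2 by nra.
  by rewrite !exprMn hw; lra.
have f0 : 0 <= 4*x^+2 + 2 * t*x+t^+2-3*t by nra.
have l1 : - 2 * t * x <= t^+2+t-1 by nra.
have l2 : t <= -4 * x by nra.
have l3 : 12*t-3*t^+2 <= (-4*x - t)^+2 by nra.
have l4 : t * (-4*x-t) <= t^+2+2*t-2 by nra.
have l5 : 0 <= t * (-4*x-t) by rewrite mulr_ge0; lra.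
have l6 : (t * (-4*x-t))^+2 <= (t^+2+2*t-2)^+2 by nra.
have l7 : t^+2 * (12*t-3*t^+2) <= (t * (-4*x-t))^+2 by rewrite exprMn ler_pM2l ?exprn_gt0 //; lra.
have l8 : 0 <= t^+4 - 2 * t^+3 - 2 * t + 1 by lra.
(* The polynomial equals [t^2 * (r^2 - 2 * r - 2)] with [r = (t^2 + 1) / t], which is negative while
   [r < 1 + sqrt 3]. The value [27/10] lies below that bound and above [r] on [[1, 9/4]]. *)
have : t^+4 - 2 * t^+3 - 2 * t + 1 < 0.
  have : t^+2 + 1 <= 27/10 * t by nra.
  by move=> q; have : (t^+2+1)^+2 <= (27/10)*t *(t^+2+1); nra.
by lra.
Qed.
End Triple.

Section TripleBall.
Variable R : realType.
Implicit Types (K : R -> R -> Prop).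
Local Notation s3 := (@s3 R).

(** The projections on the three vertices of the triangle. The sector of a point is that of its
    smallest projection, so it is centred on the direction opposite to a vertex. *)
Let f1 (v : R * R) := v.1.
Let f2 (v : R * R) := - v.1/2 + s3 * v.2.
Let f3 (v : R * R) := - v.1/2 - s3 * v.2.
Let sector v : nat := if (f1 v <= f2 v) && (f1 v <= f3 v) then 0 else if f2 v <= f3 v then 1 else 2.

Let sectorP v : [\/ [/\ sector v = 0%N, f1 v <= f2 v & f1 v <= f3 v],
  [/\ sector v = 1%N, f2 v <= f1 v & f2 v <= f3 v] |
  [/\ sector v = 2%N, f3 v <= f1 v & f3 v <= f2 v]].
Proof.
rewrite /sector; case: ifPn => [/andP[a b]|]; first exact: Or31.
rewrite negb_and -!ltNge => /orP n; case: ifPn => [l|]; last rewrite -ltNge => r.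
  by apply: Or32; split=> //; case: n => ?; lra.
by apply: Or33; split=> //; case: n => ?; lra.
Qed.

Lemma rotN_norm (x y : R) : (-x/2 + s3*y)^+2 + (-s3*x - y/2)^+2 = x^+2+y^+2.
Proof.
have -> : (-x/2 + s3*y)^+2 + (-s3*x - y/2)^+2 = (1/4+s3^+2)*(x^+2+y^+2) by field.
by rewrite s3_sq; field.
Qed.

Lemma rot_norm (x y : R) : (-x/2 - s3*y)^+2 + (s3*x - y/2)^+2 = x^+2+y^+2.
Proof.
have -> : (-x/2 - s3*y)^+2 + (s3*x - y/2)^+2 = (1/4+s3^+2)*(x^+2+y^+2) by field.
by rewrite s3_sq; field.
Qed.

(* Seen from the direction opposite to f, two points on the circle of squared radius t
   both have horizontal coordinate less than 1/2 in absolute value *)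
Lemma sector_pair_close (t x y x' y' : R) : 1 <= t -> t <= 9/4 ->
  x^+2+y^+2 = t -> x'^+2+y'^+2 = t ->
  x <= -x/2 + s3 * y -> x <= -x/2 - s3*y -> -x/2 + s3*y <= t/2 -> -x/2-s3*y <= t/2 ->
  x' <= -x'/2 + s3 * y' -> x' <= -x'/2 - s3*y' -> -x'/2 + s3*y' <= t/2 -> -x'/2-s3*y' <= t/2 ->
  (x-x')^+2+(y-y')^+2 < 1.
Proof.
move=> t1 t2 e e' a b c d a' b' c' d'.
have [x0 y0 _] := sector_narrow (@s3_sq R) (@s3_gt0 R) t1 t2 e a b c d.
have [x'0 y'0 _] := sector_narrow (@s3_sq R) (@s3_gt0 R) t1 t2 e' a' b' c' d'.
wlog l : x y x' y' e e' x0 y0 x'0 y'0 {a b c d a' b' c' d'} / y^+2 <= y'^+2.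
  move=> wl; have [l|/ltW l] := leP (y^+2) (y'^+2); first exact: wl.
  have := wl _ _ _ _ e' e x'0 y'0 x0 y0 l; nra.
have := @chord_le R t y (-x) `|y'| (-x').
have [l0|l0] := leP 0 y'.
  rewrite ger0_norm // !sqrrN => h.
  have : (y - y') ^+ 2 + (- x - - x') ^+ 2 <= 2 * (y' - y) * y' by apply: h; nra.
  nra.
rewrite ltr0_norm // !sqrrN => _.
have := @chord_le R t (-y) (-x) (-y') (-x').
rewrite !sqrrN => h.
have : (- y - - y') ^+ 2 + (- x - - x') ^+ 2 <= 2 * (-y' - - y) * -y' by apply: h; nra.
nra.
Qed.

(** Each of the three sectors holds at most one point of the ring ([sector_pair_close]), so the ring
    has at most three points. One point has nonzero sum, two would be antipodal, and three form an
    equilateral triangle by [triple_sum], which the rotation by [2 pi / 3] preserves. *)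
Lemma tri_ball K x y : conf K -> K 0 0 -> tri K -> K x y -> x^+2+y^+2 <= 9/4 -> rot K x y.
Proof.
move=> ck k0 tk k le; have w0 := s3_gt0 R; have ww := s3_sq R.
case: (sep0 ck k0 k) => [[-> ->]|ge].
  by rewrite rotE !(mulr0, oppr0, mul0r, addr0, subr0).
set t := _ + _ in le ge.
have [t1|nt1] := eqVneq t 1.
  by have /tk[] := t1; move=> h _; apply/(tri_rot tk) => //; apply/tk.
have gt : 1 < t by rewrite lt_neqAle eq_sym nt1.
have [s us [ms sx sy]] := ring0 t ck k0.
have [p1 p2 p3] := tri_pts tk.
have dt (v : R * R) : v \in s -> v.1^+2+v.2^+2 = t by case: v => a b /ms[].
have hf v : v \in s -> [/\ f1 v <= t/2, f2 v <= t/2 & f3 v <= t/2].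
  case: v => a b /ms[k' e]; split; rewrite /f1 /f2 /f3 /=.
  - by case: (sepP ck p1 k') => [[? ?]|?]; nra.
  - by case: (sepP ck p2 k') => [[? ?]|?]; nra.
  by case: (sepP ck p3 k') => [[? ?]|?]; nra.
have close v v' : v \in s -> v' \in s -> (v'.1 - v.1)^+2 + (v'.2-v.2)^+2 < 1 -> v = v'.
  case: v v' => [a b] [a' b'] /ms[ka _] /ms[kb _] /= l.
  by case: ck => sep _; have [-> ->] := sep _ _ _ _ ka kb l.
have inj : {in s &, injective sector}.
  move=> v v' vs vs'; have [h1 h2 h3] := hf _ vs; have [h1' h2' h3'] := hf _ vs'.
  have e := dt _ vs; have e' := dt _ vs'.
  move: (sectorP v) (sectorP v') h1 h2 h3 h1' h2' h3'; rewrite /f1 /f2 /f3.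
  case=> -[-> a b]; case=> -[-> a' b'] // h1 h2 h3 h1' h2' h3' _; apply: close => //.
  - exact: (sector_pair_close ge le e' e a' b' h2' h3' a b h2 h3).
  - have := @sector_pair_close t (- v'.1/2 + s3 * v'.2) (-s3 * v'.1 - v'.2/2) (- v.1/2 + s3 * v.2) (-s3 * v.1 - v.2/2) ge le.
    have -> : (- v'.1/2 + s3 * v'.2 - (- v.1/2 + s3 * v.2))^+2 + ((-s3 * v'.1 - v'.2/2) - (-s3 * v.1 - v.2/2))^+2 = (v'.1-v.1)^+2+(v'.2-v.2)^+2.
      by rewrite -rotN_norm; field.
    have u1 : s3^+2 * v.1 = 3/4*v.1 by rewrite ww.
    have u2 : s3^+2 * v.2 = 3/4*v.2 by rewrite ww.
    have u3 : s3^+2 * v'.1 = 3/4*v'.1 by rewrite ww.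
    have u4 : s3^+2 * v'.2 = 3/4*v'.2 by rewrite ww.
    by apply; rewrite ?rotN_norm //; lra.
  have := @sector_pair_close t (- v'.1/2 - s3 * v'.2) (s3 * v'.1 - v'.2/2) (- v.1/2 - s3 * v.2) (s3 * v.1 - v.2/2) ge le.
  have -> : (- v'.1/2 - s3 * v'.2 - (- v.1/2 - s3 * v.2))^+2 + ((s3 * v'.1 - v'.2/2) - (s3 * v.1 - v.2/2))^+2 = (v'.1-v.1)^+2+(v'.2-v.2)^+2.
    by rewrite -rot_norm; field.
  have u1 : s3^+2 * v.1 = 3/4*v.1 by rewrite ww.
  have u2 : s3^+2 * v.2 = 3/4*v.2 by rewrite ww.
  have u3 : s3^+2 * v'.1 = 3/4*v'.1 by rewrite ww.
  have u4 : s3^+2 * v'.2 = 3/4*v'.2 by rewrite ww.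
  by apply; rewrite ?rot_norm //; lra.
have xys : (x, y) \in s by apply/ms.
have pe := perm_to_rem xys.
have us' : uniq ((x,y) :: rem (x,y) s) by rewrite -(perm_uniq pe).
have sz : (size s <= 3)%N.
  have := @uniq_leq_size _ (map sector s) (iota 0 3); rewrite map_inj_in_uniq // size_map; apply => //.
  by move=> i /mapP[v _ ->]; rewrite mem_iota /sector; case: ifP => // _; case: ifP.
move: sx sy; rewrite !(perm_big _ pe) !big_cons /=.
have mem_s v : v \in (x,y) :: rem (x,y) s -> v \in s by rewrite (perm_mem pe).
move: sz; rewrite (perm_size pe) /=.
case: (rem _ _) mem_s => [|[a b] [|[c d] [|? ?]]] //= mem_s _; rewrite ?big_cons ?big_nil /= => sx sy.
- have x0 : x = 0 by lra.
  have y0 : y = 0 by lra.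
  by move: ge; rewrite /t x0 y0; lra.
- have abs : (a, b) \in s by apply: mem_s; rewrite !inE eqxx orbT.
  have [g1 g2 g3] := hf _ abs; have [h1 h2 h3] := hf _ xys.
  have ea : a = - x by lra.
  have eb : b = - y by lra.
  move: (sectorP (x, y)) g1 g2 g3 h1 h2 h3; rewrite /f1 /f2 /f3 /= ea eb => sc g1 g2 g3 h1 h2 h3.
  have u1 : s3^+2 * x = 3/4*x by rewrite ww.
  have u2 : s3^+2 * y = 3/4*y by rewrite ww.
  (* The projection [f] is that of the sector of [(x, y)]. The antipode has projection [-f <= t/2],
     whereas [f^2 > t - 1/4]; together they give [t - 1/4 < t^2/4], false on [[1, 9/4]]. *)
  suff [f [fn ft fl]] : exists f, [/\ f < 0, - f <= t/2 & t - 1/4 < f^+2] by nra.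
  case: sc => -[_ i j].
  - exists x; have [] := sector_narrow ww w0 ge le erefl i j h2 h3; split=> //; lra.
  - exists (-x/2+s3*y); have := @sector_narrow _ t (-x/2+s3*y) (-s3*x-y/2) s3 ww w0 ge le.
    by rewrite rotN_norm => /(_ erefl)[||||n0 _ n1]; first [lra|split=> //; lra].
  exists (-x/2-s3*y); have := @sector_narrow _ t (-x/2-s3*y) (s3*x-y/2) s3 ww w0 ge le.
  by rewrite rot_norm => /(_ erefl)[||||n0 _ n1]; first [lra|split=> //; lra].
have abs : (a, b) \in s by apply: mem_s; rewrite !inE eqxx orbT.
have cds : (c, d) \in s by apply: mem_s; rewrite !inE eqxx !orbT.
have e2 := dt _ abs; have e3 := dt _ cds.
move/ms: abs => [ka _]; move/ms: cds => [kc _]; rewrite rotE.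
have [[i j _ _]|[i j _ _]] := @triple_sum _ t x y a b c d s3 ww erefl e2 e3 ltac:(lra) ltac:(lra).
  by have -> : -x/2 - s3*y = a by [lra]; have -> : s3*x - y/2 = b by [lra].
by have -> : -x/2 - s3*y = c by [lra]; have -> : s3*x - y/2 = d by [lra].
Qed.
End TripleBall.

(** * Unit rings: symmetric, triangular, or with five asymmetric points *)

Section Star.
Variable R : realType.
Implicit Types (K : R -> R -> Prop) (s : seq (R * R)).
Local Notation s3 := (@s3 R).

Lemma sort_x s : uniq s -> {in s &, forall u v, u.1 = v.1 -> u = v} ->
  exists2 s', perm_eq s s' & sorted (fun u v => u.1 < v.1) s'.
Proof.
move=> us inj; pose le (u v : R * R) := u.1 <= v.1.
have pe : perm_eq s (sort le s) by rewrite perm_sym perm_sort.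
exists (sort le s) => //.
have so : sorted le (sort le s) by apply: sort_sorted => u v; exact: le_total.
have u' : uniq (sort le s) by rewrite sort_uniq.
have inj' : {in sort le s &, forall u v, u.1 = v.1 -> u = v}.
  by move=> u v; rewrite !mem_sort; exact: inj.
elim: (sort le s) so u' inj' => [//|a [//|b q] IH] /= /andP[ab so] /andP[na u'] inj'.
apply/andP; split; last first.
  by apply: IH => // u v hu hv; apply: inj'; rewrite inE ?hu ?hv orbT.
rewrite lt_neqAle [_ <= _]ab andbT; apply/eqP => e.
by move: na; rewrite (inj' a b _ _ e) ?inE ?eqxx ?orbT.
Qed.

Definition spread_top t c s := [/\ uniq s,
  forall x y, (x, y) \in s -> [/\ 0 < y, x^+2+y^+2 = t & -c <= x <= c] &
  forall x y x' y', (x, y) \in s -> (x', y') \in s -> (x, y) != (x', y') -> 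
    1 <= (x' - x)^+2 + (y'-y)^+2].

Lemma spread_top_sort t c s : spread_top t c s -> 
  exists s', [/\ perm_eq s s', spread_top t c s' & sorted (fun u v => u.1 < v.1) s'].
Proof.
move=> [us h sp]; have [s' pe so] := sort_x us (s := s) ltac:(
  move=> [a b] [a' b'] /h[p e _] /h[p' e' _] /= ea; congr pair => //; nra).
exists s'; split=> //; split; first by rewrite -(perm_uniq pe).
  by move=> x y; rewrite -(perm_mem pe); exact: h.
by move=> x y x' y'; rewrite -!(perm_mem pe); exact: sp.
Qed.

(** The chord bounds read backwards: the case distinction is which endpoint is farther from the
    vertical axis, since the bound is taken at that endpoint. *)
Lemma spread_chord t c s x y x' y' : spread_top t c s -> (x, y) \in s -> (x', y') \in s -> x < x' ->
  [/\ - x' < x -> 1 < 2 * (x' - x) * x', x' < - x -> 1 < 2 * (x' - x) * - x &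
      x' = - x -> 1 <= 2 * (x' - x) * x'].
Proof.
move=> [_ h sp] m m' l; have n : (x, y) != (x', y').
  by apply/eqP => -[e _]; move: l; rewrite e ltxx.
have := sp _ _ _ _ m m' n; have [p e _] := h _ _ m; have [p' e' _] := h _ _ m'.
move=> d; split=> k.
- by have := chord_lt p p' e e' k l; nra.
- have e1 : (-x)^+2 + y^+2 = t by rewrite sqrrN.
  have e2 : (-x')^+2 + y'^+2 = t by rewrite sqrrN.
  have := chord_lt p' p e2 e1; have := d; nra.
have : -x' <= x by lra.
by move=> k'; have := chord_le p p' e e' k' (ltW l); nra.
Qed.

(** Among four abscissas in [[-1, 1]], two consecutive steps away from the axis on one side
    overshoot 1 by [spread_chord]. If the middle step straddles the axis instead, the outer steps
    force it into [|x| < 1/2], where it is too short. *)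
Lemma spread_top_le3 t s : spread_top t 1 s -> (size s <= 3)%N.
Proof.
move=> /spread_top_sort[s' [pe sp so]]; rewrite (perm_size pe).
have [_ h _] := sp.
case: s' {pe} sp so h => [|[x1 y1] [|[x2 y2] [|[x3 y3] [|[x4 y4] q]]]] //= sp /and4P[l12 l23 l34 _] h; exfalso.
have m1 : (x1, y1) \in [:: (x1, y1), (x2, y2), (x3, y3), (x4, y4) & q] by rewrite !inE eqxx.
have m2 : (x2, y2) \in [:: (x1, y1), (x2, y2), (x3, y3), (x4, y4) & q] by rewrite !inE eqxx ?orbT.
have m3 : (x3, y3) \in [:: (x1, y1), (x2, y2), (x3, y3), (x4, y4) & q] by rewrite !inE eqxx ?orbT.
have m4 : (x4, y4) \in [:: (x1, y1), (x2, y2), (x3, y3), (x4, y4) & q] by rewrite !inE eqxx ?orbT.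
have [_ _ /andP[b1 _]] := h _ _ m1; have [_ _ /andP[_ b4]] := h _ _ m4.
have [c12 d12 _] := spread_chord sp m1 m2 l12.
have [c23 d23 e23] := spread_chord sp m2 m3 l23.
have [c34 d34 _] := spread_chord sp m3 m4 l34.
have [x20|x20] := leP 0 x2.
  have := c23 ltac:(lra); have := c34 ltac:(lra) => ? ?.
  have : 1/2 < x4 - x3 by nra.
  by nra.
have [x30|x30] := leP 0 x3; last first.
  have := d12 ltac:(lra); have := d23 ltac:(lra) => ? ?.
  have : 1/2 < x2 - x1 by nra.
  by nra.
have := c34 ltac:(lra); have := d12 ltac:(lra) => ? ?.
have ? : x3 < 1/2 by nra.
have ? : -(1/2) < x2 by nra.
have [e|e|e] := ltrgtP (- x3) x2; [have := c23 e|have := d23 ltac:(lra)|have := e23 ltac:(lra)]; nra.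
Qed.

(** In angles: the points lie in [[pi/3, pi[] and differ by at least [pi/3], so a third one does not
    fit. *)
Lemma spread_top_right s : spread_top 1 1 s -> (forall x y, (x, y) \in s -> x <= 1/2) -> (size s <= 2)%N.
Proof.
move=> /spread_top_sort[s' [pe sp so]] r; rewrite (perm_size pe).
have {}r x y : (x, y) \in s' -> x <= 1/2 by rewrite -(perm_mem pe); exact: r.
have [_ h _] := sp.
case: s' {pe} sp so h r => [|[x1 y1] [|[x2 y2] [|[x3 y3] q]]] //= sp /and3P[l12 l23 _] h r; exfalso.
have m1 : (x1, y1) \in [:: (x1, y1), (x2, y2), (x3, y3) & q] by rewrite !inE eqxx.
have m2 : (x2, y2) \in [:: (x1, y1), (x2, y2), (x3, y3) & q] by rewrite !inE eqxx ?orbT.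
have m3 : (x3, y3) \in [:: (x1, y1), (x2, y2), (x3, y3) & q] by rewrite !inE eqxx ?orbT.
have [_ _ /andP[b1 _]] := h _ _ m1; have r3 := r _ _ m3.
have [c12 d12 _] := spread_chord sp m1 m2 l12.
have [c23 d23 e23] := spread_chord sp m2 m3 l23.
have [x20|x20] := leP 0 x2; first by have := c23 ltac:(lra); nra.
have ? : -(1/2) < x2 by have := d12 ltac:(lra); nra.
have [e|e|e] := ltrgtP (- x3) x2; [have := c23 e|have := d23 ltac:(lra)|have := e23 ltac:(lra)]; nra.
Qed.

End Star.

Section Star2.
Variable R : realType.
Implicit Types (K : R -> R -> Prop) (s : seq (R * R)).
Local Notation s3 := (@s3 R).

Definition flip (v : R * R) : R * R := (v.1, - v.2).
Lemma flipK : involutive flip. Proof. by move=> [x y]; rewrite /flip /= opprK. Qed.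

Lemma asym_spread K t c s : conf K -> uniq s ->
  (forall x y, (x, y) \in s -> [/\ asym K t x y, 0 < y & -c <= x <= c]) -> spread_top t c s.
Proof.
move=> ck us h; split=> // [x y /h[[]]//|x y x' y' /h[a _ _] /h[a' _ _]].
exact: asym_sep ck a a'.
Qed.

Lemma asym_spread_flip K t c s : conf K -> uniq s ->
  (forall x y, (x, y) \in s -> [/\ asym K t x y, y < 0 & -c <= x <= c]) -> spread_top t c (map flip s).
Proof.
move=> ck us h; split; first by rewrite map_inj_uniq //; exact: inv_inj flipK.
  by move=> x y /mapP[[x' y'] /h[[_ e _] l c'] [-> ->]] /=; rewrite oppr_gt0 sqrrN.
move=> x y x' y' /mapP[[u v] /h[a _ _] [-> ->]] /mapP[[u' v'] /h[a' _ _] [-> ->]] /= n.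
have -> : (- v' - - v)^+2 = (v' - v)^+2 by ring.
by apply: asym_sep ck a a' _; apply: contraNneq n => -[-> ->].
Qed.

Lemma asym_unit_bound K x y : asym K 1 x y -> -1 <= x <= 1.
Proof. by move=> [_ e _]; apply/andP; split; nra. Qed.

(** The other asymmetric points lie off the axis with [x <= 1/2], at most two above and two below.
    The vertical balance needs both sides occupied. One and one give a triangle; one and two give
    four vectors, which cancel in antipodal pairs by [pair_sum], a contradiction; two and two give
    the five vectors. *)
Lemma star_asym K : conf K -> K 0 0 -> asym K 1 1 0 ->
  tri K \/ exists2 s, uniq s /\ size s = 5%N & 
    (forall x y, (x, y) \in s -> asym K 1 x y) /\ \sum_(v <- s) v.1 = 0 /\ \sum_(v <- s) v.2 = 0.
Proof.
move=> ck k0 a10; have [s us [ms sx sy]] := asym_seq 1 ck k0.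
have ms1 : (1, 0) \in s by apply/ms.
have pe := perm_to_rem ms1; set r := rem _ _ in pe.
have ur : uniq ((1, 0) :: r) by rewrite -(perm_uniq pe).
have mr x y : (x, y) \in r -> [/\ asym K 1 x y, y != 0 & x <= 1/2].
  move=> m; have a : asym K 1 x y by apply/ms; rewrite (perm_mem pe) inE m orbT.
  have ne : (x, y) != (1, 0) by apply: contraTneq m => ->; case/andP: ur.
  have [k e n] := a; split=> //; last first.
    by have := asym_sep ck a10 a; rewrite eq_sym => /(_ ne); lra.
  apply: contra_not_neq n => y0; move: e; rewrite y0 expr0n addr0 => /eqP.
  rewrite sqrf_eq1 => /orP[] /eqP x1; first by move: ne; rewrite x1 y0 eqxx.
  by rewrite x1 opprK oppr0; case: a10.
pose T := [seq v <- r | 0 < v.2]; pose B := [seq v <- r | ~~ (0 < v.2)].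
have uT : uniq T by rewrite filter_uniq //; case/andP: ur.
have uB : uniq B by rewrite filter_uniq //; case/andP: ur.
have mT x y : (x, y) \in T -> [/\ asym K 1 x y, 0 < y & x <= 1/2].
  by rewrite mem_filter => /andP[/= p /mr[a _ l]].
have mB x y : (x, y) \in B -> [/\ asym K 1 x y, y < 0 & x <= 1/2].
  by rewrite mem_filter -leNgt => /andP[/= p /mr[a n l]]; rewrite lt_neqAle n.
have sT : (size T <= 2)%N.
  apply: spread_top_right => [|x y /mT[]//].
  by apply: asym_spread ck uT _ => x y /mT[a p _]; split=> //; exact: asym_unit_bound a.
have sB : (size B <= 2)%N.
  rewrite -(size_map flip); apply: spread_top_right => [|x y /mapP[[u v] /mB[_ _ l] [-> _]] //].
  by apply: asym_spread_flip ck uB _ => x y /mB[a p _]; split=> //; exact: asym_unit_bound a.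
have pe2 : perm_eq s ((1, 0) :: T ++ B) by rewrite (perm_trans pe) // perm_cons perm_sym perm_filterC.
have msall x y : (x, y) \in (1, 0) :: T ++ B -> asym K 1 x y by move=> h; apply/ms; rewrite (perm_mem pe2).
have us2 : uniq ((1,0) :: T ++ B) by rewrite -(perm_uniq pe2).
move: sx sy; rewrite !(perm_big _ pe2) !big_cons !big_cat /=.
have ytop x y : (x, y) \in T -> 0 < y by case/mT.
have ybot x y : (x, y) \in B -> y < 0 by case/mB.
have smem x y : asym K 1 x y -> (x, y) \in (1,0) :: T ++ B by move=> /ms; rewrite (perm_mem pe2).
clear uT uB mT mB pe2; clearbody T B.
case: T sT msall us2 ytop smem => [|[a b] [|[c d] [|? ?]]] //= _ msall us2 ytop smem;
case: B sB msall us2 ybot smem => [|[p q] [|[u v] [|? ?]]] //= _ msall us2 ybot smem; rewrite ?big_cons ?big_nil /= => sx sy;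
  try by [exfalso; lra].
- by have := ybot p q (seq.mem_head _ _); lra.
- by have := ybot p q (seq.mem_head _ _); have := ybot u v (mem_second _ _ _); lra.
- by have := ytop a b (seq.mem_head _ _); lra.
- left; have a1 := msall _ _ (mem_second _ _ _).
  have a2 : asym K 1 p q by apply: msall; rewrite !inE eqxx !orbT.
  have a10' := a10; case: a10' a1 a2 => _ e1 _ [k2 e2 n2] [k3 e3 n3].
  have ww := s3_sq R; have w0 := s3_gt0 R.
  have bp := ytop a b (seq.mem_head _ _).
  have [f1 f2 f3 f4] : [/\ a = -1/2, b = s3, p = -1/2 & q = - s3].
    have [[]|[]] := @triple_sum _ 1 1 0 a b p q s3 ww e1 e2 e3 ltac:(lra) ltac:(lra) => i j k l; split; lra.
  move: msall smem k2 k3 n2 n3; rewrite {}f1 {}f2 {}f3 {}f4 => msall smem k2 k3 n2 n3.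
  have k1 : K 1 0 by case: a10. have n1 : ~ K (-1) 0 by case: a10; rewrite oppr0.
  move=> x y e; split=> [k|]; last by case=> -[-> ->].
  have [k'|n'] := pselect (K (-x) (-y)); last first.
    by have := smem x y (And3 k e n'); rewrite !inE => /or3P[] /eqP[-> ->]; [exact: Or31|exact: Or32|exact: Or33].
  have [|k1'] := sepP ck k1 k; first by move=> [-> ->]; exact: Or31.
  have [|k2'] := sepP ck k2 k; first by move=> [-> ->]; exact: Or32.
  have [|k3'] := sepP ck k3 k; first by move=> [-> ->]; exact: Or33.
  exfalso.
  have [[i j]|k1''] := sepP ck k1 k'.
    by apply: n1; rewrite -i -[X in K _ X]oppr0 -j !opprK.
  have [[i j]|k2''] := sepP ck k2 k'.
    by apply: n2; rewrite -i -j !opprK.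
  have [[i j]|k3''] := sepP ck k3 k'.
    by apply: n3; rewrite -i -j !opprK.
  (* A further symmetric pair would have all three projections on the triangle at most [1/2] in
     absolute value, but on the unit circle the squares of these projections add up to [3/2]. *)
  have b1 : x^+2 <= 1/4 by nra.
  have b2 : (-x/2+s3*y)^+2 <= 1/4 by nra.
  have b3 : (-x/2-s3*y)^+2 <= 1/4 by nra.
  have : s3^+2 * y^+2 = 3/4 * y^+2 by rewrite ww.
  lra.
- exfalso; have [_ e1 _] := a10.
  have a2 := msall a b (mem_second _ _ _).
  have a3 : asym K 1 p q by apply: msall; rewrite !inE eqxx !orbT.
  have a4 : asym K 1 u v by apply: msall; rewrite !inE eqxx !orbT.
  have [_ e2 _] := a2; have [_ e3 _] := a3; have [_ e4 _] := a4.
  have := ytop a b (seq.mem_head _ _) => bp.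
  have [|||||[f1 f2]|[f1 f2]] := @pair_sum _ 1 1 0 a b (-p) (-q) (-u) (-v) e1 e2; rewrite ?sqrrN ?sqrrN //; try lra.
  - by apply: (asymN a10 a3); lra.
  by apply: (asymN a10 a4); lra.
- by have := ytop a b (seq.mem_head _ _); have := ytop c d (mem_second _ _ _); lra.
- exfalso; have [_ e1 _] := a10.
  have a2 := msall a b (mem_second _ _ _).
  have a3 : asym K 1 c d by apply: msall; rewrite !inE eqxx !orbT.
  have a4 : asym K 1 p q by apply: msall; rewrite !inE eqxx !orbT.
  have [_ e2 _] := a2; have [_ e3 _] := a3; have [_ e4 _] := a4.
  have := ybot p q (seq.mem_head _ _) => bp.
  have [|||||[f1 f2]|[f1 f2]] := @pair_sum _ 1 1 0 p q (-a) (-b) (-c) (-d) e1 e4; rewrite ?sqrrN ?sqrrN //; try lra.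
  - by apply: (asymN a10 a2); lra.
  by apply: (asymN a10 a3); lra.
right; exists [:: (1, 0); (a, b); (c, d); (p, q); (u, v)]; first by [].
by split; [exact: msall|rewrite !big_cons !big_nil /=; split; lra].
Qed.
End Star2.

(** * Excluding five asymmetric unit vectors *)

Section Five.
Variable R : realType.
Implicit Types (K : R -> R -> Prop).
Local Notation s3 := (@s3 R).

Lemma asym_move K t c s x y : c^+2+s^+2 = 1 ->
  asym (move K 0 0 c s) t x y <-> asym K t (c*x-s*y) (s*x+c*y).
Proof.
move=> h; rewrite /asym /move.
have -> : 0 + c * x - s * y = c * x - s * y by ring.
have -> : 0 + s * x + c * y = s * x + c * y by ring.
have -> : 0 + c * - x - s * - y = - (c * x - s * y) by ring.
have -> : 0 + s * - x + c * - y = - (s * x + c * y) by ring.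
have -> : (c * x - s * y)^+2 + (s * x + c * y)^+2 = (c^+2+s^+2)*(x^+2+y^+2) by ring.
by rewrite h mul1r.
Qed.

Lemma tri_turn K c s a b : c^+2+s^+2 = 1 -> tri (move K 0 0 c s) -> a^+2+b^+2 = 1 -> K a b ->
  tri (move K 0 0 a b).
Proof.
move=> h tk e k; have ww := s3_sq R.
have n1 : (c*a + s*b)^+2+(c*b - s*a)^+2 = 1.
  have -> : (c*a + s*b)^+2+(c*b - s*a)^+2 = (c^+2+s^+2)*(a^+2+b^+2) by ring.
  by rewrite h e mulr1.
have k' : move K 0 0 c s (c*a+s*b) (c*b-s*a).
  rewrite /move; have -> : 0 + c * (c * a + s * b) - s * (c * b - s * a) = (c^+2+s^+2)*a by ring.
  have -> : 0 + s * (c * a + s * b) + c * (c * b - s * a) = (c^+2+s^+2)*b by ring.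
  by rewrite h !mul1r.
have ea : a = (c^+2+s^+2)*a by rewrite h mul1r.
have eb : b = (c^+2+s^+2)*b by rewrite h mul1r.
have fa : a = c*(c*a+s*b) - s*(c*b-s*a) by rewrite {1}ea; ring.
have fb : b = s*(c*a+s*b) + c*(c*b-s*a) by rewrite {1}eb; ring.
have tk1 := tri_rot tk; have tk2 := tri_rot tk1.
case: (tk _ _ n1).1 => // -[i j]; rewrite i j in fa fb.
- have -> : a = c by lra. have -> : b = s by lra. by [].
- move=> x y /tk1 <-; rewrite /rot {1}/move.
  by rewrite /move fa fb (_ : _ - _ = 0 + c * (0 + -1 / 2 * x - s3 * y) - s * (0 + s3 * x + -1 / 2 * y)); [rewrite (_ : 0 + (s * (-1 / 2) + c * s3) * x + (c * (-1 / 2) - s * s3) * y = 0 + s * (0 + -1 / 2 * x - s3 * y) + c * (0 + s3 * x + -1 / 2 * y)) //; field|field].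
move=> x y /tk2 <-; rewrite rot2E /move fa fb.
by rewrite (_ : _ - _ = 0 + c * (- x / 2 + s3 * y) - s * (- s3 * x - y / 2)); [rewrite (_ : 0 + (s * (-1 / 2) + c * - s3) * x + (c * (-1 / 2) - s * - s3) * y = 0 + s * (- x / 2 + s3 * y) + c * (- s3 * x - y / 2)) //; field|field].
Qed.

(** Extends [ball_sym] to squared radius 2. The pair of points at [(a, b)] and [(-a, -b)] blocks one
    end of each arc, so on one side the asymmetric abscissas lie, up to sign, in an interval of
    length at most [1 + 16/25], while they differ by at least [6/7]: there are at most two. *)
Lemma ring_sym_blocked K a b x y : conf K -> K 0 0 -> K 1 0 -> K (-1) 0 -> K a b -> K (-a) (-b) ->
  -7/10 <= a <= -1/2 -> 6/7 <= b <= 24/25 -> 9/5 <= x^+2+y^+2 <= 2 -> K x y -> K (-x) (-y).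
Proof.
move=> ck k0 k1 k2 kb kb' /andP[a1 a2] /andP[b1 b2] /andP[t1 t2] k.
apply: sym_ring k erefl => u v uv.
set t := _ + _ in t1 t2 uv.
have hy u' v' : asym K t u' v' -> (- (t/2) <= u' <= t/2) /\ (49/50 <= v' \/ v' <= - (49/50)).
  move=> h; have b3 := asym_near1 ck k1 k2 h; split=> //.
  case: h => _ e _; move/andP: b3 => [? ?].
  have : (49/50)^+2 <= v'^+2 by nra.
  by have [?|?] := leP (49/50) v'; [left|right; nra].
apply: (sym_of_two ck k0 (h := 49/50)) uv; [lra|lra|by move=> ? ? /hy[]|].
move=> e x1 y1 x2 y2 x3 y3 he h1 h2 h3 p1 p2 p3 n12 n13 n23.
have ee : e^+2 = 1 by case/orP: he => /eqP ->; rewrite ?sqrrN expr1n.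
have ke : K (e * a) (e * b) by case/orP: he => /eqP ->; rewrite ?mulN1r ?mul1r.
have hh u' v' : asym K t u' v' -> 0 < e * v' -> [/\ - (t/2) <= e*u', e*u' <= t/2, 49/50 <= e*v', e*u' > -16/25 & e * v' < 10/7].
  move=> h p; have [/andP[c1 c2] c3] := hy _ _ h; have [kk tt _] := h.
  have tt' : (e*u')^+2+(e*v')^+2 = t by rewrite !exprMn ee !mul1r.
  have q : 49/50 <= e * v' by case/orP: he p c3 => /eqP ->; lra.
  have [q1 q2] : - (t/2) <= e*u' /\ e*u' <= t/2 by case/orP: he => /eqP ->; lra.
  split=> //; last by nra.
  rewrite ltNge; apply/negP => q3.
  case: (sepP ck ke kk) => [[i j]|sp].
    by move: tt; rewrite i j !exprMn ee; nra.
  have : (u'-e*a)^+2+(v'-e*b)^+2 = e^+2*((u'-e*a)^+2+(v'-e*b)^+2) by rewrite ee mul1r.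
  have -> : e^+2*((u'-e*a)^+2+(v'-e*b)^+2) = (e*u'-e^+2*a)^+2+(e*v'-e^+2*b)^+2 by ring.
  rewrite ee !mul1r => sp'; rewrite sp' in sp.
  have m1 : (e*u'-a)^+2 <= 9/25 by nra.
  have m2 : e*v' <= 13/10 by nra.
  have m3 : (e*v'-b)^+2 <= 6/25 by nra.
  lra.
clear u v.
have key u v u' v' : asym K t u v -> asym K t u' v' -> 0 < e * v -> 0 < e * v' -> (u,v) != (u',v') -> 6/7 <= e * u - e * u' \/ e*u - e*u' <= - (6/7).
  move=> h h' p p' n; have sp := asym_sep ck h h' n.
  have [_ _ c3 _ c5] := hh _ _ h p; have [_ _ d3 _ d5] := hh _ _ h' p'.
  have : (u' - u)^+2 + (v'-v)^+2 = e^+2*((u' - u)^+2 + (v'-v)^+2) by rewrite ee mul1r.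
  have -> : e^+2*((u' - u)^+2 + (v'-v)^+2) = (e*u-e*u')^+2+(e*v-e*v')^+2 by ring.
  move=> sp'; rewrite sp' in sp.
  have m : (e*v-e*v')^+2 <= 1/4 by nra.
  have [?|?] := leP (6/7) (e * u - e * u'); [by left|right].
  by nra.
have [? ? _ ? _] := hh _ _ h1 p1; have [? ? _ ? _] := hh _ _ h2 p2; have [? ? _ ? _] := hh _ _ h3 p3.
have [] := key _ _ _ _ h1 h2 p1 p2 n12; have [] := key _ _ _ _ h1 h3 p1 p3 n13;
have [] := key _ _ _ _ h2 h3 p2 p3 n23; lra.
Qed.

End Five.

Section Five2.
Variable R : realType.
Implicit Types (K : R -> R -> Prop).
Local Notation s3 := (@s3 R).

Lemma shiftE K a b x y : move K a b 1 0 x y = K (a + x) (b + y).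
Proof. by rewrite /move !mul1r !mul0r subr0 addr0. Qed.

Definition anti K := forall x y, x^+2+y^+2 = 1 -> K x y -> K (-x) (-y).

Lemma size_le_pair (T : eqType) (s : seq T) (a b : T) : uniq s -> (forall v, v \in s -> v = a \/ v = b) ->
  (size s < 2)%N \/ perm_eq s [:: a; b].
Proof.
move=> us h; have [|lt] := ltnP (size s) 2; first by left.
right; have sub : {subset s <= [:: a; b]} by move=> v /h[->|->]; rewrite !inE eqxx ?orbT.
have ab : uniq [:: a; b].
  rewrite /= inE andbT; apply/eqP => e.
  have : (size s <= size [:: b])%N by apply: uniq_leq_size => // v /h; rewrite inE e => -[] ->.
  by rewrite leqNgt lt.
by apply: uniq_perm => //; have [] := uniq_min_size us sub lt.
Qed.

(** The summands are projections on the direction of angle [pi/6]. The three angles are below [pi],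
    at most [2 pi / 3] and at most [pi / 3], which bounds the projections below by [-s] (strictly),
    0 and [s]. *)
Lemma three_right_turn (s p1 q1 p2 q2 p3 q3 : R) : s^+2 = 3/4 -> 0 < s ->
  spread_top 1 1 [:: (p1, q1); (p2, q2); (p3, q3)] -> p1 < p2 -> p2 < p3 ->
  0 < (q1/2 + s * p1) + (q2/2 + s * p2) + (q3/2 + s * p3).
Proof.
move=> ss s0 sp l12 l23; have [_ h _] := sp.
have m1 : (p1, q1) \in [:: (p1, q1); (p2, q2); (p3, q3)] by rewrite !inE eqxx.
have m2 : (p2, q2) \in [:: (p1, q1); (p2, q2); (p3, q3)] by rewrite !inE eqxx ?orbT.
have m3 : (p3, q3) \in [:: (p1, q1); (p2, q2); (p3, q3)] by rewrite !inE eqxx ?orbT.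
have [c12 d12 _] := spread_chord sp m1 m2 l12.
have [c23 d23 e23] := spread_chord sp m2 m3 l23.
have [y1 e1 /andP[b1 _]] := h _ _ m1; have [y2 e2 _] := h _ _ m2.
have [y3 e3 /andP[_ b3]] := h _ _ m3.
have r2 : -(1/2) <= p2.
  by rewrite leNgt; apply/negP => n; have := d12 ltac:(lra); nra.
have r3 : 1/2 <= p3.
  rewrite leNgt; apply/negP => n; have [e|e|e] := ltrgtP (- p3) p2.
  - have c := c23 e; have p0 : 0 < p3 by nra.
    have : (p3 - p2) * p3 <= (p3+1/2) * p3 by nra.
    nra.
  - by have := d23 ltac:(lra); nra.
  by have := e23 ltac:(lra); nra.
have t1 : - s < q1/2 + s * p1 by nra.
have t2 : 0 <= q2/2 + s * p2.
  have [|n] := leP 0 p2; first by move=> ?; nra.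
  have : s <= q2 by nra.
  by nra.
have t3 : s <= q3/2 + s * p3.
  have : (s * (1-p3))^+2 <= (q3/2)^+2.
    by rewrite !exprMn ss; nra.
  have n1 : 0 <= s * (1-p3) by apply: mulr_ge0; lra.
  move=> sq; have : s * (1-p3) <= q3/2 by rewrite -(@ler_pXn2r _ 2) // nnegrE; lra.
  lra.
lra.
Qed.

(** The unit circles about [(1, 0)] and [(d, e)] meet at the origin and at the fourth vertex
    [(1 + d, e)] of the rhombus. A point of the first circle in the upper half plane, outside the
    second disc and other than the origin, lies beyond that vertex. *)
Lemma arc_bound (d e x y : R) : d^+2+e^+2 = 1 -> 0 < e -> -1 < x -> x^+2+y^+2= 1 -> 0 <= y ->
  1 <= (1+x-d)^+2+(y-e)^+2 -> d <= x.
Proof.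
move=> h e0 x1 h2 y0 c.
have c1 : y * e <= (1-d)*(1+x) by nra.
have c2 : (y * e)^+2 <= ((1-d)*(1+x))^+2 by have := mulr_ge0 y0 (ltW e0); nra.
have c3 : (1-x)*(1+x)*((1-d)*(1+d)) <= (1-d)*(1-d)*((1+x)*(1+x)).
  have -> : (1-x)*(1+x)*((1-d)*(1+d)) = (y*e)^+2.
    have -> : (y*e)^+2 = y^+2*e^+2 by ring.
    have -> : y^+2 = (1-x)*(1+x) by lra.
    have -> : e^+2 = (1-d)*(1+d) by lra.
    by [].
  lra.
have d1 : d < 1 by nra.
have x2 : 0 < 1 + x by lra.
have d2 : 0 < 1 - d by lra.
have : (1-x)*(1+d) <= (1-d)*(1+x).
  rewrite -(ler_pM2l x2) -(ler_pM2l d2); lra.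
lra.
Qed.

Lemma tri_conflict_eq (w d e d' : R) : w^+2 = 3/4 -> 0 < w -> d^+2+e^+2 = 1 -> 0 < e -> d < 1/2 ->
  d' <= d -> 1 - d' = - (1 - d) / 2 - w * - e -> False.
Proof.
move=> ww w0 hd e0 lt dd i.
have i2 : 3/2 * (1-d) <= w * e by lra.
have i3 : (3/2 * (1-d))^+2 <= (w*e)^+2 by apply: sqr_le => //; lra.
have i4 : (w*e)^+2 = 3/4*(1-d^+2) by rewrite exprMn ww -hd; ring.
rewrite i4 in i3.
have : (1 - 2*d) * (1-d) <= 0 by lra.
by have : 0 < (1 - 2*d) * (1-d) by [apply: mulr_gt0; lra]; lra.
Qed.

Lemma tri_conflict (w d e d' e' : R) : w^+2 = 3/4 -> 19/22 < w -> w < 13/15 ->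
  d^+2+e^+2 = 1 -> 0 < e -> 3/10 <= d -> d <= 1/2 ->
  d'^+2+e'^+2 = 1 -> 0 < e' -> 0 < d' -> d' < 1/2 ->
  (1 - d' - (- (1 - d) / 2 - w * - e))^+2 + (e' - (w * (1 - d) - - e / 2))^+2 < 1.
Proof.
move=> ww wl wr hd e0 d1 d2 hd' e'0 d'1 d'2.
have [eb1 eb2] : 6/7 <= e /\ e < 24/25 by split; clear -hd e0 d1 d2; nra.
have [fb1 fb2] : 6/7 <= e' /\ e' <= 1 by split; clear -hd' e'0 d'1 d'2; nra.
have [m1 m2] : 18/25 <= w * e /\ w * e <= 21/25 by split; clear -wl wr eb1 eb2; nra.
have [n1 n2] : 2/5 <= w * (1-d) /\ w * (1-d) <= 31/50 by split; clear -wl wr d1 d2; nra.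
have c1 : (1 - d' - (- (1 - d) / 2 - w * - e))^+2 <= (4/5)^+2 by apply: sqr_le; lra.
have c2 : (e' - (w * (1 - d) - - e / 2))^+2 <= (2/5)^+2 by apply: sqr_le; lra.
lra.
Qed.

(** Seen from [(1, 0)], the origin and [(d, e)] are the only candidates for asymmetric unit
    neighbours in the closed left half plane. So five asymmetric neighbours would need three on the
    right, and then exactly these two on the left, an equality case that fails. A triangle is
    refuted by its rotation symmetry. *)
Lemma nbr_anti K d e d' e' : conf K -> K 0 0 -> K 1 0 -> K d e -> K d' (-e') ->
  d^+2+e^+2 = 1 -> d'^+2+e'^+2 = 1 -> 0 < e -> 0 < e' -> 3/10 <= d <= 1/2 ->
  0 < d' < 1/2 -> d' <= d -> anti (move K 1 0 1 0).
Proof.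
move=> ck k0 k1 kd kd' hd hd' e0 e'0 /andP[d1 d2] /andP[d'1 d'2] dd.
set M := move K 1 0 1 0.
have cM : conf M by apply: conf_move => //; ring.
have ME x y : M x y = K (1+x) y by rewrite /M shiftE add0r.
have M0 : M 0 0 by rewrite ME addr0.
have M1 : M (-1) 0 by rewrite ME subrr.
have ww := s3_sq R; have w0 := s3_gt0 R; have [wl wr] := s3_bound R.
have hx x y : asym M 1 x y -> (x, y) != (-1, 0) -> (x, y) != (d-1, e) -> 0 < x.
  move=> [k h _] n1 n2; rewrite ME in k.
  have x1 : -1 < x.
    rewrite lt_neqAle; apply/andP; split; last by nra.
    apply: contra_neq n1 => x1; rewrite -x1; congr pair; move: h; rewrite -x1 => h; nra.
  have [y0|y0] := leP 0 y.
    suff : d <= x by lra.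
    apply: (arc_bound hd e0 x1 h y0).
    have [[i j]|//] := sepP ck kd k.
    by move: n2; rewrite -j -i (addrC 1) addrK eqxx.
  suff : d' <= x by lra.
  have h' : x^+2 + (-y)^+2 = 1 by rewrite sqrrN.
  apply: (arc_bound hd' e'0 x1 h' ltac:(lra)).
  have [[i j]|sp] := sepP ck kd' k; last by nra.
  by exfalso; nra.
have [//|nanti] := pselect (anti M); exfalso.
have [x0 [y0 a0]] : exists x y, asym M 1 x y.
  apply: contrapT => n; apply: nanti => x y h k.
  by apply: contrapT => n'; apply: n; exists x, y.
have [_ h0 _] := a0.
have : asym (move M 0 0 x0 y0) 1 1 0 by apply/asym_move => //; rewrite !mulr1 !mulr0 subr0 addr0.
move=> /(star_asym (conf_move _ _ h0 cM)); rewrite /move !mulr0 subr0 !addr0 -/(move M 0 0 x0 y0) => /(_ M0)[tM|].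
  (* Triangle case, with the triangle oriented towards the old origin: rotating [(d, e)] about the
     neighbour by [tri_ball] produces a point too close to [(d', -e')]. *)
  have := tri_turn h0 tM _ M1; set N := move M 0 0 (-1) 0 => /(_ ltac:(lra)) tN.
  have cN : conf N by apply: conf_move => //; lra.
  have NE x y : N x y = M (-x) (-y) by rewrite /N /move !mulN1r !mul0r subr0 !add0r.
  have N0 : N 0 0 by rewrite NE oppr0.
  have Nb : N (1-d) (-e) by rewrite NE ME opprK; have -> : 1 + - (1-d) = d by ring.
  have Ne : N (1-d') e' by rewrite NE ME; have -> : 1 + - (1-d') = d' by ring.
  have [dh|dh] := eqVneq d (1/2).
    have n1 : (1-d)^+2 + (-e)^+2 = 1 by nra.
    have [[i j]|[i j]|[i j]] := (tN _ _ n1).1 Nb; lra.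
  have lt : d < 1/2 by rewrite lt_neqAle dh.
  have := tri_ball cN N0 tN Nb; rewrite rotE => /(_ ltac:(nra)) kr.
  have [[i j]|sp] := sepP cN kr Ne.
    by apply: (tri_conflict_eq ww w0 hd e0 lt dd i).
  by have := tri_conflict ww wl wr hd e0 d1 d2 hd' e'0 d'1 d'2; lra.
move=> [s [us sz] [ms [sx sy]]].
(* This undoes the rotation of the frame and exchanges the coordinates, so that the right half plane
   becomes the upper one and [spread_top_le3] counts its points. *)
pose g (v : R * R) := (y0 * v.1 + x0 * v.2, x0 * v.1 - y0 * v.2).
have ginj : injective g.
  move=> [a b] [a' b'] [i j].
  have u1 : (x0^+2+y0^+2)*a = (x0^+2+y0^+2)*a'.
    have -> : (x0^+2+y0^+2)*a = y0 * (y0*a+x0*b) + x0*(x0*a-y0*b) by ring.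
    by rewrite i j; ring.
  have u2 : (x0^+2+y0^+2)*b = (x0^+2+y0^+2)*b'.
    have -> : (x0^+2+y0^+2)*b = x0 * (y0*a+x0*b) - y0*(x0*a-y0*b) by ring.
    by rewrite i j; ring.
  by move: u1 u2; rewrite h0 !mul1r => -> ->.
pose L := map g s.
have uL : uniq L by rewrite map_inj_uniq.
have sL : size L = 5%N by rewrite size_map.
have mL p q : (p, q) \in L -> asym M 1 q p.
  by move=> /mapP[[a b] /ms /asym_move-/(_ h0) h [-> ->]].
have lx : \sum_(v <- L) v.1 = 0 by rewrite big_map big_split /= -!mulr_sumr sx sy; ring.
have ly : \sum_(v <- L) v.2 = 0 by rewrite big_map sumrB /= -!mulr_sumr sx sy; ring.
pose T := [seq v <- L | 0 < v.2]; pose C := [seq v <- L | ~~ (0 < v.2)].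
have pe : perm_eq L (T ++ C) by rewrite perm_sym perm_filterC.
have uT : uniq T by rewrite filter_uniq.
have uC : uniq C by rewrite filter_uniq.
have sT : spread_top 1 1 T.
  split=> // [p q|p q p' q'].
    rewrite mem_filter => /andP[/= q0 /mL h]; split=> //; first by case: h => _ h _; lra.
    by case: h => _ h _; apply/andP; split; nra.
  rewrite !mem_filter => /andP[_ /mL h] /andP[_ /mL h'] n.
  have : (q, p) != (q', p') by apply: contra_neq n => -[-> ->].
  by move=> /(asym_sep cM h h'); lra.
have T3 := spread_top_le3 sT.
have mC v : v \in C -> v = (0, -1) \/ v = (e, d-1).
  case: v => p q; rewrite mem_filter => /andP[/= q0 /mL h].
  have [[-> ->]|n1] := eqVneq (q, p) (-1, 0); first by left.
  have [[-> ->]|n2] := eqVneq (q, p) (d-1, e); first by right.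
  by move: q0; rewrite (hx _ _ h n1 n2).
have [C1|pC] := size_le_pair uC mC.
  have := perm_size pe; rewrite sL size_cat => s5.
  by move: (leq_add T3 C1); rewrite addnS -s5.
have T3' : size T = 3%N.
  by have := perm_size pe; rewrite sL size_cat (perm_size pC) /= addn2 => -[].
have hC : (e, d-1) \in L.
  have : (e, d-1) \in C by rewrite (perm_mem pC) !inE eqxx orbT.
  by rewrite mem_filter => /andP[].
have dh : d = 1/2 by case: (mL _ _ hC) => _ h _; nra.
have eh : e^+2 = 3/4 by rewrite dh in hd; lra.
move: lx ly; rewrite !(perm_big _ pe) !big_cat /= !(perm_big _ pC) !big_cons !big_nil /= => lx ly.
have [T' [pT sT' so]] := spread_top_sort sT.
move: T3' lx ly; rewrite (perm_size pT) !(perm_big _ pT).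
case: T' sT' so {pT} => [|[p1 q1] [|[p2 q2] [|[p3 q3] [|? ?]]]] //= sT' /and3P[l1 l2 _] _.
rewrite !big_cons !big_nil /= => lx ly.
(* With [d = 1/2] and [e^2 = 3/4] the balance makes the projections add up to [3/4 - e^2 = 0],
   whereas they are strictly positive. *)
have := three_right_turn eh e0 sT' l1 l2.
have -> : q1 / 2 + e * p1 + (q2 / 2 + e * p2) + (q3 / 2 + e * p3) = (q1+q2+q3)/2 + e * (p1+p2+p3) by field.
have -> : q1+q2+q3 = 3/2 by lra.
have -> : p1+p2+p3 = -e by lra.
nra.
Qed.

End Five2.

Section Five3.
Variable R : realType.
Implicit Types (K : R -> R -> Prop).

Lemma asym_dot K x y x' y' : conf K -> asym K 1 x y -> asym K 1 x' y' -> (x, y) != (x', y') ->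
  x*x'+y*y' <= 1/2.
Proof. by move=> ck a a' n; have := asym_sep ck a a' n; case: a => _ e _; case: a' => _ e' _; lra. Qed.

Lemma lower_cross (x y x' y' : R) : x^+2+y^+2 = 1 -> x'^+2+y'^+2 = 1 -> y < 0 -> y' < 0 -> x < x' ->
  0 < x * y' * -1 + y * x' -> False.
Proof.
move=> e e' y0 y'0 l h.
have [p|p] := leP 0 x.
  have : y < y' by nra.
  nra.
have [q|q] := leP 0 x'; first by nra.
have : y' < y by nra.
nra.
Qed.

(* The middle vector m is a nonnegative combination of l and r; pairing this
   with m and with l + r gives 1 + l.r <= 2 d^2 *)
Lemma cone_bound (d xl yl xm ym xr yr : R) :
  xl^+2+yl^+2 = 1 -> xm^+2+ym^+2 = 1 -> xr^+2+yr^+2 = 1 ->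
  yl < 0 -> ym < 0 -> yr < 0 -> xl < xm -> xm < xr ->
  xl*xm+yl*ym <= d -> xm*xr+ym*yr <= d -> 0 < d /\ 1 + (xl*xr+yl*yr) <= 2*d^+2.
Proof.
move=> el em er yl0 ym0 yr0 l1 l2 d1 d2.
have C1 : 0 <= xm*yr - ym*xr by rewrite leNgt; apply/negP => h; apply: (lower_cross em er) => //; lra.
have C2 : 0 <= xl*ym - yl*xm by rewrite leNgt; apply/negP => h; apply: (lower_cross el em) => //; lra.
have C : 0 <= xl*yr - yl*xr by rewrite leNgt; apply/negP => h; apply: (lower_cross el er) => //; lra.
have nz : xl*yr - yl*xr != 0.
  apply/eqP => z.
  have z2 : (xl*xr+yl*yr)^+2 = 1.
    have : (xl*yr - yl*xr)^+2 + (xl*xr+yl*yr)^+2 = (xl^+2+yl^+2)*(xr^+2+yr^+2) by ring.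
    by rewrite z el er; lra.
  move/eqP: z2; rewrite sqrf_eq1 => /orP[] /eqP z2.
    have : (xl-xr)^+2+(yl-yr)^+2 = 0 by lra.
    by have := sqr_ge0 (yl-yr); have : 0 < (xl-xr)^+2 by [rewrite exprn_even_gt0 // subr_eq0; lra]; lra.
  have : (xl+xr)^+2+(yl+yr)^+2 = 0 by lra.
  by have := sqr_ge0 (xl+xr); have : 0 < (yl+yr)^+2 by [rewrite exprn_even_gt0 //=; lra]; lra.
have {C nz} C : 0 < xl*yr - yl*xr by rewrite lt_neqAle eq_sym nz.
set c1 := xm*yr - ym*xr in C1; set c2 := xl*ym - yl*xm in C2; set c := xl*yr - yl*xr in C.
set a := xl*xm+yl*ym in d1; set b := xm*xr+ym*yr in d2; set e := xl*xr+yl*yr.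
have i1 : c = c1 * a + c2 * b.
  have -> : c1*a+c2*b = c*(xm^+2+ym^+2) by rewrite /c /c1/c2/a/b; ring.
  by rewrite em mulr1.
have i2 : c * (a + b) = (c1+c2)*(1+e).
  have -> : c * (a+b) = c1 * (xl^+2+yl^+2+e) + c2*(e+(xr^+2+yr^+2)) by rewrite /c/c1/c2/a/b/e; ring.
  by rewrite el er; ring.
clearbody c1 c2 c a b e.
have s0 : 0 < c1 + c2.
  rewrite lt_neqAle addr_ge0 // andbT eq_sym; apply/eqP => z.
  have z1 : c1 = 0 by lra. have z2 : c2 = 0 by lra.
  by move: C; rewrite i1 z1 z2 !mul0r addr0 ltxx.
have i3 : c <= (c1+c2)*d.
  by rewrite i1 mulrDl; have := ler_wpM2l C1 d1; have := ler_wpM2l C2 d2; lra.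
have d0 : 0 < d by have : 0 < (c1+c2)*d by [lra]; rewrite pmulr_rgt0.
split=> //.
rewrite -(ler_pM2l s0) -i2.
have : c * (a+b) <= c * (2*d) by rewrite ler_pM2l //; lra.
have : c * (2*d) <= (c1+c2)*d*(2*d) by rewrite ler_pM2r //; lra.
by rewrite -mulrA (_ : d * (2*d) = 2 * d^+2); [lra|ring].
Qed.

Lemma low_bound (q y x y' x' ym xm : R) : q < 13/15 -> xm^+2+ym^+2 = 1 ->
  x^+2+y^+2 = 1 -> x'^+2+y'^+2= 1 -> y < -7/25 -> y' < -7/25 -> x' + xm + x = 0 ->
  y' + ym + y = -2 * q -> -13/15 <= y' + y -> 0 < x -> x' < 0 -> ym < 0 -> -47/100 <= y.
Proof.
move=> q3 em e e' b b' hx hy lr x0 x'0 ym0.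
rewrite leNgt; apply/negP => h.
have a2 : 3/100 <= xm^+2.
  have : ym^+2 <= (59/60)^+2 by rewrite -(sqrrN ym); apply: sqr_le; lra.
  lra.
have y1 : y^+2 <= (3/5)^+2 by rewrite -(sqrrN y); apply: sqr_le; lra.
have y2 : y'^+2 <= (2/5)^+2 by rewrite -(sqrrN y'); apply: sqr_le; lra.
have c1 : x < 8/9 by clear -h e x0; nra.
have c2 : 4/5 <= x by clear -y1 e x0; nra.
have c3 : x' < -9/10 by clear -y2 e' x'0; nra.
have c4 : -24/25 <= x' by clear -b' e' x'0; nra.
have := @sqr_le _ xm (4/25) ltac:(lra) ltac:(lra); lra.
Qed.

(** The vectors [(p, q)] and [(-p, q)] have inner product [q^2 - p^2] and sum [(0, 2 * q)]. The
    squared length of [v1 + v2], computed through [v3], is at most [2 + 2 * (q^2 - p^2) = 4 * q^2],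
    which is the claim. *)
Lemma five_low (p q x1 y1 x2 y2 x3 y3 : R) : p^+2+q^+2 = 1 ->
  x1^+2+y1^+2 = 1 -> x2^+2+y2^+2 = 1 -> x3^+2+y3^+2 = 1 ->
  x1+x2+x3 = 0 -> y1+y2+y3 = -2 * q -> x1*x2+y1*y2 <= q^+2-p^+2 -> 4 * q * y3 <= -1.
Proof.
move=> hp e1 e2 e3 sx sy d.
have : x3^+2 + (y3+2*q)^+2 = 2 + 2*(x1*x2+y1*y2).
  by have -> : x3 = -(x1+x2) by [lra]; have -> : y3 = - (2*q) - (y1+y2) by [lra]; lra.
lra.
Qed.

(** The normal position of five vectors: [(p, q)] and [(-p, q)] are the two closest ones, so their
    inner product bounds all others, and the remaining three add up to [(0, -2 * q)]. The outer two
    of the three are confined to a narrow strip below the axis. *)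
Lemma five_bounds (p q xl yl xm ym xr yr : R) : p^+2+q^+2= 1 -> 0 < p -> 0 < q ->
  xl^+2+yl^+2 = 1 -> xm^+2+ym^+2 = 1 -> xr^+2+yr^+2 = 1 -> xl < xm -> xm < xr ->
  xl+xm+xr = 0 -> yl+ym+yr = - 2 * q -> q^+2-p^+2 <= 1/2 ->
  xl*xm+yl*ym <= q^+2-p^+2 -> xm*xr+ym*yr <= q^+2-p^+2 -> xl*xr+yl*yr <= q^+2-p^+2 ->
  [/\ 3/10 <= q^+2-p^+2, -47/100 <= yr, yr < -7/25, 0 < xr & [/\ -47/100 <= yl, yl < -7/25 & xl < 0]].
Proof.
move=> hp p0 q0 el em er l1 l2 sx sy d12 dlm dmr dlr.
have q2 : q^+2 <= 3/4 by lra.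
have q3 : q < 13/15 by clear -q0 q2; nra.
have bl := five_low hp em er el ltac:(lra) ltac:(lra) dmr.
have br := five_low hp el em er ltac:(lra) ltac:(lra) dlm.
have bm := five_low hp el er em ltac:(lra) ltac:(lra) dlr.
have n y : 4 * q * y <= -1 -> y < -7/25 by clear -q0 q3; move=> h; nra.
have yl0 := n _ bl; have ym0 := n _ bm; have yr0 := n _ br.
have [d0 e2] := cone_bound el em er ltac:(lra) ltac:(lra) ltac:(lra) l1 l2 dlm dmr.
set d := q^+2-p^+2 in d12 dlm dmr dlr d0 e2 *.
have dq : q^+2 = (1+d)/2 by rewrite /d; lra.
have m1 : 4 * q * ym <= 4*d^+2 - 1 - 4*q^+2.
  have : (xm)^+2 + (ym+2*q)^+2 = 2 + 2*(xl*xr+yl*yr).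
    have -> : xm = -(xr+xl) by lra. have -> : ym = - (2*q) - (yr+yl) by lra.
    lra.
  lra.
have qs : 4 * q * (yl + yr) = - 8 * q^+2 - 4 * q * ym.
  by have -> : yl + yr = -2*q - ym by [lra]; ring.
(* The bounds combine to [4 * d^2 + 2 * d - 1 >= 0], that is, [d >= cos (2 pi / 5)], the value of
   the regular pentagon; [3/10] is a rational bound just below it. *)
have d3 : 3/10 <= d by clear -d0 qs m1 bl br dq; nra.
have q65 : 4/5 < q by clear -d3 dq q0; nra.
have lr : -13/15 <= yl + yr.
  rewrite -(@ler_pM2l _ (4*q)) ?qs; last by lra.
  by clear -d3 d12 m1 dq q65 q3; nra.
have xr0 : 0 < xr by lra.
have xl0 : xl < 0 by lra.
split=> //; first by apply: (low_bound q3 em er el) => //; lra.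
split=> //; apply: (@low_bound q yl (-xl) yr (-xr) ym (-xm)); rewrite ?sqrrN //; lra.
Qed.
End Five3.

Section Five4.
Variable R : realType.
Implicit Types (K : R -> R -> Prop).

Definition mir K x y := K (-x) y.

Lemma conf_mir K : conf K -> conf (mir K).
Proof.
move=> ck; have -> : mir K = move (fun x y => K x (-y)) 0 0 (-1) 0.
  by apply/funext => x; apply/funext => y; rewrite /mir /move; congr K; ring.
by apply: conf_move; [ring|exact: conf_flip].
Qed.

(** In the frame with first axis [(p, q)] the points [(-p, q)] and [(x, y)] take the roles of the
    upper and lower neighbours in [nbr_anti], so the unit ring of [(p, q)] is symmetric. The small
    rings around it are then symmetric as well, which reflects [(x, y)] through [(p, q)]. *)
Lemma extend_right K p q x y : conf K -> K 0 0 -> K p q -> K (-p) q -> K x y ->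
  p^+2+q^+2 = 1 -> 0 < p -> 0 < q -> x^+2+y^+2 = 1 -> 3/10 <= q^+2-p^+2 <= 1/2 ->
  0 < p*x+q*y < 1/2 -> p*x+q*y <= q^+2-p^+2 -> 0 < q*x-p*y -> K (2* p-x) (2*q-y).
Proof.
move=> ck k0 k1 k2 k3 hp p0 q0 hx dd d' ld e'0.
set K1 := move K 0 0 p q; have c1 : conf K1 by exact: conf_move.
pose d := q^+2-p^+2; pose e := 2* p*q; pose f := p*x+q*y; pose g := q*x-p*y.
have K1E a b : K1 a b = K (p*a-q*b) (q*a+p*b) by rewrite /K1 /move !add0r.
have i0 : K1 0 0 by rewrite K1E !mulr0 subr0 addr0.
have i1 : K1 1 0 by rewrite K1E !mulr0 subr0 addr0 !mulr1.
have i2 : K1 d e.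
  rewrite K1E /d /e.
  have -> : p * (q^+2-p^+2) - q * (2* p*q) = - ((p^+2+q^+2)* p) by ring.
  have -> : q * (q^+2-p^+2) + p * (2* p*q) = (p^+2+q^+2)*q by ring.
  by rewrite hp !mul1r.
have i3 : K1 f (-g).
  rewrite K1E /f /g.
  have -> : p * (p * x + q * y) - q * - (q * x - p * y) = (p^+2+q^+2)*x by ring.
  have -> : q * (p * x + q * y) + p * - (q * x - p * y) = (p^+2+q^+2)*y by ring.
  by rewrite hp !mul1r.
have e0 : 0 < e by rewrite /e !mulr_gt0.
have hd : d^+2+e^+2 = 1.
  by have -> : d^+2+e^+2 = (p^+2+q^+2)^+2 by [rewrite /d/e; ring]; rewrite hp expr1n.
have hf : f^+2+g^+2 = 1.
  have -> : f^+2+g^+2 = (p^+2+q^+2)*(x^+2+y^+2) by rewrite /f/g; ring.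
  by rewrite hp hx mulr1.
have aM := nbr_anti c1 i0 i1 i2 i3 hd hf e0 e'0 dd d' ld.
have cM : conf (move K1 1 0 1 0) by apply: conf_move => //; ring.
set M := move K1 1 0 1 0 in aM cM.
have ME a b : M a b = K1 (1+a) b by rewrite /M shiftE add0r.
have m0 : M 0 0 by rewrite ME addr0.
have mn : M (-1) 0 by rewrite ME subrr.
have m1 : M 1 0.
  by have := aM (-1) 0 ltac:(ring) mn; rewrite opprK oppr0.
have md : M (d-1) e by rewrite ME addrC subrK.
have mf : M (f-1) (-g) by rewrite ME addrC subrK.
move: dd d' ld; rewrite -/d -/f => /andP[d1 d2] /andP[f1 f2] ld.
have md' : M (-(d-1)) (-e) by apply: ball_sym => //; clear -hd d1; lra.
suff : M (-(f-1)) (- - g).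
  rewrite ME K1E opprK /f /g.
  have -> : p * (1 + - (p * x + q * y - 1)) - q * (q * x - p * y) = 2* p - (p^+2+q^+2)*x by ring.
  have -> : q * (1 + - (p * x + q * y - 1)) + p * (q * x - p * y) = 2*q - (p^+2+q^+2)*y by ring.
  by rewrite hp !mul1r.
have [t1|t1] := leP ((f-1)^+2+(-g)^+2) (9/5); first exact: ball_sym.
apply: (ring_sym_blocked cM m0 m1 mn md md') => //.
- by apply/andP; split; clear -d1 d2; lra.
- by apply/andP; split; clear -hd e0 d1 d2; nra.
by apply/andP; split; clear -t1 hf f1; lra.
Qed.

(** Reflecting the right outer vector through [(p, q)] and the left outer one through [(-p, q)]
    gives two distinct points at distance less than 1. *)
Lemma five_bisector K p q xl yl xm ym xr yr : conf K -> K 0 0 -> K p q -> K (-p) q -> K xl yl -> K xr yr ->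
  p^+2+q^+2= 1 -> 0 < p -> 0 < q ->
  xl^+2+yl^+2 = 1 -> xm^+2+ym^+2 = 1 -> xr^+2+yr^+2 = 1 -> xl < xm -> xm < xr ->
  xl+xm+xr = 0 -> yl+ym+yr = - 2 * q -> q^+2-p^+2 <= 1/2 ->
  xl*xm+yl*ym <= q^+2-p^+2 -> xm*xr+ym*yr <= q^+2-p^+2 -> xl*xr+yl*yr <= q^+2-p^+2 ->
  p*xr+q*yr <= q^+2-p^+2 -> - p*xl+q*yl <= q^+2-p^+2 -> False.
Proof.
move=> ck k0 k1 k2 kl kr hp p0 q0 el em er l1 l2 sx sy d2 dlm dmr dlr dr dl.
have [d1 r1 r2 r3 [s1 s2 s3]] := five_bounds hp p0 q0 el em er l1 l2 sx sy d2 dlm dmr dlr.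
clear dlm dmr dlr l1 l2 sx sy em.
have [q1 q2] : 4/5 <= q /\ q < 13/15 by split; clear -hp q0 d1 d2; nra.
have [p1 p2] : 1/2 <= p /\ p <= 3/5 by split; clear -hp p0 d1 d2; nra.
have hbound x y : x^+2+y^+2 = 1 -> 0 < x -> -47/100 <= y -> y < -7/25 ->
  [/\ 22/25 <= x, x <= 24/25 & [/\ 0 < p*x+q*y, p*x+q*y < 1/2 & 0 < q*x-p*y]].
  clear -q1 q2 p1 p2 => e x0 y1 y2.
  have x1 : 22/25 <= x by clear -e x0 y1 y2; nra.
  have x2 : x <= 24/25 by clear -e x0 y2; nra.
  split=> //; split.
  - have : 11/25 <= p * x by clear -p1 x1; nra.
    by have : -41/100 <= q * y by [clear -q1 q2 y1 y2; nra]; lra.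
  - have : p * x <= 72/125 by clear -p2 x2 p1 x1; nra.
    by have : q * y <= -28/125 by [clear -q1 y2; nra]; lra.
  by clear -p1 q1 x1 y2; nra.
have [xr1 xr2 [r4 r5 r6]] := hbound _ _ er r3 r1 r2.
have el' : (-xl)^+2+yl^+2 = 1 by rewrite sqrrN.
have xl0 : 0 < -xl by lra.
have [xl1 xl2 [s4 s5 s6]] := hbound _ _ el' xl0 s1 s2.
have kX : K (2* p-xr) (2*q-yr).
  by apply: extend_right => //; apply/andP.
have kY : mir K (2* p - -xl) (2*q-yl).
  apply: (@extend_right (mir K)) => //; rewrite /mir ?oppr0 ?opprK //; first exact: conf_mir.
  - by apply/andP.
  - by apply/andP.
  by lra.
rewrite /mir in kY.
have [[i j]|sp] := sepP ck kX kY; first by lra.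
have a1 : (- (2 * p - - xl) - (2 * p - xr))^+2 <= (4/5)^+2 by apply: sqr_le; lra.
have a2 : (2 * q - yl - (2 * q - yr)) ^+ 2 <= (1/5)^+2 by apply: sqr_le; lra.
lra.
Qed.

End Five4.

Section Five5.
Variable R : realType.
Implicit Types (K : R -> R -> Prop).

Lemma sum_perm (T : eqType) (F : T -> R) (s s' : seq T) : perm_eq s s' ->
  \sum_(v <- s) F v = \sum_(v <- s') F v.
Proof. exact: perm_big. Qed.

Lemma seq_max (T : eqType) (f : T -> R) (s : seq T) : s != [::] ->
  exists2 m, m \in s & forall x, x \in s -> f x <= f m.
Proof.
elim: s => [//|a [|b s] IH] _.
  by exists a; [exact: seq.mem_head|move=> x; rewrite inE => /eqP ->].
have [//|m ms mx] := IH; have [l|l] := leP (f a) (f m).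
  exists m; first by rewrite inE ms orbT.
  by move=> x; rewrite inE => /orP[/eqP ->|/mx].
exists a; first exact: seq.mem_head.
by move=> x; rewrite inE => /orP[/eqP ->|/mx h] //; rewrite (le_trans h) // ltW.
Qed.

(** Choosing the pair with the largest inner product and turning its bisector to the vertical axis
    gives the normal position of [five_bounds]; the other three vectors lie below the axis by
    [five_low], so they are ordered by abscissa. *)
Lemma five_false K s : conf K -> K 0 0 -> uniq s -> size s = 5%N ->
  (forall x y, (x, y) \in s -> asym K 1 x y) ->
  \sum_(v <- s) v.1 = 0 -> \sum_(v <- s) v.2 = 0 -> False.
Proof.
move=> ck k0 us sz ms sx sy.
pose dot (w : (R*R)*(R*R)) := w.1.1 * w.2.1 + w.1.2*w.2.2.
pose L := [seq w <- [seq (u, v) | u <- s, v <- s] | w.1 != w.2].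
have mL u v : ((u, v) \in L) = [&& u != v, u \in s & v \in s].
  rewrite mem_filter /=; congr andb; apply/allpairsP/andP => [[[a b] [? ? [-> ->]]]//|[? ?]].
  by exists (u, v).
have Ln : L != [::].
  have [a [b [ma mb ab]]] : exists a b, [/\ a \in s, b \in s & a != b].
    case: (s) us sz => [|a [|b s']] //= /andP[]; rewrite inE negb_or => /andP[ab _] _ _.
    by exists a, b; rewrite ab !inE !eqxx orbT.
  have : (a, b) \in L by rewrite mL ab ma.
  by case: (L).
have [[u1 u2] /[!mL] /and3P[n12 m1 m2] mx] := seq_max dot Ln.
have {mx}dmax u v : u \in s -> v \in s -> u != v -> u.1*v.1+u.2*v.2 <= u1.1*u2.1+u1.2*u2.2.
  by move=> mu mv n; apply: (mx (u, v)); rewrite mL n mu mv.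
clear L mL Ln.
have au v : v \in s -> asym K 1 v.1 v.2 by case: v => x y /ms.
have nu v : v \in s -> v.1^+2+v.2^+2 = 1 by move=> /au[].
have dle u v : u \in s -> v \in s -> u != v -> u.1*v.1+u.2*v.2 <= 1/2.
  move=> mu mv n; apply: asym_dot ck (au _ mu) (au _ mv) _.
  by case: u v n {mu mv} => [? ?] [? ?].
wlog or : u1 u2 n12 m1 m2 dmax / 0 < u1.1*u2.2-u1.2*u2.1.
  move=> wl; have [l|l|e] := ltrgt0P (u1.1*u2.2-u1.2*u2.1).
  - exact: (wl u1 u2).
  - apply: (wl u2 u1) => //; [by rewrite eq_sym| |lra].
    by move=> u v mu mv n; have := dmax u v mu mv n; lra.
  have n1 := nu _ m1; have n2 := nu _ m2.
  have : (u1.1*u2.1+u1.2*u2.2)^+2 = 1.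
    have : (u1.1*u2.1+u1.2*u2.2)^+2 + (u1.1*u2.2-u1.2*u2.1)^+2 = (u1.1^+2+u1.2^+2)*(u2.1^+2+u2.2^+2) by ring.
    by rewrite e n1 n2; lra.
  move/eqP; rewrite sqrf_eq1 => /orP[] /eqP z; first by have := dle _ _ m1 m2 n12; lra.
  have z1 : (u1.1+u2.1)^+2+(u1.2+u2.2)^+2 = 0 by lra.
  have z2 := sqr_ge0 (u1.1+u2.1); have z3 := sqr_ge0 (u1.2+u2.2).
  have /eqP : (u1.1+u2.1)^+2 = 0 by lra.
  have /eqP : (u1.2+u2.2)^+2 = 0 by lra.
  rewrite !sqrf_eq0 => /eqP z4 /eqP z5.
  by apply: (asymN (au _ m1) (au _ m2)); lra.
have n1 := nu _ m1; have n2 := nu _ m2.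
have d12 := dle _ _ m1 m2 n12.
set D := u1.1*u2.1+u1.2*u2.2 in dmax d12.
have D1 : -1 < D.
  have : D^+2 + (u1.1*u2.2-u1.2*u2.1)^+2 = 1.
    have -> : D^+2 + (u1.1*u2.2-u1.2*u2.1)^+2 = (u1.1^+2+u1.2^+2)*(u2.1^+2+u2.2^+2) by rewrite /D; ring.
    by rewrite n1 n2 mulr1.
  by clear -or d12; nra.
(* The cosine of half the angle between [u1] and [u2]. The frame [(c, t)] chosen next has the
   normalised sum of [u1] and [u2] as second axis, so both receive height [q]. *)
pose q := Num.sqrt ((1+D)/2).
have q2 : q^+2 = (1+D)/2 by rewrite sqr_sqrtr //; clear -D1; lra.
have q0 : 0 < q by rewrite sqrtr_gt0; clear -D1; lra.
clearbody q.
pose c := (u1.2+u2.2)/(2*q); pose t := - (u1.1+u2.1)/(2*q).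
have qn : q != 0 by rewrite gt_eqF.
have ct : c^+2+t^+2 = 1.
  have -> : c^+2+t^+2 = ((u1.1+u2.1)^+2+(u1.2+u2.2)^+2)/(4*q^+2) by rewrite /c/t; field.
  have -> : (u1.1+u2.1)^+2+(u1.2+u2.2)^+2 = 2+2*D by rewrite /D; lra.
  by rewrite q2; field; rewrite gt_eqF //; lra.
have ec : u1.2+u2.2 = 2 * q * c by rewrite /c; field.
have et : u1.1+u2.1 = - (2 * q * t) by rewrite /t; field.
clearbody c t.
pose f (v : R * R) := (c * v.1 + t * v.2, c * v.2 - t * v.1).
pose K' := move K 0 0 c t.
have cK' : conf K' by exact: conf_move.
have K'0 : K' 0 0 by rewrite /K' /move !mulr0 subr0 !addr0.
have fK v : v \in s -> K' (f v).1 (f v).2.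
  move=> /au[k _ _]; rewrite /K' /move /f /=.
  have -> : 0 + c * (c * v.1 + t * v.2) - t * (c * v.2 - t * v.1) = (c^+2+t^+2)*v.1 by ring.
  have -> : 0 + t * (c * v.1 + t * v.2) + c * (c * v.2 - t * v.1) = (c^+2+t^+2)*v.2 by ring.
  by rewrite ct !mul1r.
have fdot u v : (f u).1*(f v).1+(f u).2*(f v).2 = u.1*v.1+u.2*v.2.
  have -> : (f u).1*(f v).1+(f u).2*(f v).2 = (c^+2+t^+2)*(u.1*v.1+u.2*v.2) by rewrite /f /=; ring.
  by rewrite ct mul1r.
have fnorm v : v \in s -> (f v).1^+2+(f v).2^+2 = 1 by move=> /nu <-; rewrite !expr2 fdot.
have finj : injective f.
  move=> [a b] [a' b'] [i j].
  have w1 : (c^+2+t^+2)*a = (c^+2+t^+2)*a'.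
    have -> : (c^+2+t^+2)*a = c * (c*a+t*b) - t * (c*b-t*a) by ring.
    by rewrite i j; ring.
  have w2 : (c^+2+t^+2)*b = (c^+2+t^+2)*b'.
    have -> : (c^+2+t^+2)*b = t * (c*a+t*b) + c * (c*b-t*a) by ring.
    by rewrite i j; ring.
  by move: w1 w2; rewrite ct !mul1r => -> ->.
pose p := (f u1).1.
have f1 : (f u1).2 = q.
  have : 2 * (q * (f u1).2) = 2 * q^+2.
    have : 2*q*(f u1).2 = (u1.1+u2.1)*u1.1 + (u1.2+u2.2)*u1.2 by rewrite ec et /f /=; ring.
    by rewrite q2 /D; lra.
  by move=> h; apply: (mulfI qn); rewrite -expr2; lra.
have f2 : (f u2).2 = q.
  have : 2 * (q * (f u2).2) = 2 * q^+2.
    have : 2*q*(f u2).2 = (u1.1+u2.1)*u2.1 + (u1.2+u2.2)*u2.2 by rewrite ec et /f /=; ring.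
    by rewrite q2 /D; lra.
  by move=> h; apply: (mulfI qn); rewrite -expr2; lra.
have f3 : (f u1).1 + (f u2).1 = 0.
  have -> : (f u1).1 + (f u2).1 = c * (u1.1+u2.1) + t*(u1.2+u2.2) by rewrite /f /=; ring.
  by rewrite ec et; ring.
have pq : p^+2+q^+2 = 1 by rewrite -f1 /p; exact: fnorm.
have dpq : D = q^+2-p^+2 by lra.
have p0 : 0 < p.
  have : (f u1).1 * (f u2).2 - (f u1).2 * (f u2).1 = u1.1*u2.2-u1.2*u2.1.
    have -> : (f u1).1 * (f u2).2 - (f u1).2 * (f u2).1 = (c^+2+t^+2)*(u1.1*u2.2-u1.2*u2.1) by rewrite /f /=; ring.
    by rewrite ct mul1r.
  have -> : (f u2).1 = - p by rewrite /p; lra.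
  rewrite f1 f2 -/p => h; have : 0 < 2 * q * p by lra.
  by rewrite pmulr_rgt0 // mulr_gt0.
have pe1 := perm_to_rem m1; have u1' : uniq (u1 :: rem u1 s) by rewrite -(perm_uniq pe1).
have m2' : u2 \in rem u1 s.
  by move: m2; rewrite (perm_mem pe1) inE eq_sym (negPf n12).
have pe2 := perm_to_rem m2'; set r := rem u2 _ in pe2.
have pe : perm_eq s [:: u1, u2 & r] by rewrite (perm_trans pe1) // perm_cons.
have ur : uniq [:: u1, u2 & r] by rewrite -(perm_uniq pe).
have mr v : v \in r -> [/\ v \in s, v != u1 & v != u2].
  move=> m; split; first by rewrite (perm_mem pe) !inE m !orbT.
    by apply: contraTneq m => ->; case/andP: ur; rewrite inE negb_or => /andP[].
  by apply: contraTneq m => ->; case/and3P: ur.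
have sr : size r = 3%N by have := perm_size pe; rewrite sz => -[].
have uM : uniq (map f r) by rewrite map_inj_uniq //; case/and3P: ur.
have sM : size (map f r) = 3%N by rewrite size_map.
have sumx : \sum_(v <- map f r) v.1 = 0.
  have : \sum_(v <- s) (f v).1 = 0 by rewrite big_split /= -!mulr_sumr sx sy; ring.
  by rewrite (sum_perm _ pe) !big_cons big_map; lra.
have sumy : \sum_(v <- map f r) v.2 = -2 * q.
  have : \sum_(v <- s) (f v).2 = 0 by rewrite sumrB /= -!mulr_sumr sx sy; ring.
  by rewrite (sum_perm _ pe) !big_cons big_map f1 f2; lra.
have mM w : w \in map f r -> exists2 v, [/\ v \in s, v != u1 & v != u2] & w = f v.
  by move=> /mapP[v /mr h ->]; exists v.
have dM w w' : w \in map f r -> w' \in map f r -> w != w' -> w.1*w'.1+w.2*w'.2 <= q^+2-p^+2.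
  move=> /mM[v [h _ _] ->] /mM[v' [h' _ _] ->] n; rewrite -dpq fdot; apply: dmax => //.
  by apply: contra_neq n => ->.
have nM w : w \in map f r -> w.1^+2+w.2^+2 = 1 by move=> /mM[v [h _ _] ->]; exact: fnorm.
have lowM w : w \in map f r -> w.2 < 0.
  move=> m; have pw := perm_to_rem m.
  have uw : uniq (w :: rem w (map f r)) by rewrite -(perm_uniq pw).
  have mem_w v : v \in w :: rem w (map f r) -> v \in map f r by rewrite (perm_mem pw).
  move: sumx sumy; rewrite !(perm_big _ pw) !big_cons.
  move: sM; rewrite (perm_size pw) /=.
  case: (rem _ _) uw mem_w => [|a [|b [|? ?]]] //= /and3P[wn abn _] mem_w _; rewrite !big_cons !big_nil => ex ey.
  have ma : a \in map f r by apply: mem_w; rewrite !inE eqxx orbT.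
  have mb : b \in map f r by apply: mem_w; rewrite !inE eqxx !orbT.
  have ab : a != b by rewrite inE in abn.
  have := five_low pq (nM _ ma) (nM _ mb) (nM _ m) ltac:(lra) ltac:(lra) (dM _ _ ma mb ab).
  clear -q0 => h; rewrite ltNge; apply/negP => h'.
  by have := mulr_ge0 (ltW q0) h'; lra.
have [r' per so] : exists2 s', perm_eq (map f r) s' & sorted (fun u v => u.1 < v.1) s'.
  apply: sort_x => // -[a b] [a' b'] h h' /= i.
  have := nM _ h; have := nM _ h'; have := lowM _ h; have := lowM _ h' => /= y1 y2 e1 e2.
  rewrite i in e2 *; congr pair.
  have /eqP : b^+2 = b'^+2 by lra.
  by rewrite eqf_sqr => /orP[] /eqP //; lra.
move: sM sumx sumy; rewrite (perm_size per) !(perm_big _ per).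
have mr' v : v \in r' -> v \in map f r by rewrite (perm_mem per).
case: r' so mr' {per} => [|a [|b [|d [|? ?]]]] //= /and3P[l1 l2 _] mr' _; rewrite !big_cons !big_nil => ex ey.
have ma := mr' a (seq.mem_head _ _); have mb := mr' b (mem_second _ _ _).
have md : d \in map f r by apply: mr'; rewrite !inE eqxx !orbT.
have ab : a != b by apply: contraTneq l1 => ->; rewrite ltxx.
have bd : b != d by apply: contraTneq l2 => ->; rewrite ltxx.
have ad : a != d by apply: contraTneq l1 => ->; rewrite -leNgt ltW.
have k1 : K' p q by rewrite /p -f1; exact: fK.
have k2 : K' (-p) q.
  by have := fK _ m2; rewrite f2; have -> : (f u2).1 = - p by [rewrite /p; lra].
have bnd w u : w \in map f r -> u \in s -> (u = u1 \/ u = u2) -> (f u).1*w.1+(f u).2*w.2 <= q^+2-p^+2.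
  move=> /mM[v [h n1' n2'] ->] mu hu; rewrite fdot -dpq; apply: dmax => //.
  by case: hu => ->; rewrite eq_sym.
apply: (five_bisector cK' K'0 k1 k2 _ _ pq p0 q0 (nM _ ma) (nM _ mb) (nM _ md) l1 l2 _ _ _ (dM _ _ ma mb ab) (dM _ _ mb md bd) (dM _ _ ma md ad)).
- by have [v [h _ _] ->] := mM _ ma; exact: fK.
- by have [v [h _ _] ->] := mM _ md; exact: fK.
- by lra.
- by lra.
- by rewrite -dpq.
- by have := bnd _ _ md m1 (or_introl erefl); rewrite f1.
have := bnd _ _ ma m2 (or_intror erefl); rewrite f2.
by have -> : (f u2).1 = - p by [rewrite /p; lra].
Qed.

Lemma star K : conf K -> K 0 0 -> anti K \/ exists c t, c^+2+t^+2 = 1 /\ tri (move K 0 0 c t).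
Proof.
move=> ck k0; have [|nanti] := pselect (anti K); [by left|right].
have [x [y a0]] : exists x y, asym K 1 x y.
  apply: contrapT => n; apply: nanti => x y h k.
  by apply: contrapT => n'; apply: n; exists x, y.
have [_ h _] := a0; exists x, y; split=> //.
have cM := conf_move 0 0 h ck.
have M0 : move K 0 0 x y 0 0 by rewrite /move !mulr0 subr0 !addr0.
have : asym (move K 0 0 x y) 1 1 0 by apply/asym_move => //; rewrite !mulr1 !mulr0 subr0 addr0.
move=> /(star_asym cM M0)[//|[s [us sz] [ms [sx sy]]]].
by case: (five_false cM M0 us sz ms sx sy).
Qed.
End Five5.

(** * Symmetry about the points of a full line *)

Section Line1.
Variable R : realType.
Implicit Types (K : R -> R -> Prop).

Lemma conv2 K x y x' y' : K x y -> x = x' -> y = y' -> K x' y'.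
Proof. by move=> k <- <-. Qed.

Lemma sqr_le_abs (a b : R) : 0 <= b -> a^+2 <= b^+2 -> - b <= a <= b.
Proof. by move=> b0 h; rewrite -ler_norml -(@ler_pXn2r _ 2) ?nnegrE // real_normK ?num_real. Qed.

Lemma le_abs_sqr (a b : R) : 0 < b -> b^+2 <= a^+2 -> b <= a \/ a <= - b.
Proof.
move=> b0 h; have [l|l] := leP 0 a; [left|right].
  by rewrite -(@ler_pXn2r _ 2) ?nnegrE // ltW.
have : b <= -a by rewrite -(@ler_pXn2r _ 2) ?nnegrE ?sqrrN //; lra.
lra.
Qed.

(* Points of one ring lying above height h differ little in height *)
Lemma band_dy (t h c2 x y x' y' : R) : x^+2+y^+2 = t -> x'^+2+y'^+2 = t -> 0 < h -> h <= y' -> y' <= y ->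
  t <= h^+2 + c2 -> 0 <= c2 -> (y - y')^+2 * (4 * h^+2) <= c2^+2.
Proof.
move=> e e' h0 hy yy tc c0.
have y2 : h^+2 <= y'^+2 by apply: sqr_le; lra.
have x2 := sqr_ge0 x; have x2' := sqr_ge0 x'.
have d : (y-y')*(2*h) <= c2.
  have m : (y-y')*(2*h) <= (y-y')*(y+y') by apply: ler_wpM2l; lra.
  lra.
have d0 : 0 <= (y-y')*(2*h) by apply: mulr_ge0; lra.
have -> : (y - y')^+2 * (4 * h^+2) = ((y-y')*(2*h))^+2 by ring.
by apply: sqr_le; lra.
Qed.

(** Asymmetric points have [y^2 >= b] and hence [x^2 <= t - b <= 3/4]. Two on the same side whose
    abscissas differ by at most [sqrt (t - b)] have squared distance at most [3/4 + 3/16] by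
    [band_dy], so [sym_band] applies. *)
Lemma reflect_near K b x y : conf K -> K 0 0 -> 3/4 <= b ->
  (forall x y, K x y -> y^+2 < b -> K (-x) (-y)) -> K x y -> x^+2+y^+2 <= b+3/4 -> K (-x) (-y).
Proof.
move=> ck k0 b0 low k le; apply: sym_ring k erefl.
set t := _ + _ in le *.
have ay u v : asym K t u v -> b <= v^+2.
  by move=> [k e n]; rewrite leNgt; apply/negP => l; apply: n; exact: low.
have [tb|tb] := ltP t b.
  move=> u v a; have := ay _ _ a; case: a => _ e _; have := sqr_ge0 u; lra.
pose h := Num.sqrt b; pose c := Num.sqrt (t-b).
have h2 : h^+2 = b by rewrite sqr_sqrtr //; lra.
have c2 : c^+2 = t-b by rewrite sqr_sqrtr //; lra.
have h0 : 0 < h by rewrite sqrtr_gt0; lra.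
have c0 : 0 <= c by rewrite sqrtr_ge0.
clearbody h c.
apply: (sym_band ck k0 (c := c) h0); first by rewrite h2; lra.
  move=> u v a; have := ay _ _ a; rewrite -h2 => hv; case: a => _ e _.
  split; last exact: le_abs_sqr.
  by apply: sqr_le_abs => //; lra.
move=> u v u' v' e e' hv vv _ _ uu.
have := band_dy e e' h0 hv vv (c2 := t - b) ltac:(lra) ltac:(lra).
rewrite h2 => m; move/andP: uu => [u1 u2].
have u3 : (u-u')^+2 <= c^+2 by apply: sqr_le => //; lra.
have m0 := sqr_ge0 (v-v').
have m1 : (v-v')^+2 * 3 <= (v-v')^+2 * (4*b) by apply: ler_wpM2l => //; lra.
have m2 : (t-b)^+2 <= (3/4)^+2 by apply: sqr_le; lra.
lra.
Qed.

Lemma band_spread (b t : R) s u v u' v' : 24/25 <= b -> t <= b + 51/50 -> 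
  (forall x y, (x, y) \in s -> b <= y^+2) ->
  spread_top t (91/90) s -> (u, v) \in s -> (u', v') \in s -> u < u' -> 17/20 < u' - u.
Proof.
move=> b1 tb low [_ h sp] m m' l; rewrite ltNge; apply/negP => d.
have ne : (u, v) != (u', v') by apply: contraTneq l => -[-> _]; rewrite ltxx.
have := sp _ _ _ _ m m' ne; have [v0 e _] := h _ _ m; have [v'0 e' _] := h _ _ m'.
have q2 : (u'-u)^+2 <= (17/20)^+2 by apply: sqr_le; lra.
pose k := Num.sqrt b; have k2 : k^+2 = b by rewrite sqr_sqrtr //; lra.
have k0 : 0 < k by rewrite sqrtr_gt0; lra.
have kv x y : (x, y) \in s -> k <= y.
  by move=> q; have [q0 _ _] := h _ _ q; rewrite -(@ler_pXn2r _ 2) ?nnegrE ?k2 ?(ltW k0) ?(ltW q0) //; exact: low q.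
have hv := kv _ _ m; have hv' := kv _ _ m'.
clearbody k.
have dy : (v'-v)^+2 * (4 * k^+2) <= (51/50)^+2.
  have [w|w] := leP v v'; first by apply: (band_dy e' e k0 hv w); lra.
  by rewrite -sqrrN opprB; apply: (band_dy e e' k0 hv' (ltW w)); lra.
rewrite k2 in dy.
have m1 : (v'-v)^+2 * (4*(24/25)) <= (v'-v)^+2 * (4*b) by apply: ler_wpM2l; [exact: sqr_ge0|lra].
lra.
Qed.

Lemma band_ends (b t : R) s : 24/25 <= b -> t <= b + 51/50 -> 
  (forall x y, (x, y) \in s -> b <= y^+2) -> spread_top t (91/90) s -> (2 < size s)%N ->
  size s = 3%N /\ exists l y r z, [/\ (l, y) \in s, (r, z) \in s, l <= -13/20 & 13/20 <= r].
Proof.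
move=> b1 tb low /spread_top_sort[s' [pe sp so]] sz.
have low' x y : (x, y) \in s' -> b <= y^+2 by rewrite -(perm_mem pe); exact: low.
rewrite (perm_size pe) in sz *; have key := band_spread b1 tb low' sp.
case: s' pe sp so sz key {low'} => [|[x1 y1] [|[x2 y2] [|[x3 y3] s']]] //= pe sp /and3P[l1 l2 so] _ key.
have m1 : (x1, y1) \in [:: (x1, y1), (x2, y2), (x3, y3) & s'] by rewrite !inE eqxx.
have m2 : (x2, y2) \in [:: (x1, y1), (x2, y2), (x3, y3) & s'] by rewrite !inE eqxx ?orbT.
have m3 : (x3, y3) \in [:: (x1, y1), (x2, y2), (x3, y3) & s'] by rewrite !inE eqxx ?orbT.
have d1 := key _ _ _ _ m1 m2 l1; have d2 := key _ _ _ _ m2 m3 l2.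
have [_ h _] := sp; have [_ _ /andP[a1 _]] := h _ _ m1; have [_ _ /andP[_ a3]] := h _ _ m3.
split; last by exists x1, y1, x3, y3; rewrite !(perm_mem pe); split=> //; lra.
case: s' {pe sp m1 m2 m3} so key h => [//|[x4 y4] s'] /= /andP[l3 _] key h.
have m3 : (x3, y3) \in [:: (x1, y1), (x2, y2), (x3, y3), (x4, y4) & s'] by rewrite !inE eqxx ?orbT.
have m4 : (x4, y4) \in [:: (x1, y1), (x2, y2), (x3, y3), (x4, y4) & s'] by rewrite !inE eqxx ?orbT.
by exfalso; have d3 := key _ _ _ _ m3 m4 l3; have [_ _ /andP[_ a4]] := h _ _ m4; lra.
Qed.

Lemma sum_ge (T : eqType) (s : seq T) (F : T -> R) c :
  (forall v, v \in s -> c <= F v) -> c * (size s)%:R <= \sum_(v <- s) F v.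
Proof.
elim: s => [|a s IH] h; first by rewrite big_nil mulr0.
rewrite big_cons /= -natr1 mulrDr mulr1 addrC; apply: lerD; first exact/h/seq.mem_head.
by apply: IH => v m; apply: h; rewrite inE m orbT.
Qed.

(** The balance of heights then requires three points below as well. The outer top points reflect
    through [(1, 0)] and [(-1, 0)] almost onto outer bottom points, hence exactly onto them, so they
    sit at abscissas [1] and [-1]. By equal norms they have equal heights, and opposite corners are
    antipodal. *)
Lemma no_three_tops K b t x1 y1 x2 y2 x3 y3 : conf K -> K 0 0 -> K (-1) 0 -> K 1 0 -> 24/25 <= b -> t <= b+51/50 ->
  (forall x y, K x y -> y^+2 < b -> [/\ K (-x) (-y), K (-2-x) (-y) & K (2-x) (-y)]) ->
  asym K t x1 y1 -> asym K t x2 y2 -> asym K t x3 y3 -> 0 < y1 -> 0 < y2 -> 0 < y3 ->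
  (x1, y1) != (x2, y2) -> (x1, y1) != (x3, y3) -> (x2, y2) != (x3, y3) -> False.
Proof.
move=> ck k0 kl kr b1 tb low a1 a2 a3 p1 p2 p3 n12 n13 n23.
have ay u v : asym K t u v -> b <= v^+2.
  by move=> [k e n]; rewrite leNgt; apply/negP => l; apply: n; case: (low _ _ k l).
have n0 u v : asym K t u v -> v != 0.
  by move=> /ay h; apply/eqP => v0; move: h; rewrite v0; lra.
have ax u v : asym K t u v -> - (91/90) <= u <= 91/90.
  by move=> a; have := ay _ _ a; case: a => _ e _ h; apply: sqr_le_abs; lra.
have [T [B [uT uB mT mB [sx sy]]]] := asym_split ck k0 n0.
have sT : spread_top t (91/90) T by apply: asym_spread ck uT _ => x y /mT[a p]; split=> //; exact: ax a.
have sB : spread_top t (91/90) (map (@flip R) B) by apply: asym_spread_flip ck uB _ => x y /mB[a p]; split=> //; exact: ax a.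
have lT x y : (x, y) \in T -> b <= y^+2 by case/mT => /ay.
have lB x y : (x, y) \in map (@flip R) B -> b <= y^+2 by move=> /mapP[[u v] /mB[/ay h _] [_ ->]]; rewrite sqrrN.
have zT : (2 < size T)%N.
  have : (size [:: (x1, y1); (x2, y2); (x3, y3)] <= size T)%N; last by [].
  apply: uniq_leq_size; first by rewrite /= !inE negb_or n12 n13 n23.
  by move=> v; rewrite !inE => /or3P[] /eqP ->; apply/mT.
have [T3 [l [y [r [z [ml mr hl hr]]]]]] := band_ends b1 tb lT sT zT.
pose k := Num.sqrt b; have k2 : k^+2 = b by rewrite sqr_sqrtr //; lra.
have kp : 0 < k by rewrite sqrtr_gt0; lra.
clearbody k.
have st u v : asym K t u v -> - (29/20*k) < v /\ v < 29/20*k.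
  move=> [_ e _]; have v2 : v^+2 <= t by have := sqr_ge0 u; lra.
  have k32 : v^+2 < (29/20*k)^+2 by rewrite exprMn k2; lra.
  by apply/andP; rewrite -ltr_norml -(@ltr_pXn2r _ 2) ?nnegrE ?real_normK ?num_real //; lra.
have sumT : k * 3 <= \sum_(v <- T) v.2.
  have -> : 3 = (size T)%:R :> R by rewrite T3.
  apply: sum_ge => -[u v] /mT[a p] /=; rewrite -(@ler_pXn2r _ 2) ?nnegrE ?k2 //; first [exact: ay a|lra].
have zB : (2 < size (map (@flip R) B))%N.
  rewrite size_map ltnNge; apply/negP => zB.
  have : - (29/20*k) * (size B)%:R <= \sum_(v <- B) v.2.
    by apply: sum_ge => -[u v] /mB[a p] /=; case: (st _ _ a); lra.
  have : (size B)%:R <= 2 :> R by rewrite ler_nat.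
  move=> h; have : k * (size B)%:R <= k * 2 by apply: ler_wpM2l => //; lra.
  lra.
have [_ [l' [y' [r' [z' [ml' mr' hl' hr']]]]]] := band_ends b1 tb lB sB zB.
have {ml} [al yp] := (mT _ _).1 ml; have {mr} [ar zp] := (mT _ _).1 mr.
have /mapP[[u v] /mB[al' v0] [e1 e2]] := ml'; rewrite /= in e1 e2; subst u.
have /mapP[[u w] /mB[ar' w0] [e3 e4]] := mr'; rewrite /= in e3 e4; subst u.
clear ml' mr' sumT zB zT T3 lB lT sB sT sx sy mT mB uT uB.
have refl e x yy x' yy' : (e = 1) \/ (e = -1) -> asym K t x yy -> asym K t x' yy' -> 0 < yy -> yy' < 0 ->
   13/20 <= e * x -> 13/20 <= e*x' -> x = e /\ yy' = - yy.
  move=> he a a' yy0 yy'0 hx hx'.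
  have xb := ax _ _ a; have xb' := ax _ _ a'; have yb := ay _ _ a; have yb' := ay _ _ a'.
  have [kk ee _] := a; have [kk' ee' _] := a'.
  have kr1 : K (2*e - x) (-yy).
    have cM : conf (move K e 0 1 0) by apply: conf_move => //; ring.
    have : move K e 0 1 0 (-(x-e)) (-yy).
      apply: (reflect_near cM (b := b)); rewrite ?shiftE ?addr0; [by case: he => ->|lra| | |].
      - move=> p q; rewrite !shiftE !add0r => kpq lq; have [_ h2 h3] := low _ _ kpq lq.
        by case: he h2 h3 => -> h2 h3; [apply: (conv2 h3)|apply: (conv2 h2)]; ring.
      - by apply: (conv2 kk); ring.
      by case: he hx => -> hx; move/andP: xb => [? ?]; nra.
    by rewrite shiftE add0r => h; apply: (conv2 h); ring.
  have [[i j]|sp] := sepP ck kr1 kk'.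
    have h1 : x^+2 = x'^+2 by rewrite j in ee'; lra.
    move/eqP: h1; rewrite eqf_sqr => /orP[] /eqP h1; last by case: he hx hx' => ->; lra.
    by split; lra.
  exfalso.
  clear ay ax st kr1 low a1 a2 a3.
  have s1 : (x' - (2*e-x))^+2 <= (18/25)^+2.
    by case: he hx hx' => ->; move/andP: xb => [? ?]; move/andP: xb' => [? ?] hx hx'; apply: sqr_le; lra.
  have hk : k <= yy by case: (le_abs_sqr (a := yy) kp); [rewrite k2|by []|lra].
  have hk' : k <= -yy' by case: (le_abs_sqr (a := yy') kp); [rewrite k2|lra|lra].
  have ee'' : x'^+2+(-yy')^+2 = t by rewrite sqrrN.
  have dy : (yy' - - yy)^+2 * (4 * k^+2) <= (51/50)^+2.
    have -> : (yy' - - yy)^+2 = (yy - -yy')^+2 by ring.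
    have [q|q] := leP (-yy') yy; first by apply: (band_dy ee ee'' kp hk' q); lra.
    by rewrite -sqrrN opprB; apply: (band_dy ee'' ee kp hk (ltW q)); lra.
  rewrite k2 in dy.
  have m1 : (yy' - - yy)^+2 * (4*(24/25)) <= (yy' - - yy)^+2 * (4*b) by apply: ler_wpM2l; [exact: sqr_ge0|lra].
  lra.
have [q1 q2] := refl (-1) l y l' v (or_intror erefl) al al' yp v0 ltac:(lra) ltac:(lra).
have [q3 q4] := refl 1 r z r' w (or_introl erefl) ar ar' zp w0 ltac:(lra) ltac:(lra).
have [_ g1 _] := al; have [_ g2 _] := ar; have [_ g3 _] := al'; have [_ g4 _] := ar'.
have yz : y = z.
  have /eqP : y^+2 = z^+2 by rewrite q1 in g1; rewrite q3 in g2; lra.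
  by rewrite eqf_sqr => /orP[] /eqP //; lra.
apply: (asymN al ar').
  have /eqP : r'^+2 = 1 by rewrite q4 q1 in g1 g4 *; rewrite sqrrN -yz in g4; lra.
  by rewrite sqrf_eq1 => /orP[] /eqP; lra.
by rewrite q4 yz.
Qed.

End Line1.

Section Line2.
Variable R : realType.
Implicit Types (K : R -> R -> Prop).

Lemma reflect_next K b x y : conf K -> K 0 0 -> K (-1) 0 -> K 1 0 -> 24/25 <= b -> 
  (forall x y, K x y -> y^+2 < b -> [/\ K (-x) (-y), K (-2-x) (-y) & K (2-x) (-y)]) ->
  K x y -> x^+2+y^+2 <= b+51/50 -> K (-x) (-y).
Proof.
move=> ck k0 kl kr b1 low k le; apply: sym_ring k erefl.
set t := _ + _ in le *.
pose h := Num.sqrt b; have h2 : h^+2 = b by rewrite sqr_sqrtr //; lra.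
have h0 : 0 < h by rewrite sqrtr_gt0; lra.
clearbody h t.
apply: (sym_of_two ck k0 h0); first by rewrite h2; lra.
  move=> u v [kk e n]; apply: le_abs_sqr => //; rewrite h2 leNgt; apply/negP => l; apply: n.
  by case: (low _ _ kk l).
move=> e x1 y1 x2 y2 x3 y3 /orP[] /eqP -> a1 a2 a3; rewrite ?mul1r ?mulN1r => p1 p2 p3 n12 n13 n23.
  exact: (no_three_tops ck k0 kl kr b1 le low a1 a2 a3).
pose K' x y := K x (-y).
have cK' : conf K' by exact: conf_flip.
have aK u v : asym K t u v -> asym K' t u (-v).
  by move=> [kk ee n]; rewrite /asym /K' !opprK sqrrN; split=> // kk'; apply: n.
have fn u v u' v' : (u, v) != (u', v') :> R * R -> (u, - v) != (u', - v').
  by apply: contra_neq => -[-> /oppr_inj ->].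
apply: (no_three_tops cK' _ _ _ b1 le _ (aK _ _ a1) (aK _ _ a2) (aK _ _ a3)); rewrite ?/K' ?oppr0 //.
- by move=> u v ku lv; have [] := low _ _ ku; rewrite ?sqrrN.
- exact: fn.
- exact: fn.
exact: fn.
Qed.

Lemma int_step (P : int -> Prop) (n : int) : P n -> (forall i, P i -> P (i + 1)) -> (forall i, P i -> P (i - 1)) ->
  forall i, P i.
Proof.
move=> p0 pS pP i; rewrite -(subrKC n i); elim/int_ind: (i - n) => [|k|k]; first by rewrite addr0.
  by rewrite -addn1 PoszD addrA; exact: pS.
by rewrite -addn1 PoszD opprD addrA; exact: pP.
Qed.

Lemma floorP (x : R) : exists n : int, n%:~R <= x <= n%:~R + 1.
Proof.
exists (Num.floor x); have /andP[-> /ltW h] := floor_itv x.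
by rewrite -intrD1.
Qed.

Definition on_line K := forall i : int, K i%:~R 0.
Definition line_sym K := forall x y, K x y -> forall i : int, K (2*i%:~R - x) (-y).

Lemma off_line K x y : conf K -> on_line K -> K x y -> 3/4 <= y^+2 \/ exists i : int, x = i%:~R /\ y = 0.
Proof.
move=> ck ok k; have [n /andP[l r]] := floorP x.
have [[-> ->]|s1] := sepP ck (ok n) k; first by right; exists n.
have [[-> ->]|s2] := sepP ck (ok (n+1)) k; first by right; exists (n+1).
left; rewrite intrD1 in s2.
have [h|h] := leP (x - n%:~R) (1/2).
  have : (x - n%:~R)^+2 <= (1/2)^+2 by apply: sqr_le; lra.
  lra.
have : (x - (n%:~R + 1))^+2 <= (1/2)^+2 by apply: sqr_le; lra.
lra.
Qed.

(** Since [37/50 + 1/100 = 3/4], a point with [(x - m)^2 <= 37/50] is covered by [reflect_near].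
    Otherwise it is nearly above an adjacent integer point, whose distance forces [b >= 24/25], and
    [reflect_next] applies. *)
Lemma band_reflect K b x y (m : int) : conf K -> on_line K -> 3/4 <= b ->
  (forall x y, K x y -> y^+2 < b -> forall i : int, K (2*i%:~R - x) (-y)) ->
  K x y -> y^+2 < b + 1/100 -> -1 <= x - m%:~R <= 1 -> K (2 * m%:~R-x) (-y).
Proof.
move=> ck ok b0 low k yb /andP[l r].
have [lb|lb] := ltP (y^+2) b; first exact: low.
pose M := move K m%:~R 0 1 0; have cM : conf M by apply: conf_move => //; ring.
have ME u v : M u v = K (m%:~R + u) v by rewrite /M shiftE add0r.
have M0 : M 0 0 by rewrite ME addr0.
have kM : M (x - m%:~R) y by rewrite ME addrC subrK.
have lowM u v (i : int) : M u v -> v^+2 < b -> M (2*i%:~R - u) (-v).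
  rewrite !ME => ku lv; apply: (conv2 (low _ _ ku lv (m + i))) => //; rewrite intrD; ring.
suff : M (-(x-m%:~R)) (-y) by rewrite ME => h; apply: (conv2 h) => //; ring.
have M1 : M 1 0 by rewrite ME -intrD1.
have Mn1 : M (-1) 0 by rewrite ME (_ : m%:~R + -1 = (m-1)%:~R) // intrB.
have [g|g] := leP ((x-m%:~R)^+2) (37/50).
  apply: (reflect_near cM M0 b0) => //; last by lra.
  by move=> u v ku lv; apply: (conv2 (lowM _ _ 0 ku lv)) => //; ring.
have b1 : 24/25 <= b.
  have [g1|g1] : 43/50 < x - m%:~R \/ x - m%:~R < - (43/50).
  - by have [|h1] := ltP (43/50) (x - m%:~R); [left|right; rewrite ltNge; apply/negP => h2; have := sqr_le h2 h1; lra].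
  - have [[_ i]|s] := sepP cM M1 kM; first by rewrite i in lb; lra.
    have : (x - m%:~R - 1)^+2 <= (7/50)^+2 by apply: sqr_le; lra.
    lra.
  have [[_ i]|s] := sepP cM Mn1 kM; first by rewrite i in lb; lra.
  have : (x - m%:~R - -1)^+2 <= (7/50)^+2 by apply: sqr_le; lra.
  lra.
apply: (reflect_next cM M0 Mn1 M1 b1) => //; last first.
  have : (x-m%:~R)^+2 <= 1^+2 by apply: sqr_le; lra.
  lra.
move=> u v ku lv; split.
- by apply: (conv2 (lowM _ _ 0 ku lv)) => //; ring.
- by apply: (conv2 (lowM _ _ (-1) ku lv)) => //; ring.
by apply: (conv2 (lowM _ _ 1 ku lv)) => //; ring.
Qed.

(** Let [b] be the infimum of the squared heights at which some reflection fails. It is at least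
    [3/4] by [off_line]. In the thin band above [b] the reflections through nearby integer points
    still work ([band_reflect]), and composing them yields all others, so nothing fails there. *)
Theorem line_symP K : conf K -> on_line K -> line_sym K.
Proof.
move=> ck ok; apply: contrapT => nsym.
pose bad z := exists x y, [/\ K x y, y^+2 = z & exists i : int, ~ K (2*i%:~R-x) (-y)].
have ne : (bad !=set0)%classic.
  apply: contrapT => n; apply: nsym => x y k i; apply: contrapT => h.
  by apply: n; exists (y^+2); exists x, y; split=> //; exists i.
have lbb : lbound bad (3/4).
  move=> z [x [y [k <- [i ni]]]]; have [//|[j [ex ey]]] := off_line ck ok k.
  case: ni; rewrite ex ey oppr0; apply: (conv2 (ok (2*i - j))) => //.
  by rewrite intrB intrM.
have hi : has_inf bad by split=> //; exists (3/4).
pose b := inf bad.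
have b0 : 3/4 <= b by apply: lb_le_inf.
have low x y : K x y -> y^+2 < b -> forall i : int, K (2*i%:~R - x) (-y).
  move=> k l i; apply: contrapT => n.
  have : b <= y^+2 by apply: ge_inf; [exact: hi.2|exists x, y; split=> //; exists i].
  by rewrite leNgt l.
have [z [x [y [k <- [i ni]]]] zb] := inf_adherent (ltac:(lra) : 0 < 1/100 :> R) hi.
have refl u v (m : int) : K u v -> v^+2 < b + 1/100 -> -1 <= u - m%:~R <= 1 -> K (2 * m%:~R-u) (-v).
  exact: band_reflect.
have [n /andP[l r]] := floorP x.
(* Two reflections through consecutive integer points make a translation by 2. Along these
   translates the point comes near every integer point, through which it can then be reflected. *)
have tr (j : int) : K (x+2*j%:~R) y.
  apply: (@int_step (fun j : int => K (x+2*j%:~R) y) 0) => {j}.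
  - by rewrite mulr0 addr0.
  - move=> j kj; rewrite intrD1.
    have k1 : K (2*(n+2*j+1)%:~R - (x+2*j%:~R)) (-y).
      by apply: refl => //; rewrite !intrD !intrM; apply/andP; split; lra.
    have k2 : K (2*(n+2*j+2)%:~R - (2*(n+2*j+1)%:~R - (x+2*j%:~R))) (--y).
      by apply: refl => //; rewrite ?sqrrN // !intrD !intrM; apply/andP; split; lra.
    by apply: (conv2 k2); rewrite ?opprK // !intrD; ring.
  move=> j kj; rewrite intrB.
  have k1 : K (2*(n+2*j)%:~R - (x+2*j%:~R)) (-y).
    by apply: refl => //; rewrite !intrD !intrM; apply/andP; split; lra.
  have k2 : K (2*(n+2*j-1)%:~R - (2*(n+2*j)%:~R - (x+2*j%:~R))) (--y).
    by apply: refl => //; rewrite ?sqrrN // !intrB !intrD !intrM; apply/andP; split; lra.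
  by apply: (conv2 k2); rewrite ?opprK // !intrB !intrD; ring.
apply: ni.
have : K (2*(n+2*(i-n))%:~R - (x+2*(i-n)%:~R)) (-y).
  by apply: refl => //; rewrite !intrD !intrM !intrB; apply/andP; split; lra.
by move=> h; apply: (conv2 h) => //; rewrite !intrD !intrM !intrB; ring.
Qed.
End Line2.

(** * A sparse row between two full ones *)

Section Row.
Variable R : realType.
Implicit Types (K N : R -> R -> Prop).
Local Notation s3 := (@s3 R).

Lemma sq_half_le (a : R) : 1/2 <= a^+2 -> 0 < a -> 7/10 < a.
Proof. by move=> h a0; rewrite ltNge; apply/negP => l; have := @sqr_le _ a (7/10) ltac:(lra) l; lra. Qed.

Lemma wrapped_three_right (t x1 y1 x2 y2 x3 y3 : R) :
  spread_top t 1 [:: (x1, y1); (x2, y2); (x3, y3)] -> x1 < x2 -> x2 < x3 -> 0 <= x2 ->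
  (x1 + 2 = x3 /\ y1 = y3) \/ 1 <= (x1 + 2 - x3)^+2 + (y1 - y3)^+2 -> x1 + 2 = x3 /\ y1 = y3.
Proof.
move=> sp l12 l23 x20 [//|wr]; exfalso.
have m1 : (x1, y1) \in [:: (x1, y1); (x2, y2); (x3, y3)] by rewrite !inE eqxx.
have m2 : (x2, y2) \in [:: (x1, y1); (x2, y2); (x3, y3)] by rewrite !inE eqxx ?orbT.
have m3 : (x3, y3) \in [:: (x1, y1); (x2, y2); (x3, y3)] by rewrite !inE eqxx ?orbT.
have [c12 d12 e12] := spread_chord sp m1 m2 l12.
have [c23 _ _] := spread_chord sp m2 m3 l23.
have [_ h _] := sp.
have [y10 e1 /andP[b1 _]] := h _ _ m1; have [y30 e3 /andP[_ b3]] := h _ _ m3.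
clear h sp m1 m2 m3.
have {}c23 := c23 ltac:(clear -x20 l23; lra).
have h3 : 1/2 <= x3^+2 by clear -c23 x20 l23; nra.
have h3' := sq_half_le h3 ltac:(clear -x20 l23; lra).
have h2 : x2 < 1/2.
  rewrite ltNge; apply/negP => h; have : (x3-x2)*x3 <= (1/2) * 1 by apply: ler_pM; clear -h l23 b3 x20; lra.
  by clear -c23; lra.
have h1 : x1 < 0.
  rewrite ltNge; apply/negP => h; have := c12 ltac:(clear -h x20 l12; lra).
  have : (x2-x1)*x2 <= (1/2)*(1/2) by apply: ler_pM; clear -h x20 h2 l12; lra.
  clear; lra.
have dy2 : (y1-y3)^+2 <= x3^+2 - x1^+2 \/ (y1-y3)^+2 <= x1^+2 - x3^+2.
  have [q|q] := leP y1 y3; [right|left].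
    have : (y3-y1)*(y3-y1) <= (y3-y1)*(y3+y1) by apply: ler_wpM2l; clear -q y10; lra.
    by clear -e1 e3; lra.
  have : (y1-y3)*(y1-y3) <= (y1-y3)*(y3+y1) by apply: ler_wpM2l; clear -q y30; lra.
  by clear -e1 e3; lra.
have [p1|p1] := leP (1/2) (x1^+2).
  have p1' : 7/10 < -x1 by apply: sq_half_le; rewrite ?sqrrN //; clear -h1; lra.
  have dx : (x1+2-x3)^+2 <= (3/5)^+2 by apply: sqr_le; clear -p1' h3' b1 b3; lra.
  have q1 : x1^+2 <= 1^+2 by rewrite -sqrrN; apply: sqr_le; clear -b1 h1; lra.
  have q3 : x3^+2 <= 1^+2 by apply: sqr_le; clear -b3 h3'; lra.
  by clear -dx q1 q3 dy2 wr p1 h3; case: dy2 => ?; lra.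
have p0 : x2 < - x1.
  rewrite ltNge; apply/negP => q.
  have : x2 <= - x1.
    rewrite leNgt; apply/negP => q'; have := c12 ltac:(clear -q'; lra).
    have : (x2-x1)*x2 <= 1*(1/2) by apply: ler_pM; clear -q q' h2 x20 h1; lra.
    clear; lra.
  move=> q'; have := e12 ltac:(clear -q q'; lra).
  have : (x2-x1)*x2 <= 1*(1/2) by apply: ler_pM; clear -q q' h2 x20 h1; lra.
  have : (x2-x1) < 1 by clear -q q' h2; lra.
  by clear -x20 h2; nra.
have {}d12 := d12 p0.
have p2 : 1/2 < - x1.
  rewrite ltNge; apply/negP => q.
  have : (x2-x1) * (-x1) <= 1*(1/2) by apply: ler_pM; clear -q h1 h2 x20; lra.
  by clear -d12; lra.
have q3 : - x1 < x3.
  rewrite ltNge; apply/negP => q.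
  have : x3^+2 <= (-x1)^+2 by apply: sqr_le; clear -q h3'; lra.
  by rewrite sqrrN; clear -p1 h3; lra.
have dy : (y1-y3)^+2 <= x3^+2 - x1^+2.
  case: dy2 => // q; have : x3^+2 - x1^+2 >= 0; last by clear -q; lra.
  by have -> : x3^+2 - x1^+2 = (x3+x1)*(x3-x1) by [ring]; apply: mulr_ge0; clear -q3 h1 h3'; lra.
have : 0 <= (1 - x3)*(x3 - 7/10) by apply: mulr_ge0; clear -b3 h3'; lra.
have : 0 <= (1 - x3)*(- x1 - 1/2) by apply: mulr_ge0; clear -b3 p2; lra.
by clear -wr dy p2 h3' b3; lra.
Qed.

(** The last hypothesis reflects the period 2: the leftmost point moved by 2 must also keep distance
    1 from the rightmost one, or coincide with it. Three spaced points leave no room for a strict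
    gap, so they coincide. *)
Lemma wrapped_three (t x1 y1 x2 y2 x3 y3 : R) :
  spread_top t 1 [:: (x1, y1); (x2, y2); (x3, y3)] -> x1 < x2 -> x2 < x3 ->
  (x1 + 2 = x3 /\ y1 = y3) \/ 1 <= (x1 + 2 - x3)^+2 + (y1 - y3)^+2 ->
  [/\ x1 = -1, x3 = 1 & y1 = y3].
Proof.
move=> sp l12 l23 wr; have [_ h _] := sp.
have [_ _ /andP[b1 _]] := h x1 y1 ltac:(by rewrite !inE eqxx).
have [_ _ /andP[_ b3]] := h x3 y3 ltac:(by rewrite !inE eqxx ?orbT).
suff [e1 ->] : x1 + 2 = x3 /\ y1 = y3 by split=> //; clear -e1 b1 b3; lra.
have [x20|x20] := leP 0 x2; first exact: wrapped_three_right sp l12 l23 x20 wr.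
suff [e1 e2] : - x3 + 2 = - x1 /\ y3 = y1 by split=> //; clear -e1; lra.
apply: (@wrapped_three_right t (-x3) y3 (-x2) y2 (-x1) y1); try by clear -l12 l23 x20; lra.
  have mm x y : (x, y) \in [:: (-x3, y3); (-x2, y2); (-x1, y1)] -> (-x, y) \in [:: (x1, y1); (x2, y2); (x3, y3)].
    by rewrite !inE => /or3P[] /eqP[-> ->]; rewrite opprK eqxx ?orbT.
  split.
  - rewrite /= !inE !negb_or !andbT -!andbA; apply/and3P; split; apply/eqP => -[q _]; clear -q l12 l23; lra.
  - by move=> x y /mm /h[? + /andP[? ?]]; rewrite sqrrN => ?; split=> //; apply/andP; split; lra.
  move=> x y x' y' /mm m /mm m' n; have [_ _ sep] := sp.
  have := sep _ _ _ _ m m'; have -> : (-x' - -x)^+2 = (x'-x)^+2 by ring.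
  by apply; apply: contra_neq n => -[/oppr_inj -> ->].
case: wr => [[i j]|wr]; [left|right]; first by split=> //; clear -i; lra.
by clear -wr; lra.
Qed.

(** A lone bottom point [(b, -h)] and two top points form an equilateral triangle by [triple_sum].
    The period 2 then leaves only the upright triangle with [b = 0], the case treated by
    [no_special1]. *)
Lemma two_tops (t b h x1 y1 x2 y2 : R) : b^+2+h^+2 = t -> 1 <= t -> 0 < h -> -1/2 <= b <= 1/2 ->
  x1^+2+y1^+2 = t -> x2^+2+y2^+2 = t -> 0 < y1 -> 0 < y2 -> -1 <= x1 -> x2 <= 1 -> x1 < x2 ->
  b + x1 + x2 = 0 -> - h + y1 + y2 = 0 ->
  (x1 + 2 = x2 /\ y1 = y2) \/ 1 <= (x1 + 2 - x2)^+2 + (y1 - y2)^+2 ->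
  [/\ b = 0, x1 = -1, x2 = 1, y1 = h/2 & y2 = h/2].
Proof.
move=> eb t1 h0 /andP[b1 b2] e1 e2 y10 y20 l1 l2 l12 ex ey wr.
have ww := s3_sq R; have w0 := s3_gt0 R.
have eb' : b^+2 + (-h)^+2 = t by rewrite sqrrN.
have [[i1 i2 i3 i4]|[i1 i2 i3 i4]] := @triple_sum _ t b (-h) x1 y1 x2 y2 s3 ww eb' e1 e2 ex ey.
  have : 0 < s3 * h by rewrite mulr_gt0.
  by clear -i1 i3 l12; lra.
have hk : (s3*h)^+2 = 3/4*h^+2 by rewrite exprMn ww.
have yb : s3^+2 * b^+2 <= (h/2)^+2.
  rewrite -exprMn; apply: sqr_le; clear -i2 i4 y10 y20; lra.
have b4 : b^+2 <= (1/2)^+2 by apply: sqr_le; clear -b1 b2; lra.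
have hp : 0 < s3 * h by rewrite mulr_gt0.
have h34 : 3/4 <= s3*h.
  rewrite leNgt; apply/negP => q; have : (s3*h)^+2 < (3/4)^+2 by rewrite ltr_pXn2r // ?nnegrE //; clear -hp q; lra.
  by rewrite hk; clear -eb t1 b4; lra.
have dx : x1 + 2 - x2 = 2 * (1 - s3*h) by clear -i1 i3; lra.
have dy : y1 - y2 = - 2 * (s3 * b) by clear -i2 i4; lra.
have q0 : (1 - s3*h)^+2 <= (1/4)^+2 by apply: sqr_le; clear -h34 dx l1 l2; lra.
case: wr => [[w1 w2]|wr].
  have b0 : b = 0.
    have : s3 * b = 0 by clear -dy w2; lra.
    by move/eqP; rewrite mulf_eq0 gt_eqF //= => /eqP.
  by move: i1 i2 i3 i4; rewrite b0 => i1 i2 i3 i4; split=> //; clear -i1 i2 i3 i4 w1 w2; lra.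
exfalso.
rewrite dx dy in wr.
have wr' : 1 <= 4 * (1 - s3*h)^+2 + 3 * b^+2.
  have : (- 2 * (s3 * b))^+2 = 3 * b^+2 by have -> : (- 2 * (s3 * b))^+2 = 4 * (s3^+2 * b^+2) by [ring]; rewrite ww; lra.
  by clear -wr; lra.
have bq : b^+2 = 1/4 by clear -wr' b4 q0; lra.
have h3 : h^+2 = 3/4.
  have : s3 * h <= 3/4.
    rewrite leNgt; apply/negP => q.
    have : (1 - s3*h)^+2 < (1/4)^+2 by rewrite ltr_pXn2r // ?nnegrE //; clear -q dx l1 l2; lra.
    by clear -wr' bq; lra.
  by move=> q; have e : s3 * h = 3/4 by [clear -q h34; lra]; move: hk; rewrite e; clear; lra.
have /eqP : y1 * y2 = 0.
  have -> : y1*y2 = (h/2)^+2 - s3^+2*b^+2 by rewrite i2 i4; ring.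
  by rewrite ww bq exprMn h3; field.
by rewrite mulf_eq0 !gt_eqF.
Qed.

End Row.

Lemma lt_of_sqr (R : realDomainType) (a b : R) : 0 <= b -> a^+2 < b^+2 -> a < b.
Proof.
by move=> b0 l; rewrite ltNge; apply/negP => h; have := @sqr_le _ b a ltac:(lra) h; lra.
Qed.

Section HalfRow.
Variable R : realType.
Implicit Types (N : R -> R -> Prop) (s h : R).

(* The configuration seen from a point of a sparse row: its own row has spacing 2, and the nearest
   row below, at depth h, has spacing 1 *)
Record half_row N s h : Prop := HalfRow {
  hr_conf : conf N;
  hr_per : forall x y (i : int), N x y -> N (x + 2*i%:~R) y;
  hr_row : forall x, N x 0 -> exists i : int, x = 2*i%:~R;
  hr_origin : N 0 0;
  hr_below : forall j : int, N (j%:~R - s) (-h);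
  hr_below_inv : forall x, N x (-h) -> exists j : int, x = j%:~R - s;
  hr_gap : forall x y, N x y -> y < 0 -> y = -h \/ y <= - (2*h);
  hr_s : 0 <= s <= 1/2;
  hr_h : 0 < h;
  hr_t : 1 <= s^+2+h^+2 }.

Lemma hr_h2 N s h : half_row N s h -> 3/4 <= h^+2.
Proof.
move=> H.
have /andP[a b] := hr_s H; have := hr_t H.
have : s^+2 <= (1/2)^+2 by apply: sqr_le; lra.
lra.
Qed.

Lemma hr_ring_bottom N s h x y t : half_row N s h -> N x y -> x^+2+y^+2 = t -> t < 4*h^+2 -> y < 0 ->
  y = -h /\ exists j : int, x = j%:~R - s.
Proof.
move=> H. have h0 := hr_h H.
move=> k e l y0; case: (hr_gap H k y0) => [ey|ly].
  by split=> //; apply: (hr_below_inv H); rewrite -ey.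
have : (2*h)^+2 <= (-y)^+2 by apply: sqr_le; have := h0; lra.
by rewrite sqrrN; have := sqr_ge0 x; lra.
Qed.

Lemma int_offset (j : int) (c : R) : 0 <= c <= 1/2 -> c^+2 <= (j%:~R - c)^+2.
Proof.
move=> /andP[c0 c1].
have [jl|jl] : (j <= 0)%R \/ (1 <= j)%R by lia.
  have : (j%:~R : R) <= 0 by rewrite lerz0.
  by rewrite -sqrrN => q; apply: sqr_le; lra.
have : 1 <= (j%:~R : R) by rewrite ler1z.
by move=> q; apply: sqr_le; lra.
Qed.

(* A ring without points below the axis has none above. *)
Lemma hr_above N s h x y : half_row N s h -> N x y -> 0 < y -> s^+2 + h^+2 <= x^+2+y^+2.
Proof.
move=> H. have ck := hr_conf H; have k0 := hr_origin H.
move=> k y0; rewrite leNgt; apply/negP => l.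
have [q uq [mq _ sy]] := ring0 (x^+2+y^+2) ck k0.
have nn v : v \in q -> 0 <= v.2.
  case: v => a b /mq[kk e] /=; rewrite leNgt; apply/negP => b0.
  have h2 := hr_h2 H; have /andP[s0 s1] := hr_s H.
  have s2 : s^+2 <= (1/2)^+2 by apply: sqr_le; lra.
  have [eb [j ej]] := hr_ring_bottom H kk e ltac:(lra) b0.
  by have := int_offset j (hr_s H); rewrite -ej eb in e *; lra.
have := sy; rewrite big_seq => /eqP; rewrite psumr_eq0 // => /allP z.
have /z : (x, y) \in q by apply/mq.
by move=> /implyP/(_ ((mq _ _).2 (conj k erefl)))/eqP /= y00; move: y0; rewrite y00 ltxx.
Qed.

Lemma hr_above2 N s h x y : half_row N s h -> N x y -> 0 < y -> s^+2+h^+2 <= (x-2)^+2+y^+2 /\ s^+2+h^+2 <= (x+2)^+2+y^+2.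
Proof.
move=> H.
move=> k y0; have k1 := hr_per H (-1) k; have k2 := hr_per H 1 k; split.
  by have := hr_above H k1 y0; rewrite mulrN1.
by have := hr_above H k2 y0; rewrite mulr1.
Qed.

Lemma hr_level N s h t x : half_row N s h -> asym N t x 0 -> False.
Proof.
move=> H.
move=> [k _ n]; apply: n; rewrite oppr0; have [i ei] := hr_row H k.
by have := hr_per H (-i) (hr_origin H); rewrite add0r mulrNz mulrN -ei.
Qed.

Lemma hr_wrap N s h x y x' y' : half_row N s h -> N x y -> N x' y' ->
  (x + 2 = x' /\ y = y') \/ 1 <= (x + 2 - x')^+2 + (y - y')^+2.
Proof.
move=> H. have ck := hr_conf H.
move=> k k'; have k1 := hr_per H 1 k; rewrite mulr1 in k1.
by case: (sepP ck k' k1) => [[-> ->]|]; [left|right].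
Qed.

(* If the two lowest points of a ring are (c, -h) and (-c, -h), the heights of the points
   above the axis sum to 2 h; hence they cannot all lie strictly between h and 2 h. *)
Lemma no_balance N s h (c t : R) : half_row N s h -> c != 0 -> t < 4*h^+2 -> c^+2+h^+2 = t ->
  N c (-h) -> N (-c) (-h) ->
  (forall x y, N x y -> x^+2+y^+2 = t -> y < 0 -> x = c \/ x = -c) ->
  (forall x y, N x y -> x^+2+y^+2 = t -> 0 < y -> h < y) -> False.
Proof.
move=> H. have ck := hr_conf H; have k0 := hr_origin H; have h0 := hr_h H.
move=> cn tl et kc kc' bot top.
have [q uq [mq _ sy]] := ring0 t ck k0.
pose B := [seq v <- q | v.2 < 0]; pose T := [seq v <- q | ~~ (v.2 < 0) & v.2 != 0].
have eB : perm_eq B [:: (c, -h); (-c, -h)].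
  apply: uniq_perm; first exact: filter_uniq.
    rewrite /= inE andbT; apply: contra_neqN cn => /eqP[e]; lra.
  move=> [a b]; rewrite mem_filter !inE /=; apply/andP/orP => [[b0 /mq[kk e]]|].
    have [-> _] := hr_ring_bottom H kk e tl b0.
    by case: (bot _ _ kk e b0) => ->; rewrite eqxx; [left|right].
  move=> [] /eqP[-> ->]; split; rewrite ?oppr_lt0 ?h0 //; apply/mq; split=> //; rewrite ?sqrrN //.
have sB : \sum_(v <- B) v.2 = - (2*h).
  by rewrite (sum_perm _ eB) !big_cons big_nil /=; lra.
have sT : \sum_(v <- T) v.2 = 2 * h.
  move: sy; rewrite (bigID (fun v : R * R => v.2 < 0)) /= -big_filter -/B sB.
  rewrite (bigID (fun v : R * R => v.2 == 0)) /= [X in _ + (X + _)]big1 => [|v /andP[_ /eqP //]].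
  by rewrite -big_filter; lra.
have mT v : v \in T -> h < v.2 /\ v.2 < 2*h.
  case: v => a b; rewrite mem_filter /= -leNgt => /andP[/andP[b1 b2] /mq[kk e]].
  have b0 : 0 < b by rewrite lt_neqAle eq_sym b2.
  split; first exact: top kk e b0.
  apply: lt_of_sqr; first by have := h0; lra.
  by rewrite exprMn; have := sqr_ge0 a; lra.
move: sT mT; case: T => [|u [|v T]] sT mT.
- by move: sT; rewrite big_nil; lra.
- by have [] := mT u (seq.mem_head _ _); move: sT; rewrite big_cons big_nil; lra.
have [a1 _] := mT u (seq.mem_head _ _); have [a2 _] := mT v (mem_second _ _ _).
move: sT; rewrite !big_cons; have : 0 <= \sum_(j <- T) j.2; last by lra.
rewrite big_seq; apply: sumr_ge0 => w mw; have [] := mT w; last by lra.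
by rewrite !inE mw !orbT.
Qed.

(** This borderline case survives in the nearest ring and falls in the ring through [(1, -h)] and
    [(-1, -h)]: the points at height [h/2] push every upper point of that ring above height [h],
    contrary to [no_balance]. *)
Lemma no_special1 N s h : half_row N s h -> s = 0 -> h^+2 = 4/3 -> N 1 (h/2) -> N (-1) (h/2) -> False.
Proof.
move=> H. have ck := hr_conf H; have h1 := hr_h H.
move=> s0 hh k1 k2.
apply: (@no_balance _ _ _ 1 (7/3) H); rewrite ?oner_neq0 //; [lra|lra| | | |].
- by have := hr_below H 1; rewrite s0 subr0.
- by have := hr_below H (-1); rewrite s0 subr0.
- move=> x y k e y0; have [ey [j]] := hr_ring_bottom H k e ltac:(lra) y0.
  rewrite s0 subr0 => _; have /eqP : x^+2 = 1 by rewrite ey in e; lra.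
  by rewrite sqrf_eq1 => /orP[] /eqP; [left|right].
have key x y : N x y -> x^+2+y^+2 = 7/3 -> 0 < y -> x < 1.
  move=> k e y0; rewrite ltNge; apply/negP => x1.
  have [[i j]|sp] := sepP ck k1 k; first by rewrite i j in e; lra.
  have l : x + h/2 * y <= 4/3 by lra.
  have hy : 0 < h/2*y by rewrite mulr_gt0 //; lra.
  have x2 : x <= 4/3 by lra.
  have y2 : 5/9 <= y^+2 by have := @sqr_le _ x (4/3) ltac:(lra) x2; lra.
  have : (1/3)^+2 < (h/2*y)^+2.
    by have -> : (h/2*y)^+2 = h^+2/4*y^+2 by [field]; rewrite hh; lra.
  by move=> sqq; apply lt_of_sqr in sqq; lra.
move=> x y k e y0; have x1 := key _ _ k e y0.
have x2 : -1 < x.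
  rewrite ltNge; apply/negP => x2.
  have [[i j]|sp] := sepP ck k2 k; first by rewrite i j in e; lra.
  have l : - x + h/2 * y <= 4/3 by lra.
  have hy : 0 < h/2*y by rewrite mulr_gt0 //; lra.
  have y2 : 5/9 <= y^+2 by have := @sqr_le _ (-x) (4/3) ltac:(lra) ltac:(lra); rewrite sqrrN; lra.
  have : (1/3)^+2 < (h/2*y)^+2.
    by have -> : (h/2*y)^+2 = h^+2/4*y^+2 by [field]; rewrite hh; lra.
  by move=> sqq; apply lt_of_sqr in sqq; lra.
have : h^+2 < y^+2.
  have : 0 < (1-x)*(1+x) by apply: mulr_gt0; lra.
  by lra.
by move=> sqq; apply lt_of_sqr in sqq; lra.
Qed.

Lemma special2_range N s h (k r : R) : half_row N s h -> 0 < k -> 0 < r -> k^+2 = h^+2 - 3/4 -> r^+2 = h^+2+1/4 -> 2*k+r = 2*h ->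
  [/\ 23/25 < h^+2, h^+2 < 47/50 & 2/5 < k].
Proof.
move=> H. have h1 := hr_h H.
move=> kp r0 ek er e.
have e1 : 8 * (h*k) = 7 * h^+2 - 13/4.
  have : r^+2 = (2*h-2*k)^+2 by congr (_ ^+ 2); lra.
  by rewrite er; lra.
have e2 : 64 * (h^+2 * (h^+2 - 3/4)) = (7 * h^+2 - 13/4)^+2.
  by rewrite -ek -e1; ring.
have h2 := hr_h2 H; move: (h^+2) e2 h2 ek => z e2 h2 ek.
have e3 : 15 * z^+2 - 5/2 * z - 169/16 = 0 by lra.
have z1 : 23/25 < z by rewrite ltNge; apply/negP => q; have : z * z <= 23/25*z by [apply: ler_wpM2r; lra]; lra.
have z2 : z < 47/50 by rewrite ltNge; apply/negP => q; have : 47/50*z <= z * z by [apply: ler_wpM2r; lra]; lra.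
split=> //; have : (2/5)^+2 < k^+2 by rewrite ek; lra.
by move=> sqq; apply lt_of_sqr in sqq; lra.
Qed.

(** The second borderline case, with upper points [(-1, k)], [(0, r)], [(1, k)]. It falls in the
    ring through [(3/2, -h)] and [(-3/2, -h)], again by [no_balance]. *)
Lemma no_special2 N s h k r : half_row N s h -> s = 1/2 -> 0 < k -> 0 < r -> k^+2 = h^+2 - 3/4 -> r^+2 = h^+2+1/4 -> 2*k+r = 2*h ->
  N 1 k -> N (-1) k -> False.
Proof.
move=> H. have ck := hr_conf H; have h1 := hr_h H.
move=> s2 kp r0 ek er e k1 k2.
have [z1 z2 kl] := special2_range H kp r0 ek er e.
apply: (@no_balance _ _ _ (3/2) (9/4 + h^+2) H).
- by apply/eqP; lra.
- by lra.
- by lra.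
- by apply: (conv2 (hr_below H 2)); lra.
- by apply: (conv2 (hr_below H (-1))); lra.
- move=> x y kk ee y0; have [ey _] := hr_ring_bottom H kk ee ltac:(lra) y0.
  have /eqP : x^+2 = (3/2)^+2 by rewrite ey in ee; lra.
  by rewrite eqf_sqr => /orP[] /eqP; [left|right].
clear r0 er e.
have key (x y : R) : x^+2+y^+2 = 9/4+h^+2 -> 0 < y -> 1 <= (x-1)^+2+(y-k)^+2 -> x < 3/2.
  clear -ek z1 z2 kl; move=> e y0 sp; rewrite ltNge; apply/negP => x1.
  have l : x + k * y <= h^+2+3/4 by lra.
  have ky : 0 < k*y by rewrite mulr_gt0 //; lra.
  have x2 : x <= 17/10 by lra.
  have y2 : 1/4 <= y^+2 by have := @sqr_le _ x (17/10) ltac:(lra) x2; lra.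
  have y3 : 1/2 <= y by case: (@le_abs_sqr _ y (1/2) ltac:(lra)); [|by []|]; lra.
  have : 2/5 * (1/2) <= k * y by apply: ler_pM; lra.
  lra.
have far x y c : c^+2 = 1 -> N c k -> N x y -> x^+2+y^+2 = 9/4+h^+2 -> 1 <= (x-c)^+2+(y-k)^+2.
  move=> c2 kc kk ee; have [[i j]|//] := sepP ck kc kk.
  by rewrite i j c2 in ee; lra.
move=> x y kk ee y0.
have x1 := key _ _ ee y0 (far _ _ 1 ltac:(ring) k1 kk ee).
have x2 : - x < 3/2.
  apply: (key _ y); rewrite ?sqrrN //.
  by have := far _ _ (-1) ltac:(ring) k2 kk ee; lra.
have : h^+2 < y^+2.
  have : 0 < (3/2-x)*(3/2+x) by apply: mulr_gt0; lra.
  by lra.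
by move=> sqq; apply lt_of_sqr in sqq; lra.
Qed.
End HalfRow.

Lemma int_trich (R : realType) (j c : int) :
  (j%:~R : R) <= c%:~R - 1 \/ j = c \/ c%:~R + 1 <= (j%:~R : R).
Proof.
have [l|[e|l]] : j <= c - 1 \/ j = c \/ c + 1 <= j by lia.
- by left; have <- : (c - 1)%:~R = c%:~R - 1 :> R; [by rewrite intrB|rewrite ler_int].
- by right; left.
by right; right; have <- : (c + 1)%:~R = c%:~R + 1 :> R; [by rewrite intrD|rewrite ler_int].
Qed.

Lemma sum_pos_nil (R : realDomainType) (q : seq (R * R)) :
  (forall x y, (x, y) \in q -> 0 < y) -> \sum_(v <- q) v.2 = 0 -> q = [::].
Proof.
case: q => [//|[x y] q] p; rewrite big_cons /= => e; exfalso; have := p x y (seq.mem_head _ _).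
suff : 0 <= \sum_(v <- q) v.2 by lra.
by rewrite big_seq; apply: sumr_ge0 => -[a b] m; apply: ltW; apply: (p a); rewrite inE m orbT.
Qed.

Section HalfRow2.
Variable R : realType.
Implicit Types (N : R -> R -> Prop) (s h t b x y : R) (T B : seq (R * R)).

Lemma small_shift s : 0 <= s <= 1/2 -> s^+2 <= (1/2)^+2.
Proof. by move=> /andP[? ?]; apply: sqr_le; lra. Qed.

Lemma hr_bottom1 N s h u v : half_row N s h -> asym N (s^+2+h^+2) u v -> v < 0 ->
  [/\ v = -h, u^+2 = s^+2 & (u = s -> s <> - s -> s = 1/2)].
Proof.
move=> H [k e _] v0; have h2 := hr_h2 H; have s2 := small_shift (hr_s H); have /andP[s0 s1] := hr_s H.
have tl : s^+2+h^+2 < 4*h^+2 by clear -s2 h2; lra.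
have [ev [j ej]] := hr_ring_bottom H k e tl v0.
split=> //; first by rewrite ev in e; clear -e; lra.
move=> us ns; have js : 2*s = j%:~R by clear -us ej; lra.
clear k e s2 h2 tl.
have [jl|[jl|jl]] := int_trich R j 1.
- by exfalso; apply: ns; lra.
- by rewrite jl in js; lra.
by lra.
Qed.

Lemma hr_top1 N s h T : half_row N s h -> uniq T -> 
  (forall x y, (x, y) \in T <-> asym N (s^+2+h^+2) x y /\ 0 < y) -> spread_top (s^+2+h^+2) 1 T.
Proof.
move=> H uT mT; apply: asym_spread (hr_conf H) uT _ => u v /mT[a v0]; split=> //; case: a => k e _.
by have [l r] := hr_above2 H k v0; clear -l r e; apply/andP; split; lra.
Qed.

Lemma hr_three N s h x1 y1 x2 y2 x3 y3 : half_row N s h -> let T := [:: (x1, y1); (x2, y2); (x3, y3)] in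
  spread_top (s^+2+h^+2) 1 T -> sorted (fun u v : R * R => u.1 < v.1) T ->
  (forall u v, (u, v) \in T -> asym N (s^+2+h^+2) u v /\ 0 < v) -> [/\ x1 = -1, x3 = 1, y1 = y3 & 0 < y1 /\ 0 < y2].
Proof.
move=> H T sT so aT; move: so => /= /and3P[l12 l23 _].
have [[k1 _ _] y10] := aT x1 y1 ltac:(by rewrite !inE eqxx).
have [_ y20] := aT x2 y2 ltac:(by rewrite !inE eqxx ?orbT).
have [[k3 _ _] _] := aT x3 y3 ltac:(by rewrite !inE eqxx ?orbT).
by have [? ? ?] := wrapped_three sT l12 l23 (hr_wrap H k1 k3); split.
Qed.

Lemma hr_one_bottom N s h b T : half_row N s h -> asym N (s^+2+h^+2) b (-h) -> b^+2 = s^+2 ->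
  spread_top (s^+2+h^+2) 1 T -> sorted (fun u v : R * R => u.1 < v.1) T -> (size T <= 3)%N ->
  (forall u v, (u, v) \in T -> asym N (s^+2+h^+2) u v /\ 0 < v) ->
  \sum_(v <- T) v.1 = - b -> \sum_(v <- T) v.2 = h -> False.
Proof.
move=> H ab eb sT so T3 aT; have hh := hr_h H; have t1 := hr_t H; have /andP[s0 s1] := hr_s H.
have b1 : -1/2 <= b <= 1/2.
  have s2 := small_shift (hr_s H); rewrite -eb in s2.
  by have := @sqr_le_abs _ b (1/2) ltac:(clear; lra) s2; clear; lra.
have et : b^+2 + h^+2 = s^+2+h^+2 by rewrite eb.
case: T T3 sT so aT => [|[x1 y1] [|[x2 y2] [|[x3 y3] [|? ?]]]] //= _ sT so aT; rewrite ?big_cons ?big_nil /= => sx sy.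
- by clear -sy hh; lra.
- have [a1 _] := aT x1 y1 (seq.mem_head _ _).
  by apply: (asymN ab a1); clear -sx sy; lra.
- have /andP[l12 _] := so.
  have [a1 y10] := aT x1 y1 (seq.mem_head _ _); have [a2 y20] := aT x2 y2 (mem_second _ _ _).
  have [k1 e1 _] := a1; have [k2 e2 _] := a2; have [_ hb _] := sT.
  have [_ _ /andP[c1 _]] := hb x1 y1 (seq.mem_head _ _); have [_ _ /andP[_ c2]] := hb x2 y2 (mem_second _ _ _).
  have ex : b + x1 + x2 = 0 by clear -sx; lra.
  have ey : - h + y1 + y2 = 0 by clear -sy; lra.
  have [bz i1 i3 i2 i4] := two_tops et t1 hh b1 e1 e2 y10 y20 c1 c2 l12 ex ey (hr_wrap H k1 k2).
  have sz : s = 0 by apply/eqP; rewrite -sqrf_eq0 -eb bz expr0n.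
  apply: (no_special1 H sz); [|by rewrite -i4 -i3|by rewrite -i2 -i1].
  by rewrite i3 i4 sz in e2; clear -e2; lra.
have [i1 i3 i2 [y10 y20]] := hr_three H sT so aT.
have [[_ e2 _] _] := aT x2 y2 (mem_second _ _ _).
have x2b : x2 = - b by clear -sx i1 i3; lra.
have /eqP : y2^+2 = h^+2 by rewrite x2b sqrrN eb in e2; clear -e2; lra.
by rewrite eqf_sqr => /orP[] /eqP e; clear -e sy y10 y20 i2 hh; lra.
Qed.

Lemma hr_two_bottoms N s h T : half_row N s h -> asym N (s^+2+h^+2) (-s) (-h) -> asym N (s^+2+h^+2) s (-h) -> s = 1/2 ->
  spread_top (s^+2+h^+2) 1 T -> sorted (fun u v : R * R => u.1 < v.1) T -> (size T <= 3)%N ->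
  (forall u v, (u, v) \in T -> asym N (s^+2+h^+2) u v /\ 0 < v) ->
  \sum_(v <- T) v.1 = 0 -> \sum_(v <- T) v.2 = 2 * h -> False.
Proof.
move=> H ab1 ab2 sh sT so T3 aT; have hh := hr_h H; have h2 := hr_h2 H.
case: T T3 sT so aT => [|[x1 y1] [|[x2 y2] [|[x3 y3] [|? ?]]]] //= _ sT so aT; rewrite ?big_cons ?big_nil /= => sx sy.
- by clear -sy hh; lra.
- have [[_ e1 _] _] := aT x1 y1 (seq.mem_head _ _).
  have x10 : x1 = 0 by clear -sx; lra.
  have y10 : y1 = 2 * h by clear -sy; lra.
  by rewrite x10 y10 sh in e1; clear -e1 h2; lra.
- have [a1 y10] := aT x1 y1 (seq.mem_head _ _); have [a2 y20] := aT x2 y2 (mem_second _ _ _).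
  have [_ e1 _] := a1; have [_ e2 _] := a2.
  have e4 : (-s)^+2 + h^+2 = s^+2+h^+2 by rewrite sqrrN.
  have n12 : y1 + y2 != 0 by rewrite lt0r_neq0 // addr_gt0.
  have ex : x1 + x2 = s + - s by clear -sx; lra.
  have ey : y1 + y2 = h + h by clear -sy; lra.
  have [[f1 f2]|[f1 f2]] := pair_sum e1 e2 (erefl _) e4 ex ey n12.
    by apply: (asymN ab1 a1); clear -f1 f2; lra.
  by apply: (asymN ab2 a1); clear -f1 f2; lra.
have [i1 i3 i2 [y10 y20]] := hr_three H sT so aT.
have [[k1 e1 _] _] := aT x1 y1 (seq.mem_head _ _).
have [[_ e2 _] _] := aT x2 y2 (mem_second _ _ _).
have [[k3 _ _] _] := aT x3 y3 ltac:(by rewrite !inE eqxx !orbT).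
have x20 : x2 = 0 by clear -sx i1 i3; lra.
apply: (no_special2 H sh y10 y20).
- by rewrite i1 sh in e1; clear -e1; lra.
- by rewrite x20 sh in e2; clear -e2; lra.
- by clear -sy i2; lra.
- by rewrite -i3 i2.
by rewrite -i1.
Qed.

(** The nearest ring has at most three asymmetric points above, and below only [(-s, -h)] and
    possibly [(s, -h)]. The balance of each combination produces an antipodal pair or one of the two
    borderline cases. *)
Lemma hr_sym1 N s h x y : half_row N s h -> ~ asym N (s^+2+h^+2) x y.
Proof.
move=> H; have n0 u v : asym N (s^+2+h^+2) u v -> v != 0.
  by move=> a; apply: contra_not_neq (@hr_level _ _ _ _ (s^+2+h^+2) u H) => v0; rewrite -v0.
have [T [B [uT uB mT mB [sx sy]]]] := asym_split (hr_conf H) (hr_origin H) n0.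
have sT := hr_top1 H uT mT.
have bB u v : (u, v) \in B -> [/\ v = -h, u^+2 = s^+2 & (u = s -> s <> - s -> s = 1/2)].
  by move=> /mB[a v0]; apply: hr_bottom1 H a v0.
suff [eT eB] : T = [::] /\ B = [::].
  move=> a; have [l|l|e] := ltrgt0P y; last by have := n0 _ _ a; rewrite e eqxx.
    by have /mT : asym N (s^+2+h^+2) x y /\ 0 < y by []; rewrite eT.
  by have /mB : asym N (s^+2+h^+2) x y /\ y < 0 by []; rewrite eB.
have T3 := spread_top_le3 sT.
have [T' [pT sT' so]] := spread_top_sort sT.
have aT u v : (u, v) \in T' -> asym N (s^+2+h^+2) u v /\ 0 < v by rewrite -(perm_mem pT) => /mT.
rewrite !(sum_perm _ pT) in sx sy; rewrite (perm_size pT) in T3.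
suff [eT eB] : T' = [::] /\ B = [::].
  by split=> //; apply: perm_small_eq; rewrite ?eT // -eT.
clear T pT sT uT mT.
have mB' v : v \in B -> v = (-s, -h) \/ v = (s, -h).
  case: v => u v /bB[-> us _]; move/eqP: us; rewrite eqf_sqr => /orP[] /eqP ->; by [right|left].
have aB u v : (u, v) \in B -> asym N (s^+2+h^+2) u v by move=> /mB[].
have [B1|pB] := size_le_pair uB mB'.
  case: B B1 sx sy aB bB mB' {mB uB} => [|[b c] [|? ?]] //= _; rewrite ?big_cons ?big_nil /= => sx sy aB bB mB'.
    by split=> //; apply: sum_pos_nil; [move=> u v /aT[]|clear -sy; lra].
  exfalso; have [ec eb _] := bB b c (seq.mem_head _ _); have ab := aB b c (seq.mem_head _ _); subst c.
  by apply: (hr_one_bottom H ab eb sT' so T3 aT); [clear -sx; lra|clear -sy; lra].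
exfalso; rewrite !(sum_perm _ pB) !big_cons !big_nil /= in sx sy.
have mb1 : (-s, -h) \in B by rewrite (perm_mem pB) !inE eqxx.
have mb2 : (s, -h) \in B by rewrite (perm_mem pB) !inE eqxx orbT.
have sn : s <> - s.
  by move=> e; move: uB; rewrite (perm_uniq pB) /= inE -e eqxx.
have sh : s = 1/2 by have [_ _ q] := bB _ _ mb2; apply: q.
by apply: (hr_two_bottoms H (aB _ _ mb1) (aB _ _ mb2) sh sT' so T3 aT); [clear -sx; lra|clear -sy; lra].
Qed.

(** The disc about [(s, h)] cuts an arc out of the second ring. The arc starts at [(s - 1, h)], and
    [s + 1 - 2 * s^2] is the abscissa of its other end in the extreme case [s^2 + h^2 = 1]. The
    outer bounds come from the period 2 and [hr_above]. *)
Lemma top_range s h u v : 0 <= s -> s < 1/2 -> 0 < h -> 1 <= s^+2+h^+2 -> 0 < v -> u^+2+v^+2 = (1-s)^+2+h^+2 ->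
  s^+2+h^+2 <= (u-2)^+2+v^+2 -> s^+2+h^+2 <= (u+2)^+2+v^+2 -> 1 <= (u-s)^+2+(v-h)^+2 ->
  [/\ -(5/4-s/2) <= u, u <= 5/4-s/2 & u <= s - 1 \/ s + 1 - 2*s^+2 <= u].
Proof.
move=> s0 s1 h0 t1 v0 e l r sp.
have a1 : -(5/4-s/2) <= u by clear -e r; lra.
have a2 : u <= 5/4-s/2 by clear -e l; lra.
split=> //; have d : h*v <= s^+2+h^+2 - s - s*u by clear -sp e; lra.
have [q|q] := leP u (s-1); [by left|right].
rewrite leNgt; apply/negP => q2.
have hv := mulr_gt0 h0 v0.
have dd : (h*v)^+2 <= (s^+2+h^+2 - s - s*u)^+2.
  by apply: sqr_le => //; clear -d hv; lra.
have ev : h^+2 * v^+2 = h^+2 * ((1-s)^+2+h^+2 - u^+2) by rewrite -e; ring.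
have p1 : 0 < u - (s-1) by clear -q; lra.
have m1 : 0 < (u - (s-1)) * (s+1-2*s^+2 - u) by apply: mulr_gt0 p1 _; clear -q2; lra.
have m2 : (u - (s-1)) * (s+1-2*s^+2 - u) <= (s^+2+h^+2) * ((u - (s-1)) * (s+1-2*s^+2 - u)).
  rewrite -[X in X <= _]mul1r; apply: ler_wpM2r => //; exact: ltW.
have m3 : 0 <= (u - (s-1)) * (s^+2 * (s^+2+h^+2-1)).
  by apply: mulr_ge0 (ltW p1) _; apply: mulr_ge0; [exact: sqr_ge0|clear -t1; lra].
by rewrite exprMn ev in dd; clear -dd m1 m2 m3; lra.
Qed.

Lemma hr_side N s h u v : half_row N s h -> s < 1/2 -> N s h -> N u v -> u^+2+v^+2 = (1-s)^+2+h^+2 -> 0 < v ->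
  [/\ -(5/4-s/2) <= u, u <= 5/4-s/2 & u <= s - 1 \/ s + 1 - 2*s^+2 <= u].
Proof.
move=> H s1 ks k e v0; have [l r] := hr_above2 H k v0; have /andP[s0 _] := hr_s H.
have [[i j]|sp] := sepP (hr_conf H) ks k; first by exfalso; rewrite i j in e; clear -e s1; lra.
exact: top_range s0 s1 (hr_h H) (hr_t H) v0 e l r sp.
Qed.

Lemma two_sides s t T : 0 <= s -> s < 1/2 -> spread_top t (5/4-s/2) T ->
  (forall u v, (u, v) \in T -> [/\ -(5/4-s/2) <= u, u <= 5/4-s/2 & u <= s - 1 \/ s + 1 - 2*s^+2 <= u]) -> (size T <= 2)%N.
Proof.
move=> s0 s1 sT side; have [T' [pT sT' so]] := spread_top_sort sT; rewrite (perm_size pT).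
have {}side u v : (u, v) \in T' -> [/\ -(5/4-s/2) <= u, u <= 5/4-s/2 & u <= s - 1 \/ s + 1 - 2*s^+2 <= u].
  by rewrite -(perm_mem pT); exact: side.
case: T' sT' so side {pT sT} => [|[x1 y1] [|[x2 y2] [|[x3 y3] q]]] //= sT' /and3P[l12 l23 _] side; exfalso.
have m1 : (x1, y1) \in [:: (x1, y1), (x2, y2), (x3, y3) & q] by rewrite !inE eqxx.
have m2 : (x2, y2) \in [:: (x1, y1), (x2, y2), (x3, y3) & q] by rewrite !inE eqxx ?orbT.
have m3 : (x3, y3) \in [:: (x1, y1), (x2, y2), (x3, y3) & q] by rewrite !inE eqxx ?orbT.
have [_ d12 _] := spread_chord sT' m1 m2 l12; have [c23 _ _] := spread_chord sT' m2 m3 l23.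
have [b1 _ _] := side _ _ m1; have [_ b3 _] := side _ _ m3; have [_ _ []] := side _ _ m2 => q2.
  have := d12 ltac:(clear -l12 q2 s1; lra).
  have : (x2-x1)*(-x1) <= (1/4+s/2)*(5/4-s/2).
    by clear -b1 q2 s0 s1 l12; apply: ler_pM; lra.
  have : 0 < (1/2-s)*(3/2-s) by clear -s1; apply: mulr_gt0; lra.
  by clear; lra.
have ss : s*(1-2*s) >= 0 by clear -s0 s1; apply: mulr_ge0; lra.
have x20 : 1 <= x2 by clear -ss q2; lra.
have := c23 ltac:(clear -x20 l23; lra).
have : (x3-x2)*x3 <= (1/4)*(5/4) by clear -b3 x20 s0 l23; apply: ler_pM; lra.
by clear; lra.
Qed.

Lemma no_three_fold s h t b x1 y1 x2 y2 : 0 <= s -> s < 1/2 -> 0 < h -> 3/4 < h^+2 -> t = (1-s)^+2+h^+2 -> b = 1 - s \/ b = -1 /\ s = 0 -> 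
  x1^+2+y1^+2 = t -> x2^+2+y2^+2 = t -> 
  [/\ -(5/4-s/2) <= x1, x1 <= 5/4-s/2 & x1 <= s - 1 \/ s + 1 - 2*s^+2 <= x1] -> 
  [/\ -(5/4-s/2) <= x2, x2 <= 5/4-s/2 & x2 <= s - 1 \/ s + 1 - 2*s^+2 <= x2] ->
  b + x1 + x2 = 0 -> -h + y1 + y2 = 0 -> False.
Proof.
move=> s0 s1 hh h2 et hb e1 e2 [a1 a2 _] [b1 b2 _] ex ey.
have eb : b^+2 + (-h)^+2 = t by rewrite et sqrrN; case: hb => [->|[-> ->]]; ring.
have ww := s3_sq R; have w0 := s3_gt0 R.
have hk : (s3 R*h)^+2 = 3/4*h^+2 by rewrite exprMn ww.
suff q : s3 R * h <= 3/4.
  have p := mulr_gt0 w0 hh.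
  have : (s3 R*h)^+2 <= (3/4)^+2 by apply: sqr_le => //; clear -p; lra.
  by rewrite hk; clear -h2; lra.
have [[i1 _ i3 _]|[i1 _ i3 _]] := @triple_sum _ t b (-h) x1 y1 x2 y2 _ ww eb e1 e2 ex ey.
  by case: hb => [hb|[hb hs]]; [clear -hb i1 i3 a1 a2 b1 b2 s0 s1|clear -hb hs i1 i3 a1 a2 b1 b2]; lra.
by case: hb => [hb|[hb hs]]; [clear -hb i1 i3 a1 a2 b1 b2 s0 s1|clear -hb hs i1 i3 a1 a2 b1 b2]; lra.
Qed.

Lemma hr_bottom2 N s h u v : half_row N s h -> s < 1/2 -> N u v -> u^+2+v^+2 = (1-s)^+2+h^+2 -> v < 0 -> 
  v = -h /\ (u = 1-s \/ u = -1 /\ s = 0).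
Proof.
move=> H s1 k e v0; have h2 := hr_h2 H; have /andP[s0 _] := hr_s H.
have s12 : (1-s)^+2 <= 1^+2 by clear -s0 s1; apply: sqr_le; lra.
have [ev [j ej]] := hr_ring_bottom H k e ltac:(clear -s12 h2; lra) v0.
split=> //; rewrite ev sqrrN in e; have /eqP : (1-s)^+2 = u^+2 by clear -e; lra.
clear k e s12; rewrite eqf_sqr => /orP[] /eqP eu; [by left|right].
have ej2 : (j%:~R : R) = 2*s-1 by lra.
have [jl|[jl|jl]] := int_trich R j (-1); rewrite ?mulrNz in jl.
- by exfalso; lra.
- by rewrite jl mulrNz in ej2; split; lra.
by exfalso; lra.
Qed.

(** By [top_range] at most two asymmetric points lie above. Below there is [(1 - s, -h)], and also
    [(-1, -h)] if [s = 0]. Two top points against one would be an equilateral triangle, which is too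
    wide ([no_three_fold]). *)
Lemma hr_sym2 N s h x y : half_row N s h -> s < 1/2 -> N s h -> ~ asym N ((1-s)^+2+h^+2) x y.
Proof.
move=> H s1 ks; have [t et] : exists t, t = (1-s)^+2+h^+2 by eexists.
rewrite -et; have hh := hr_h H; have /andP[s0 _] := hr_s H.
have h2 : 3/4 < h^+2.
  have : 0 < (1/2-s)*(1/2+s) by clear -s0 s1; apply: mulr_gt0; lra.
  by have := hr_t H; clear; lra.
have n0 u v : asym N t u v -> v != 0.
  by move=> a; apply: contra_not_neq (@hr_level _ _ _ _ t u H) => v0; rewrite -v0.
have [T [B [uT uB mT mB [sx sy]]]] := asym_split (hr_conf H) (hr_origin H) n0.
have side u v : N u v -> u^+2+v^+2 = t -> 0 < v -> _ := fun k e => hr_side H s1 ks k (etrans e et).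
have sT : spread_top t (5/4-s/2) T.
  apply: asym_spread (hr_conf H) uT _ => u v /mT[[k e n] v0]; split=> //.
  by have [? ? _] := side _ _ k e v0; apply/andP.
have T2 : (size T <= 2)%N by apply: two_sides s0 s1 sT _ => u v /mT[[k e _] v0]; exact: side k e v0.
have aT u v : (u, v) \in T -> asym N t u v /\ 0 < v by move=> /mT.
have bB u v : (u, v) \in B -> [/\ v = -h, u = 1-s \/ u = -1 /\ s = 0 & asym N t u v].
  by move=> /mB[a v0]; have [k e _] := a; have [] := hr_bottom2 H s1 k (etrans e et) v0; split.
have pt u v : (u, v) \in T -> 0 < v by case/aT.
have eqT b x1 y1 x2 y2 : b = 1 - s \/ b = -1 /\ s = 0 -> asym N t x1 y1 -> asym N t x2 y2 -> 0 < y1 -> 0 < y2 ->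
    b + x1 + x2 = 0 -> -h + y1 + y2 = 0 -> False.
  move=> hb [k1 e1 _] [k2 e2 _] y10 y20.
  exact: no_three_fold s0 s1 hh h2 et hb e1 e2 (side _ _ k1 e1 y10) (side _ _ k2 e2 y20).
suff [eT eB] : T = [::] /\ B = [::].
  move=> a; have [l|l|e] := ltrgt0P y; last by have := n0 _ _ a; rewrite e eqxx.
    by have /mT : asym N t x y /\ 0 < y by []; rewrite eT.
  by have /mB : asym N t x y /\ y < 0 by []; rewrite eB.
clear side sT uT mT n0.
have [B1|pB] : (size B < 2)%N \/ perm_eq B [:: (1-s, -h); (-1, -h)].
  apply: size_le_pair uB _ => -[u v] /bB[-> [->|[-> _]] _]; by [left|right].
  case: B B1 sx sy bB {mB uB} => [|[b c] [|? ?]] //= _; rewrite ?big_cons ?big_nil /= => sx sy bB.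
    by split=> //; apply: sum_pos_nil => //; clear -sy; lra.
  exfalso; have [ec hb ab] := bB b c (seq.mem_head _ _); subst c.
  case: T T2 aT sx sy {pt} => [|[x1 y1] [|[x2 y2] [|? ?]]] //= _ aT; rewrite ?big_cons ?big_nil /= => sx sy.
  - by clear -sy hh; lra.
  - have [a1 _] := aT x1 y1 (seq.mem_head _ _).
    by apply: (asymN ab a1); clear -sx sy; lra.
  have [a1 y10] := aT x1 y1 (seq.mem_head _ _); have [a2 y20] := aT x2 y2 (mem_second _ _ _).
  by apply: (eqT b x1 y1 x2 y2) => //; clear -sx sy; lra.
exfalso; rewrite !(sum_perm _ pB) !big_cons !big_nil /= in sx sy.
have mb1 : (1-s, -h) \in B by rewrite (perm_mem pB) !inE eqxx.
have mb2 : (-1, -h) \in B by rewrite (perm_mem pB) !inE eqxx orbT.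
have [_ _ ab1] := bB _ _ mb1; have [_ hs ab2] := bB _ _ mb2.
have sz : s = 0 by case: hs => [e|[]//]; clear -e s0 s1; lra.
clear mB bB uB pB mb1 mb2; subst s; rewrite subr0 in et ab1 sx.
case: T T2 aT sx sy {pt} => [|[x1 y1] [|[x2 y2] [|? ?]]] //= _ aT; rewrite ?big_cons ?big_nil /= => sx sy.
- by clear -sy hh; lra.
- have [[_ e1 _] _] := aT x1 y1 (seq.mem_head _ _).
  have x10 : x1 = 0 by clear -sx; lra.
  have y10 : y1 = 2 * h by clear -sy; lra.
  by rewrite x10 y10 et in e1; clear -e1 h2; lra.
have [a1 y10] := aT x1 y1 (seq.mem_head _ _); have [a2 y20] := aT x2 y2 (mem_second _ _ _).
have [_ e1 _] := a1; have [_ e2 _] := a2.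
have e4 : (-1)^+2 + h^+2 = t by rewrite sqrrN et.
have n12 : y1 + y2 != 0 by rewrite lt0r_neq0 // addr_gt0.
have ex : x1 + x2 = 1 + -1 by clear -sx; lra.
have ey : y1 + y2 = h + h by clear -sy; lra.
have [[f1 f2]|[f1 f2]] := pair_sum e1 e2 (esym et) e4 ex ey n12.
- by apply: (asymN ab2 a1); clear -f1 f2; lra.
by apply: (asymN ab1 a1); clear -f1 f2; lra.
Qed.

(** Symmetry of the two nearest rings carries [(-s, -h)] and [(1 - s, -h)] to the row above; the
    period 2 fills that row. For [s = 1/2] both points lie on the same ring. *)
Theorem hr_full_above N s h (j : int) : half_row N s h -> N (s + j%:~R) h.
Proof.
move=> H; have /andP[s0 s1] := hr_s H.
have b0 : N (-s) (-h) by apply: (conv2 (hr_below H 0)); ring.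
have ks : N s h.
  have := sym_ring (fun x y => hr_sym1 (x := x) (y := y) H) b0; rewrite !opprK; apply; ring.
suff kn : N (s-1) h.
  have [k [->|->]] : exists k : int, j = 2*k \/ j = 2*k-1 by exists (divz (j+1) 2); lia.
    by apply: (conv2 (hr_per H k ks)) => //; rewrite intrM.
  by apply: (conv2 (hr_per H k kn)) => //; rewrite intrB intrM; ring.
have b1 : N (1-s) (-h) by apply: (conv2 (hr_below H 1)).
have [sl|sl] := ltP s (1/2).
  have := sym_ring (fun x y => hr_sym2 (x := x) (y := y) H sl ks) b1; rewrite opprK opprB; apply; ring.
have se : s = 1/2 by clear -s1 sl; lra.
by have := sym_ring (fun x y => hr_sym1 (x := x) (y := y) H) b1; rewrite opprK opprB; apply; rewrite se; field.
Qed.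

(** On the ring of such a point, moved by the period to [|x| <= 1], all points below lie in the row
    at depth [h], and their antipodes exist since the row above is full. So there is no asymmetric
    point below, hence none above, and the antipode of the point violates the gap below. *)
Theorem hr_empty_above N s h x y : half_row N s h -> N x y -> 0 < y -> h <= y.
Proof.
move=> H k y0; rewrite leNgt; apply/negP => yh; have h2 := hr_h2 H; have hh := hr_h H.
have [i i12] : exists i : int, -1 <= x + 2*i%:~R <= 1.
  by have [n /andP[l r]] := floorP ((x+1)/2); exists (-n); clear -l r; rewrite mulrNz; apply/andP; split; lra.
have k' := hr_per H i k; move: (x + _) k' i12 => {k}x k /andP[x1 x2].
have xx : x^+2 <= 1^+2 by apply: sqr_le.
have yy : y^+2 <= h^+2 by clear -y0 yh; apply: sqr_le; lra.
have [t et] : exists t, t = x^+2+y^+2 by eexists.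
have tl : t < 4*h^+2 by clear -et xx yy h2; lra.
have na u v : ~ asym N t u v.
  have n0 u' v' : asym N t u' v' -> v' != 0.
    by move=> a; apply: contra_not_neq (@hr_level _ _ _ _ t u' H) => v0; rewrite -v0.
  have [T [B [uT uB mT mB [sx sy]]]] := asym_split (hr_conf H) (hr_origin H) n0.
  have eB : B = [::].
    case: B mB {sx sy uB} => [//|[a b] B] mB; have /mB[[kk e n] b0] : (a, b) \in (a, b) :: B by rewrite inE eqxx.
    have [eb [j ej]] := hr_ring_bottom H kk e tl b0.
    case: n; rewrite eb ej opprK opprB; apply: (conv2 (hr_full_above (-j) H)) => //; by rewrite mulrNz.
  have eT : T = [::].
    apply: sum_pos_nil => [a b /mT[]//|]; by move: sy; rewrite eB big_nil addr0.
  move=> a; have [l|l|e] := ltrgt0P v; last by have := n0 _ _ a; rewrite e eqxx.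
    by have /mT : asym N t u v /\ 0 < v by []; rewrite eT.
  by have /mB : asym N t u v /\ v < 0 by []; rewrite eB.
have nk := sym_ring na k (esym et).
have yn : - y < 0 by rewrite oppr_lt0.
by have [] := hr_gap H nk yn; clear -yh y0 hh; lra.
Qed.
End HalfRow2.

(** * Classification of configurations containing a full line *)

Section LineClass.
Variable R : realType.
Implicit Types (K : R -> R -> Prop) (x y a b p q s h : R).

Definition lat K s h := forall x y, K x y <-> exists i j : int, x = i%:~R + j%:~R * s /\ y = j%:~R * h.

(** Three of the four parity classes of a lattice: the vertices and edge midpoints of the
    parallelograms with sides [2 * (1, 0)] and [2 * (s, h)]. *)
Definition lat34 K s h := forall x y, K x y <->
  exists i j : int, [/\ x = i%:~R + j%:~R * s, y = j%:~R * h & (exists k : int, i = 2*k) \/ (exists k : int, j = 2*k)].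

Lemma line_translate K p q a b (n : int) : line_sym K -> line_sym (move K p q 1 0) ->
  K a b -> K (a + n%:~R * (2 * p)) (b + n%:~R * (2*q)).
Proof.
move=> ls ls' k; move: n; apply: (@int_step _ 0) => [|n kn|n kn]; first by apply: (conv2 k); ring.
- have := ls _ _ kn 0; rewrite mulr0 sub0r => kn'.
  have kn2 : move K p q 1 0 (-(a + n%:~R * (2 * p)) - p) (-(b + n%:~R * (2*q)) - q).
    by rewrite shiftE; apply: (conv2 kn'); ring.
  have := ls' _ _ kn2 0; rewrite shiftE => kn3.
  by apply: (conv2 kn3); rewrite intrD; ring.
- have kn2 : move K p q 1 0 ((a + n%:~R * (2 * p)) - p) ((b + n%:~R * (2*q)) - q).
    by rewrite shiftE; apply: (conv2 kn); ring.
  have := ls' _ _ kn2 0; rewrite shiftE => kn3.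
  have := ls _ _ kn3 0 => kn4.
  by apply: (conv2 kn4); rewrite intrB; ring.
Qed.

Lemma reduce_mod b q : 0 < q -> exists n : int, -q <= b + n%:~R * (2*q) <= q.
Proof.
move=> q0; have [n /andP[l r]] := floorP ((b+q)/(2*q)).
have q2 : 0 < 2*q by rewrite mulr_gt0.
move: l r; rewrite ler_pdivlMr // ler_pdivrMr // => l r.
by exists (-n); rewrite mulrNz; apply/andP; split; lra.
Qed.

Lemma row_half K s h x : conf K -> line_sym K -> K s h -> K x h ->
  exists i : int, x = s + 2*i%:~R \/ (x = s + 1 + 2*i%:~R /\ K (s+1) h).
Proof.
move=> ck ls ks k; have ls0 a b : K a b -> K (-a) (-b) by move/ls/(_ 0); rewrite mulr0 sub0r.
have per a b (i : int) : K a b -> K (a + 2*i%:~R) b.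
  by move=> /ls0/ls/(_ i) ka; apply: (conv2 ka); ring.
have [i /andP[l r]] := reduce_mod (x - s - 1) (ltr01 : 0 < (1:R)).
have d a : K a h -> x + 2*i%:~R = a \/ 1 <= (x + 2*i%:~R - a)^+2.
  move=> ka; case: (sepP ck ka (per _ _ i k)) => [[-> _]|]; first by left.
  by rewrite subrr expr0n addr0; right.
have k2 : K (s+2) h by apply: (conv2 (per _ _ 1 ks)); ring.
have ki := per _ _ i k.
case: (d _ ks) => [e|d1]; first by exists (-i); left; rewrite mulrNz; lra.
case: (d _ k2) => [e|d2]; first by exists (1-i); left; rewrite intrB; lra.
have r1 : 1 <= x + 2*i%:~R - s.
  by move: d1; rewrite !leNgt; apply: contraNN => r1; rewrite expr_lt1 //; lra.
have r2 : x + 2*i%:~R - s <= 1.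
  move: d2; rewrite -sqrrN !leNgt; apply: contraNN => r2; rewrite expr_lt1 //; lra.
exists (-i); right; rewrite mulrNz; split; first by lra.
by apply: (conv2 ki); lra.
Qed.

(** If the infimum of the positive heights were not attained, three different heights would lie
    within [1/5] of each other. Modulo the period 2 the three abscissas would have to differ
    pairwise by about 1, which is impossible. *)
Lemma lowest K : conf K -> on_line K -> line_sym K -> (exists x y, K x y /\ y != 0) ->
  exists s h, [/\ 0 < h, K s h & forall x y, K x y -> 0 < y -> h <= y].
Proof.
move=> ck ok ls [x0 [y0 [k00 y00]]]; have ls0 a b : K a b -> K (-a) (-b) by move/ls/(_ 0); rewrite mulr0 sub0r.
have per a b (i : int) : K a b -> K (a + 2*i%:~R) b.
  by move=> /ls0/ls/(_ i) ka; apply: (conv2 ka); ring.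
pose E := [set y | 0 < y /\ exists x, K x y]%classic.
have E0 : (E !=set0)%classic.
  have [l|l] := ltP 0 y0; first by exists y0; split=> //; exists x0.
  exists (-y0); split; last by exists (-x0); apply: ls0.
  by rewrite oppr_gt0 lt_neqAle y00.
have hE : has_inf E by split=> //; exists 0 => y [/ltW].
have lE y : E y -> inf E <= y by apply: ge_inf; case: hE.
have [[y [Ey hy]]|nm] := pselect (exists y, E y /\ forall z, E z -> y <= z).
  have [yp [x k]] := Ey; exists x, y; split=> // a b kab b0; apply: hy; split=> //; by exists a.
exfalso.
have desc y : E y -> exists2 z, E z & z < y.
  move=> Ey; apply: contrapT => n; apply: nm; exists y; split=> // z Ez.
  by rewrite leNgt; apply/negP => l; apply: n; exists z.
have [y1 Ey1 l1] := @inf_adherent _ E (1/5) ltac:(lra) hE.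
have [y2 Ey2 l2] := desc y1 Ey1; have [y3 Ey3 l3] := desc y2 Ey2.
have := lE _ Ey3; move: l1 l2 l3; move: (inf E) => m l1 l2 l3 l4.
have nrm y : E y -> exists x, K x y /\ -1 <= x <= 1.
  move=> [_ [x k]]; have [i hi] := reduce_mod x (ltr01 : 0 < (1:R)).
  by exists (x + 2*i%:~R); split; [exact: per|move: hi; rewrite mulr1 mulrC].
have [x1 [k1 /andP[a1 b1]]] := nrm _ Ey1; have [x2 [k2 /andP[a2 b2]]] := nrm _ Ey2; have [x3 [k3 /andP[a3 b3]]] := nrm _ Ey3.
have far u v w z : K u v -> K w z -> v - z < 1/5 -> 0 < v - z -> 
   u - w <= -9/10 \/ 9/10 <= u - w.
  move=> k k' d1 d2; have [|l] := leP (u - w) (-9/10); first by left.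
  have [|l'] := leP (9/10) (u - w); first by right.
  exfalso; case: (sepP ck k' k) => [[_ e]|]; first by rewrite e subrr ltxx in d2.
  have := @sqr_le _ (u-w) (9/10) ltac:(lra) ltac:(lra).
  have := @sqr_le _ (v-z) (1/5) ltac:(lra) ltac:(lra).
  by clear; lra.
have {}far u v w z : K u v -> K w z -> v - z < 1/5 -> 0 < v - z -> -1 <= u <= 1 -> -1 <= w <= 1 ->
   (u - w <= -9/10 \/ 9/10 <= u - w) /\ -11/10 <= u - w <= 11/10.
  move=> k k' d1 d2 /andP[? ?] /andP[? ?]; split; first exact: far k k' d1 d2.
  have kp := per _ _ 1 k; have km := per _ _ (-1) k; rewrite mulrNz in km.
  by apply/andP; split; [case: (far _ _ _ _ kp k' d1 d2)|case: (far _ _ _ _ km k' d1 d2)]; lra.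
have h1 : -1 <= x1 <= 1 by apply/andP.
have h2 : -1 <= x2 <= 1 by apply/andP.
have h3 : -1 <= x3 <= 1 by apply/andP.
have := far _ _ _ _ k1 k2 ltac:(lra) ltac:(lra) h1 h2; have := far _ _ _ _ k2 k3 ltac:(lra) ltac:(lra) h2 h3; have := far _ _ _ _ k1 k3 ltac:(lra) ltac:(lra) h1 h3.
clear; move=> [[h1|h1] /andP[h2 h3]] [[h4|h4] /andP[h5 h6]] [[h7|h7] /andP[h8 h9]]; lra.
Qed.

(** The row at height [h] is full as well, so [line_symP] applies to it. Reflections through both
    rows compose to translations ([line_translate]) that bring every height into [[-h, h]], where
    only the known rows occur. *)
Lemma line_lat K s h : conf K -> on_line K -> line_sym K -> 0 < h ->
  (forall x y, K x y -> 0 < y -> h <= y) -> K s h -> K (s+1) h -> lat K s h.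
Proof.
move=> ck ok ls h0 low ks ks1; have ls0 a b : K a b -> K (-a) (-b) by move/ls/(_ 0); rewrite mulr0 sub0r.
have per a b (i : int) : K a b -> K (a + 2*i%:~R) b.
  by move=> /ls0/ls/(_ i) ka; apply: (conv2 ka); ring.
have row (i : int) : K (s + i%:~R) h.
  have [k [->|->]] : exists k : int, i = 2*k \/ i = 2*k+1 by exists (i %/ 2)%Z; lia.
    by apply: (conv2 (per _ _ k ks)) => //; rewrite intrM.
  by apply: (conv2 (per _ _ k ks1)) => //; rewrite intrD intrM; ring.
have rowP x : K x h -> exists i : int, x = s + i%:~R.
  move=> k; have [i [->|[-> _]]] := row_half ck ls ks k.
    by exists (2*i); rewrite intrM.
  by exists (2*i+1); rewrite intrD intrM; ring.
pose M := move K s h 1 0.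
have lsM : line_sym M.
  apply: line_symP; first by apply: conf_move => //; ring.
  by move=> i; rewrite /M shiftE addr0.
move=> x y; split=> [k|[i [j [-> ->]]]].
  have [n /andP[l r]] := reduce_mod y h0.
  have kn := line_translate n ls lsM k.
  have [yl|yl|ye] := ltrgtP (y + n%:~R * (2*h)) h; last 1 first.
  - rewrite ye in kn; have [i ei] := rowP _ kn.
    by exists i, (1 - 2*n); rewrite intrB intrM; split; lra.
  - have [yl'|yl'|ye'] := ltrgtP (-h) (y + n%:~R * (2*h)); [|lra|]; last first.
      have := ls0 _ _ kn; rewrite -ye' opprK => /rowP[i ei].
      by exists (-i), (-1 - 2*n); rewrite intrB intrM !mulrNz; split; lra.
    case: (off_line ck ok kn) => [y3|[i [ei ej]]]; last first.
      by exists i, (-2*n); rewrite intrM mulrNz; split; lra.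
    exfalso; have [p|p|p] := ltrgtP 0 (y + n%:~R * (2*h)).
    + by have := low _ _ kn p; lra.
    + by have := low _ _ (ls0 _ _ kn); rewrite oppr_gt0 => /(_ p); lra.
    by rewrite -p expr0n /= in y3; lra.
  by lra.
have [n [->|->]] : exists n : int, j = 2*n \/ j = 2*n+1 by exists (j %/ 2)%Z; lia.
  by apply: (conv2 (line_translate n ls lsM (ok i))); rewrite intrM; ring.
by apply: (conv2 (line_translate n ls lsM (row i))); rewrite intrD intrM; ring.
Qed.

End LineClass.

Section LineHalf.
Variable R : realType.
Implicit Types (K : R -> R -> Prop) (x y a b p q s h : R).

(** The sign [e] allows a mirror image and [n] is an integer close to [s], so that the offset [s']
    of the sparse row falls into the range [[0, 1/2]] required by [half_row]. *)
Lemma half_row_next K s h s' (e n : int) : conf K -> on_line K -> line_sym K -> 0 < h ->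
  (forall x y, K x y -> 0 < y -> h <= y) -> K s h -> ~ K (s+1) h ->
  e = 1 \/ e = -1 -> 0 <= s' <= 1/2 -> s = n%:~R + e%:~R * s' ->
  (forall i : int, K (2 * s + i%:~R) (2 * h)) /\ (forall x y, K x y -> h < y -> 2 * h <= y).
Proof.
move=> ck ok ls h0 low ks nks he s's es; have ls0 a b : K a b -> K (-a) (-b) by move/ls/(_ 0); rewrite mulr0 sub0r.
have per a b (i : int) : K a b -> K (a + 2*i%:~R) b.
  by move=> /ls0/ls/(_ i) ka; apply: (conv2 ka); ring.
have ee : e%:~R * e%:~R = 1 :> R by case: he => ->; rewrite ?mulrNz; ring.
have ek z : e%:~R * (e%:~R * z) = z :> R by rewrite mulrA ee mul1r.
pose N x y := K (s + e%:~R * x) (h + y).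
have cN : conf N.
  case: he => he.
    by have -> : N = move K s h 1 0; [apply/funext => x; apply/funext => y; rewrite shiftE /N he mul1r|apply: conf_move => //; ring].
  have -> : N = mir (move K s h 1 0).
    by apply/funext => x; apply/funext => y; rewrite /mir shiftE /N he mulrNz mulN1r.
  by apply: conf_mir; apply: conf_move => //; ring.
have H : half_row N s' h.
  split=> //.
  - by move=> x y i k; apply: (conv2 (per _ _ (e * i) k)) => //; rewrite intrM; ring.
  - rewrite /N => x; rewrite addr0 => k; have [i [ei|[_ /nks//]]] := row_half ck ls ks k.
    exists (e * i); rewrite intrM -[x]ek; have -> : e%:~R * x = 2 * i%:~R by lra.
    by ring.
  - by rewrite /N mulr0 !addr0.
  - by move=> j; apply: (conv2 (ok (n + e * j))); rewrite ?subrr // intrD intrM es; ring.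
  - rewrite /N => x; rewrite subrr => k; case: (off_line ck ok k) => [|[i [ei _]]].
      by rewrite expr0n /= => a; exfalso; lra.
    exists (e * (i - n)); rewrite intrM intrB -[x]ek -[s']ek -mulrBr; congr (_ * _); lra.
  - rewrite /N => x y k y0; have [p|p|p] := ltrgtP 0 (h + y); [|right|by left; lra].
      by have := low _ _ k p; lra.
    by have := low _ _ (ls0 _ _ k); rewrite oppr_gt0 => /(_ p); lra.
  - case: (sepP ck (ok n) ks) => [[_ z]|]; first by lra.
    by rewrite es subr0 addrAC subrr add0r exprMn expr2 ee mul1r.
split=> [i|x y k l].
  have := hr_full_above (e * (n + i)) H; rewrite /N => k.
  apply: (conv2 k); last by ring.
  by rewrite mulrDr intrM ek intrD; lra.
have kn : N (e%:~R * (x - s)) (y - h) by apply: (conv2 k); rewrite ?ek; ring.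
by have := hr_empty_above H kn ltac:(lra); lra.
Qed.

(** The row at height [2 * h] is full, so reflections through it and through the base line generate
    the translation by [(4 * s, 4 * h)]. Only the rows with index [-1], [0], [1], [2] remain to be
    identified. *)
Lemma line_half K s h : conf K -> on_line K -> line_sym K -> 0 < h ->
  (forall x y, K x y -> 0 < y -> h <= y) -> K s h -> ~ K (s+1) h -> lat34 K s h.
Proof.
move=> ck ok ls h0 low ks nks; have ls0 a b : K a b -> K (-a) (-b) by move/ls/(_ 0); rewrite mulr0 sub0r.
have per a b (i : int) : K a b -> K (a + 2*i%:~R) b.
  by move=> /ls0/ls/(_ i) ka; apply: (conv2 ka); ring.
have rowP x : K x h -> exists i : int, x = s + 2*i%:~R.
  by move=> k; have [i [->|[_ /nks//]]] := row_half ck ls ks k; exists i.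
have row0 x : K x 0 -> exists i : int, x = i%:~R.
  move=> k; case: (off_line ck ok k) => [|[i [e _]]]; last by exists i.
  by rewrite expr0n /= => a; exfalso; lra.
have gap x y : K x y -> y < h -> y = 0 \/ y <= - h.
  move=> k l; have [y0|y0|] := ltrgtP 0 y; [|by right; have := low _ _ (ls0 _ _ k); rewrite oppr_gt0 => /(_ y0); lra|by left].
  by have := low _ _ k y0; lra.
have [full empty] : (forall i : int, K (2 * s + i%:~R) (2 * h)) /\ (forall x y, K x y -> h < y -> 2 * h <= y).
  have [n /andP[l r]] := floorP (s + 1/2).
  have [sl|sl] := leP n%:~R s.
    by apply: (@half_row_next K s h (s - n%:~R) 1 n) => //; [left|apply/andP; split; lra|ring].
  by apply: (@half_row_next K s h (n%:~R - s) (-1) n) => //; [right|apply/andP; split; lra|rewrite mulrNz; ring].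
have full0 (j i : int) : (exists k : int, i = 2*k) \/ (exists k : int, j = 2*k) -> (j = -1 \/ j = 0 \/ j = 1 \/ j = 2) -> K (i%:~R + j%:~R * s) (j%:~R * h).
  move=> ij [jj|[jj|[jj|jj]]].
  - case: ij => -[k ek]; last by lia.
    by apply: (conv2 (ls0 _ _ (per _ _ (-k) ks))); rewrite jj ?ek ?intrM !mulrNz; ring.
  - by apply: (conv2 (ok i)); rewrite jj; ring.
  - case: ij => -[k ek]; last by lia.
    by apply: (conv2 (per _ _ k ks)); rewrite jj ?ek ?intrM; ring.
  by apply: (conv2 (full i)); rewrite jj; ring.
pose M := move K (2 * s) (2 * h) 1 0.
have ckM : conf M by apply: conf_move => //; ring.
have okM : on_line M by move=> i; rewrite /M shiftE addr0.
have lsM := line_symP ckM okM.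
have h20 : 0 < 2 * h by lra.
move=> x y; split=> [k|].
  have [n /andP[l r]] := reduce_mod y h20.
  have kn := line_translate n ls lsM k.
  suff [i [j [ex ey ij]]] : exists i j : int, [/\ x + n%:~R * (2 * (2 * s)) = i%:~R + j%:~R * s, y + n%:~R * (2 * (2 * h)) = j%:~R * h & (exists k : int, i = 2*k) \/ (exists k : int, j = 2*k)].
    exists i, (j - 4*n); rewrite intrB intrM; split; [lra|lra|].
    by case: ij => [|[j' ->]]; [left|right; exists (j' - 2*n); lia].
  move: (x + _) (y + _) l r kn => {k}x {}y l r k.
  have pos x' y' : K x' y' -> 0 <= y' -> y' <= 2 * h -> exists i j : int, [/\ x' = i%:~R + j%:~R * s, y' = j%:~R * h & (exists k : int, i = 2*k) \/ (exists k : int, j = 2*k)].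
    move=> {l r}k; rewrite le_eqVlt => /orP[/eqP e|p] l.
      by rewrite -e in k *; have [i ->] := row0 _ k; exists i, 0; split; [ring|ring|right; exists 0].
    have hy := low _ _ k p; rewrite le_eqVlt in hy; case/orP: hy => [/eqP e|lt].
      by rewrite -e in k *; have [i ->] := rowP _ k; exists (2*i), 1; rewrite intrM; split; [ring|ring|left; exists i].
    have e : y' = 2 * h by apply/le_anti; rewrite l (empty _ _ k).
    have kM : M (x' - 2 * s) (y' - 2 * h) by rewrite /M shiftE; apply: (conv2 k); ring.
    case: (off_line ckM okM kM) => [|[i [ei _]]]; first by rewrite e subrr expr0n /= => a; exfalso; lra.
    by exists i, 2; rewrite e; split; [lra|ring|right; exists 1].
  have [y0|y0] := leP 0 y; first by apply: pos => //; lra.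
  have [i [j [ex ey ij]]] := pos _ _ (ls0 _ _ k) ltac:(lra) ltac:(lra).
  exists (-i), (-j); rewrite !mulrNz; split; [lra|lra|].
  by case: ij => -[z ez]; [left|right]; exists (-z); lia.
move=> [i [j [-> -> ij]]].
have [n [r [ej hr]]] : exists n r : int, j = r + 4 * n /\ (r = -1 \/ r = 0 \/ r = 1 \/ r = 2).
  by exists (divz (j + 1) 4), (modz (j + 1) 4 - 1); lia.
have ij' : (exists k : int, i = 2*k) \/ (exists k : int, r = 2*k).
  by case: ij => [|[z ez]]; [left|right; exists (z - 2*n); lia].
by apply: (conv2 (line_translate n ls lsM (full0 _ _ ij' hr))); rewrite ej intrD intrM; ring.
Qed.

Theorem line_class K : conf K -> on_line K -> (exists x y, K x y /\ y != 0) ->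
  exists s h, 0 < h /\ (lat K s h \/ lat34 K s h).
Proof.
move=> ck ok ex; have ls := line_symP ck ok; have [s [h [h0 ks low]]] := lowest ck ok ls ex.
exists s, h; split=> //.
by have [ks1|nks] := pselect (K (s+1) h); [left; apply: line_lat|right; apply: line_half].
Qed.

End LineHalf.

(** * A counting argument for rings *)

Section Balance.
Variables (R : realDomainType) (T : eqType).
Implicit Types (p s : seq T) (f : T -> R) (w : seq R).

Lemma class_sum p (c : T -> nat) f w : uniq p -> {in p &, injective c} -> w != [::] -> all (fun a => 0 < a) w ->
  (forall v, v \in p -> (c v < size w)%N /\ f v < w`_(c v)) -> \sum_(v <- p) f v < \sum_(a <- w) a.
Proof.
move=> up ic wn w0 h.
have wpos i : (i < size w)%N -> 0 < w`_i by move=> l; apply: (allP w0); rewrite mem_nth.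
have sub : \sum_(i <- map c p) w`_i <= \sum_(i <- iota 0 (size w)) w`_i.
  rewrite [leRHS](bigID (fun i => i \in map c p)) /= -[leLHS]addr0; apply: lerD.
    rewrite -[leRHS]big_filter le_eqVlt; apply/orP; left; apply/eqP; apply: perm_big.
    apply: uniq_perm; [by rewrite map_inj_in_uniq|by rewrite filter_uniq ?iota_uniq|].
    move=> i; rewrite mem_filter mem_iota add0n /=; case: (boolP (i \in map c p)) => //= /mapP[v vp ->].
    by have [] := h _ vp.
  rewrite big_seq_cond; apply: sumr_ge0 => i; rewrite mem_iota add0n /= => /andP[l _]; exact/ltW/wpos.
have -> : \sum_(a <- w) a = \sum_(i <- iota 0 (size w)) w`_i.
  by rewrite (big_nth 0) /index_iota subn0.
case: p up ic h sub => [|u p] up ic h sub.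
  rewrite big_nil; case: w wn w0 wpos {h sub} => [//|b w] _ _ wpos.
  rewrite /= big_cons; apply: ltr_wpDr; last exact: (wpos 0%N).
  by rewrite big_seq_cond; apply: sumr_ge0 => i; rewrite mem_iota andbT => /andP[_ l]; exact/ltW/wpos.
apply: lt_le_trans sub; rewrite big_map !big_cons; apply: ltr_leD; first by have [] := h u (seq.mem_head _ _).
by rewrite !big_seq; apply: ler_sum => v m; apply: ltW; have [] := h v; rewrite ?inE ?m ?orbT.
Qed.

(** The known points [ks] contribute at most minus the total weight to the sum of [f], while the
    points with positive [f], at most one per class and each strictly below the weight of its class,
    cannot make up for it. *)
Lemma balance_bound s ks (c : T -> nat) f w : uniq s -> uniq ks -> \sum_(v <- s) f v = 0 ->
  (forall v, v \in ks -> v \in s /\ f v <= 0) -> \sum_(v <- ks) f v + \sum_(a <- w) a <= 0 ->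
  w != [::] -> all (fun a => 0 < a) w ->
  (forall v, v \in s -> 0 < f v -> (c v < size w)%N /\ f v < w`_(c v)) ->
  (forall u v, u \in s -> v \in s -> 0 < f u -> 0 < f v -> c u = c v -> u = v) -> False.
Proof.
move=> us uk s0 hk sw wn w0 hc ic.
have : \sum_(v <- s | 0 < f v) f v < \sum_(a <- w) a.
  rewrite -big_filter; apply: (@class_sum _ c); rewrite ?filter_uniq //.
    by move=> u v; rewrite !mem_filter => /andP[u0 us'] /andP[v0 vs]; apply: ic.
  by move=> v; rewrite mem_filter => /andP[v0 vs]; apply: hc.
have : \sum_(v <- s | ~~ (0 < f v)) f v <= \sum_(v <- ks) f v.
  rewrite (bigID (fun v => v \in ks)) /= -[leRHS]addr0; apply: lerD.
    rewrite -big_filter le_eqVlt; apply/orP; left; apply/eqP; apply: perm_big.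
    apply: uniq_perm; [by rewrite filter_uniq|by []|move=> v; rewrite mem_filter].
    case: (boolP (v \in ks)) => [m|]; rewrite ?andbF //=; have [vs v0] := hk _ m.
    by rewrite -leNgt v0 vs.
  by rewrite -oppr_ge0 -sumrN; apply: sumr_ge0 => v /andP[]; rewrite -leNgt oppr_ge0.
by move: s0; rewrite (bigID (fun v => 0 < f v)) /=; clear -sw; lra.
Qed.
End Balance.

(** * Neighbours of a point with triangular unit ring *)

Section Turn.
Variable R : realType.
Notation s3 := (s3 R).
Implicit Types (K : R -> R -> Prop) (x y a b d e t : R).

(** The half turn exchanging the origin with [(d, 0)]: the configuration as seen from [(d, 0)]
    looking back. *)
Definition turn d K x y := K (d - x) (- y).

Lemma turn_conv d K x y x' y' : turn d K x y -> d - x = x' -> -y = y' -> K x' y'.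
Proof. by rewrite /turn => k <- <-. Qed.

Lemma turnE d K : turn d K = move K d 0 (-1) 0.
Proof.
by apply/funext => x; apply/funext => y; rewrite /turn /move; congr K; ring.
Qed.

Lemma conf_turn d K : conf K -> conf (turn d K).
Proof. by rewrite turnE; apply: conf_move; ring. Qed.

Lemma turnK d K : turn d (turn d K) = K.
Proof. by apply/funext => x; apply/funext => y; rewrite /turn opprK; congr K; ring. Qed.

Lemma turn_star d K : conf K -> K (d-1) 0 -> K d 0 -> anti (turn d K) \/ tri (turn d K).
Proof.
move=> ck k1 kd; have ct := conf_turn d ck.
have t0 : turn d K 0 0 by apply: (conv2 kd); ring.
have [a|[c [s [cs tr]]]] := star ct t0; [by left|right].
have t1 : turn d K 1 0 by apply: (conv2 k1); ring.
have := tri_turn cs tr _ t1; rewrite /move => /(_ ltac:(ring)) tr'.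
by move=> x y e; rewrite -tr' //; split=> k; apply: (conv2 k); ring.
Qed.

Definition vflip K x y := K x (-y).

Lemma tri_flip K : tri K -> tri (vflip K).
Proof.
move=> tr x y e; rewrite /vflip; have -> := tr x (-y) ltac:(rewrite sqrrN //).
split=> -[[-> h]|[-> h]|[-> h]].
- by apply: Or31; split=> //; lra.
- by apply: Or33; split=> //; lra.
- by apply: Or32; split=> //; lra.
- by apply: Or31; split=> //; lra.
- by apply: Or33; split=> //; lra.
- by apply: Or32; split=> //; lra.
Qed.

(** A point [(3/2, s3)] or [(3/2, -s3)] would reflect through the symmetric neighbour [(1, 0)] to a
    point of the unit ring of the origin outside the triangle. *)
Lemma anti_nbr K : tri K -> K 0 0 -> anti (turn 1 K) -> [/\ K 2 0, ~ K (3/2) s3 & ~ K (3/2) (-s3)].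
Proof.
move=> tr k0 an; have w2 := s3_sq R; have w0 := s3_gt0 R.
have k2 : K 2 0.
  have k1 : turn 1 K 1 0 by apply: (conv2 k0); ring.
  have e : 1^+2 + 0^+2 = 1 :> R by rewrite expr0n expr1n addr0.
  by apply: (turn_conv (an _ _ e k1)); ring.
have no y : y = s3 \/ y = - s3 -> ~ K (3/2) y.
  move=> hy k; have y2 : y^+2 = 3/4 by case: hy => ->; rewrite ?sqrrN.
  have k1 : turn 1 K (-1/2) (-y) by apply: (conv2 k); [field|rewrite opprK].
  have e : (-1/2)^+2 + (-y)^+2 = 1 by rewrite sqrrN y2; field.
  have e' : (1/2)^+2 + y^+2 = 1 by rewrite y2; field.
  have kk : K (1/2) (-y) by apply: (turn_conv (an _ _ e k1)); [field|rewrite !opprK].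
  have e2 : (1/2)^+2 + (-y)^+2 = 1 by rewrite sqrrN.
  by have [/(_ kk) [[h _]|[h _]|[h _]] _] := tr _ _ e2; lra.
by split=> //; apply: no; [left|right].
Qed.

Lemma tri_nbr K : tri (turn 1 K) -> K (3/2) s3 /\ K (3/2) (-s3).
Proof.
by move=> /tri_pts[_ k2 k3]; split; [apply: (turn_conv k3)|apply: (turn_conv k2)]; field.
Qed.

End Turn.

Section Neighbours.
Variable R : realType.
Notation s3 := (s3 R).
Implicit Types (K : R -> R -> Prop) (x y a b d e t : R).

Lemma near_eq K a b c d : conf K -> K a b -> K c d -> (c-a)^+2 + (d-b)^+2 < 1 -> c = a /\ d = b.
Proof. by move=> ck k k' l; case: (sepP ck k k') => // h; exfalso; lra. Qed.

Lemma turn_far K x y : conf K -> K 2 0 -> ~ K (3/2) s3 -> ~ K (3/2) (-s3) -> K x y -> x^+2+y^+2 = 3 -> x < 3/2.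
Proof.
move=> ck k2 n1 n2 k e; have w2 := s3_sq R.
case: (sepP ck k2 k) => [[e1 e0]|l]; first by exfalso; rewrite e0 e1 in e; lra.
have le : x <= 3/2 by clear -e l; lra.
rewrite lt_neqAle le andbT; apply/eqP => ex.
have : y^+2 = s3^+2 by rewrite w2; rewrite ex in e; clear -e; lra.
by move/eqP; rewrite eqf_sqr => /orP[] /eqP ey; [apply: n1|apply: n2]; rewrite -ex -ey.
Qed.

Lemma ring3_close x y x' y' : x^+2+y^+2 = 3 -> x'^+2+y'^+2 = 3 -> 0 < x < 3/2 -> 0 < x' < 3/2 ->
  43/50 < y < 29/20 -> 43/50 < y' < 29/20 -> (x'-x)^+2 + (y'-y)^+2 < 1.
Proof.
have lb (u v : R) : u^+2+v^+2 = 3 -> 0 < u -> 43/50 < v < 29/20 -> 9/10 < u.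
  move=> e u0 /andP[v0 v1]; rewrite ltNge; apply/negP => h.
  have : u^+2 <= (9/10)^+2 by apply: sqr_le; lra.
  have : v^+2 <= (29/20)^+2 by apply: sqr_le; lra.
  by clear -e; lra.
move=> e e' /andP[x0 x1] /andP[x0' x1'] vy vy'.
have b := lb _ _ e x0 vy; have b' := lb _ _ e' x0' vy'; clear e e' lb.
have : (x'-x)^+2 <= (3/5)^+2 by clear vy vy'; apply: sqr_le; lra.
have : (y'-y)^+2 <= (3/5)^+2 by clear -vy vy'; apply: sqr_le; lra.
by clear; lra.
Qed.

(** In the ring of squared radius 3, the triangular neighbours supply [(-3/2, s3)] and
    [(-3/2, -s3)]. On the right there is at most one point above and one below the axis, each with
    abscissa less than [3/2], so the abscissas cannot balance. *)
Lemma two_tri_one_anti K : conf K -> K 0 0 -> tri K -> anti (turn 1 K) ->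
  tri (turn 1 (rot K)) -> tri (turn 1 (rot (rot K))) -> False.
Proof.
move=> ck k0 tr an t2 t3; have w2 := s3_sq R; have w0 := s3_gt0 R; have [wl wr] := s3_bound R.
have [k2 n1 n2] := anti_nbr tr k0 an.
have [a1 a2] := tri_nbr t2; have [b1 b2] := tri_nbr t3.
rewrite rotE in a1; rewrite rotE in a2; rewrite rot2E in b1; rewrite rot2E in b2.
have {}a1 : K (-3/2) s3 by apply: (conv2 a1); [rewrite -expr2|]; lra.
have {}a2 : K 0 (2 * s3) by apply: (conv2 a2); [rewrite mulrN -expr2|]; lra.
have {}b1 : K 0 (- (2 * s3)) by apply: (conv2 b1); [rewrite -expr2|]; lra.
have {}b2 : K (-3/2) (- s3) by apply: (conv2 b2); [rewrite mulrN -expr2|]; lra.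
have [s us [ms sx sy]] := ring0 3 ck k0.
pose c (v : R * R) := if 0 < v.2 then 0%N else 1%N.
have P x y : (x, y) \in s -> 0 < x -> [/\ K x y, x^+2+y^+2 = 3, x < 3/2 & (0 < y -> 43/50 < y < 29/20) /\ (y <= 0 -> - (29/20) < y < - (43/50))].
  move=> /ms[k e] x0; split=> //; first exact: turn_far ck k2 n1 n2 k e.
  have xl := turn_far ck k2 n1 n2 k e.
  have x2 : x^+2 <= (3/2)^+2 by apply: sqr_le; lra.
  have y2 : 3/4 <= y^+2 by clear -x2 e; lra.
  split=> y0; apply/andP; split.
  - rewrite ltNge; apply/negP => h; have := @sqr_le _ y (43/50) ltac:(lra) h; clear -y2; lra.
  - case: (sepP ck a2 k) => [[z _]|l]; first by exfalso; lra.
    have : 0 < y * (s3 - 19/22) by apply: mulr_gt0; lra.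
    by clear -l e w2; lra.
  - case: (sepP ck b1 k) => [[z _]|l]; first by exfalso; lra.
    have : 0 <= -y * (s3 - 19/22) by apply: mulr_ge0; lra.
    by clear -l e w2; lra.
  by rewrite ltNge; apply/negP => h; have := @sqr_le _ (-y) (43/50) ltac:(lra) ltac:(lra); rewrite sqrrN; clear -y2; lra.
apply: (@balance_bound _ _ s [:: (-3/2, s3); (-3/2, -s3)] c (fun v => v.1) [:: 3/2; 3/2]) => //.
- by rewrite /= inE xpair_eqE eqxx /= -subr_eq0 opprK; lra.
- move=> v; rewrite !inE => /orP[] /eqP -> /=; split; rewrite ?ms; try lra; split=> //; lra.
- rewrite !big_cons !big_nil /=; lra.
- by rewrite /= !divr_gt0.
- move=> [x y] m /= x0; have [_ _ l _] := P _ _ m x0; rewrite /c /=; by case: ifP => _; split.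
move=> [x y] [x' y'] m m' /= x0 x0'; rewrite /c /= => cc.
have [k e l [p1 p2]] := P _ _ m x0; have [k' e' l' [p1' p2']] := P _ _ m' x0'.
suff : (x'-x)^+2 + (y'-y)^+2 < 1 by move=> /(near_eq ck k k')[-> ->].
have bx : 0 < x < 3/2 by rewrite x0.
have bx' : 0 < x' < 3/2 by rewrite x0'.
have w (u : R) : - (29/20) < u < - (43/50) -> 43/50 < - u < 29/20 by clear; lra.
move: cc; case: (ltP 0 y) => y0; case: (ltP 0 y') => y0' // _.
  exact: ring3_close e e' bx bx' (p1 y0) (p1' y0').
have := ring3_close _ _ bx bx' (w _ (p2 y0)) (w _ (p2' y0')).
by rewrite !sqrrN => /(_ e e'); clear; lra.
Qed.

Lemma reflect_dist (x y w : R) : x^+2+y^+2 = 3 -> x < -3/2 -> w^+2 = 3/4 -> 19/22 < w -> w < 13/15 ->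
  12/25 <= y -> 4 + x - 2*w*y <= 9/5 /\ 10 + 5*x - 2*w*y < 1.
Proof.
move=> e xl w2 wl wr yl.
have yw : y < w.
  apply: lt_of_sqr; first by lra.
  by have : 0 < (-x - 3/2) * (-x + 3/2) by [apply: mulr_gt0; lra]; clear -e w2; lra.
split.
  by have : 0 <= (w - 19/22) * (y - 12/25) by [apply: mulr_ge0; lra]; lra.
suff : (9 - 2*w*y) < - (5*x) by lra.
apply: lt_of_sqr; first by lra.
have : 0 < (w - y) * (y - 2/7*w) by apply: mulr_gt0; lra.
have ey : (w*y)^+2 = 3/4*y^+2 by rewrite exprMn w2.
by clear -ey e w2; lra.
Qed.

(** The origin, its neighbour at angle [2 pi / 3] and the point behind it are collinear, so
    [ball_sym] reflects [(x, y)] through that neighbour; the image is too close to [(3/2, s3)]. *)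
Lemma wedge_reflect K x y : conf K -> K 0 0 -> K (3/2) s3 -> rot K 1 0 -> rot K 2 0 ->
  K x y -> x^+2+y^+2 = 3 -> x < -3/2 -> 12/25 <= y -> False.
Proof.
move=> ck k0 k1 kr k2 k e xl yl; have w2 := s3_sq R; have w0 := s3_gt0 R; have [wl wr] := s3_bound R.
have [d1 d2] := reflect_dist e xl w2 wl wr yl.
pose M := turn 1 (rot K).
have cM : conf M by apply/conf_turn/conf_rot.
have M1 : M 1 0 by rewrite /M /turn rotE; apply: (conv2 k0); ring.
have M2 : M (-1) 0 by rewrite /M /turn; apply: (conv2 k2); ring.
have M0 : M 0 0 by rewrite /M /turn; apply: (conv2 kr); ring.
have sx : s3*(s3*x) = 3/4*x by rewrite mulrA -expr2 w2.
have sy : s3*(s3*y) = 3/4*y by rewrite mulrA -expr2 w2.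
have sx2 : s3^+2*x^+2 = 3/4*x^+2 by rewrite w2.
have sy2 : s3^+2*y^+2 = 3/4*y^+2 by rewrite w2.
have kM : M (1 + x/2 - s3 * y) (s3 * x + y/2).
  by rewrite /M /turn rotE; apply: (conv2 k); clear -sx sy; lra.
have n : (1 + x/2 - s3 * y)^+2 + (s3 * x + y/2)^+2 <= 9/5.
  by clear -d1 e sx2 sy2; lra.
have := ball_sym cM M0 M1 M2 n kM; rewrite /M /turn rotE => k'.
have k'' : K (-1-x) (2*s3-y) by apply: (conv2 k'); clear -sx sy w2; lra.
have l : (-1-x-3/2)^+2 + (2*s3-y-s3)^+2 < 1 by clear -d2 e w2; lra.
have [ex _] := near_eq ck k1 k'' l.
have xe : x = -5/2 by lra.
by rewrite xe in e; have := sqr_ge0 y; lra.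
Qed.

Lemma rot_vflip K x y : rot (vflip K) x y = rot (rot K) x (-y).
Proof. by rewrite rot2E rotE /vflip; congr K; ring. Qed.

(** The mirror image of the previous balance: [(3/2, s3)] and [(3/2, -s3)] are present, and on the
    left, where [x < -3/2] and [|y| < 12/25] by [wedge_reflect], there is room for one point only.
    The weight [7/4] exceeds the radius [sqrt 3]. *)
Lemma one_tri_two_anti K : conf K -> K 0 0 -> tri K -> tri (turn 1 K) ->
  anti (turn 1 (rot K)) -> anti (turn 1 (rot (rot K))) -> False.
Proof.
move=> ck k0 tr t1 a2 a3; have w2 := s3_sq R; have w0 := s3_gt0 R; have [wl wr] := s3_bound R.
have [k1 k1'] := tri_nbr t1.
have rk0 : rot K 0 0 by rewrite rotE; apply: (conv2 k0); ring.
have rrk0 : rot (rot K) 0 0 by rewrite rot2E; apply: (conv2 k0); ring.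
have [k2 n1 n2] := anti_nbr (tri_rot tr) rk0 a2.
have [k3 n3 n4] := anti_nbr (tri_rot (tri_rot tr)) rrk0 a3.
have fl x y : K x y -> x^+2+y^+2 = 3 -> x < -3/2 -> -(12/25) < y < 12/25.
  move=> k e l; rewrite ltNge [y < _]ltNge; apply/andP; split; apply/negP => h.
    apply: (@wedge_reflect (vflip K) x (-y)) => //; rewrite /vflip ?oppr0 ?opprK ?sqrrN //; [exact: conf_flip| | |lra].
    - by rewrite rot_vflip oppr0; have [] := tri_pts (tri_rot (tri_rot tr)).
    - by rewrite rot_vflip oppr0.
  by apply: (@wedge_reflect K x y) => //; have [] := tri_pts (tri_rot tr).
have {}n1 : ~ K (-3/2) s3 by move=> h; apply: n1; rewrite rotE; apply: (conv2 h); [rewrite -expr2|]; lra.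
have {}n4 : ~ K (-3/2) (-s3) by move=> h; apply: n4; rewrite rot2E; apply: (conv2 h); [rewrite mulrN -expr2|]; lra.
rewrite rotE in k2; rewrite rot2E in k3.
have [s us [ms sx sy]] := ring0 3 ck k0.
have low x y : K x y -> x^+2+y^+2 = 3 -> x < 0 -> x < -3/2.
  move=> k e x0; rewrite ltNge; apply/negP => xl.
  have bd : - (3+x) <= 2 * s3 * y <= 3 + x.
    apply/andP; split.
      case: (sepP ck k3 k) => [[z1 z]|l].
        by exfalso; rewrite z1 z in e; clear -e w2; lra.
      by clear -l e w2; lra.
    case: (sepP ck k2 k) => [[z1 z]|l].
      by exfalso; rewrite z1 z in e; clear -e w2; lra.
    by clear -l e w2; lra.
  have : (2*s3*y)^+2 <= (3+x)^+2 by case/andP: bd => *; apply: sqr_le; lra.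
  have -> : (2*s3*y)^+2 = 4 * s3^+2 * y^+2 by ring.
  rewrite w2 => h.
  have : 0 <= x * (2*x+3) by clear -h e; lra.
  rewrite nmulr_rge0 // => x1; have ex : x = -3/2 by lra.
  have : y^+2 = s3^+2 by rewrite w2; rewrite ex in e; clear -e; lra.
  by move/eqP; rewrite eqf_sqr => /orP[] /eqP ey; [apply: n1|apply: n4]; rewrite -ex -ey.
apply: (@balance_bound _ _ s [:: (3/2, s3); (3/2, -s3)] (fun=> 0%N) (fun v => - v.1) [:: 7/4]) => //.
- by rewrite /= inE xpair_eqE eqxx /= -subr_eq0 opprK; lra.
- by rewrite sumrN sx oppr0.
- by move=> v; rewrite !inE => /orP[] /eqP -> /=; (split; [apply/ms; split=> //; rewrite ?sqrrN w2; field|lra]).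
- by rewrite !big_cons !big_nil /=; lra.
- by rewrite /= !divr_gt0.
- move=> [x y] /ms[k e] /= x0; split=> //; rewrite ltNge; apply/negP => h.
  by have := @sqr_le _ (7/4) (-x) ltac:(lra) h; have := sqr_ge0 y; rewrite sqrrN; clear -e; lra.
move=> [x y] [x' y'] /ms[k e] /ms[k' e'] /= x0 x0' _.
have l := low _ _ k e ltac:(lra); have l' := low _ _ k' e' ltac:(lra).
have /andP[b1 b2] := fl _ _ k e l; have /andP[b1' b2'] := fl _ _ k' e' l'.
suff : (x'-x)^+2 + (y'-y)^+2 < 1 by move=> /(near_eq ck k k')[-> ->].
have : (y'-y)^+2 <= (24/25)^+2 by apply: sqr_le; lra.
have up (u v : R) : u^+2+v^+2 = 3 -> u < -3/2 -> - (87/50) < u.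
  move=> ee ul; rewrite ltNge; apply/negP => h.
  by have := @sqr_le _ (87/50) (-u) ltac:(lra) ltac:(lra); have := sqr_ge0 v; rewrite sqrrN; clear -ee; lra.
have := up _ _ e l; have := up _ _ e' l' => ? ?.
have : (x'-x)^+2 <= (6/25)^+2 by apply: sqr_le; lra.
by clear; lra.
Qed.

End Neighbours.

Section TwoAnti.
Variable R : realType.
Notation s3 := (s3 R).
Implicit Types (K : R -> R -> Prop) (x y z a b d e t : R).

Lemma range3 x y a b : x^+2+y^+2 = 3 -> 0 <= x -> 0 <= y -> 0 <= b ->
  (x <= a -> b^+2 <= 3 - a^+2 -> b <= y) /\ (a <= x -> 0 <= a -> 3 - a^+2 <= b^+2 -> y <= b).
Proof.
move=> e x0 y0 b0; split=> [xa h|ax a0 h].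
  have : x^+2 <= a^+2 by apply: sqr_le; lra.
  by move=> h'; rewrite -(@ler_pXn2r _ 2) ?nnegrE //; clear -h h' e; lra.
have : a^+2 <= x^+2 by apply: sqr_le; lra.
by move=> h'; rewrite -(@ler_pXn2r _ 2) ?nnegrE //; clear -h h' e; lra.
Qed.

(* The arc of radius [sqrt 3] over [l, u] fits in a box of diagonal less than 1. *)
Definition short_arc l u b d :=
  [/\ 0 <= l, 0 <= b /\ 0 <= d, b^+2 <= 3 - u^+2, 3 - l^+2 <= d^+2 & (u-l)^+2 + (d-b)^+2 < 1].

Lemma arc3_close x y x' y' l u b d : short_arc l u b d -> x^+2+y^+2 = 3 -> x'^+2+y'^+2 = 3 -> l <= x <= u -> l <= x' <= u ->
  0 <= y -> 0 <= y' -> (x'-x)^+2 + (y'-y)^+2 < 1.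
Proof.
move=> [l0 [b0 d0] hb hd h] e e' /andP[lx xu] /andP[lx' xu'] y0 y0'.
have x0 : 0 <= x by lra.
have x0' : 0 <= x' by lra.
have [/(_ xu hb) by1 _] := range3 u e x0 y0 b0; have [_ /(_ lx l0 hd) yd] := range3 l e x0 y0 d0.
have [/(_ xu' hb) by1' _] := range3 u e' x0' y0' b0; have [_ /(_ lx' l0 hd) yd'] := range3 l e' x0' y0' d0.
clear e e' hb hd.
have : (x'-x)^+2 <= (u-l)^+2 by clear -lx xu lx' xu'; apply: sqr_le; lra.
have : (y'-y)^+2 <= (d-b)^+2 by clear -by1 yd by1' yd'; apply: sqr_le; lra.
by clear -h; lra.
Qed.

Lemma row_kill x y x' z : x^+2+y^+2 = 3 -> x'^+2+z^+2 = 3 -> 23/20 <= x <= 13/10 -> 0 < x' <= 13/10 ->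
  0 <= y -> 0 <= z -> (x' - (2 - x))^+2 + (y - z)^+2 < 1.
Proof.
move=> e e' /andP[x0 x1] /andP[x0' x1'] y0 z0.
have xp : 0 <= x by lra. have xp' : 0 <= x' by lra.
have [/(_ x1' ltac:(lra)) zl _] := @range3 x' z (13/10) (57/50) e' xp' z0 ltac:(lra).
have [_ /(_ xp' ltac:(lra) ltac:(lra)) zu] := @range3 x' z 0 (26/15) e' xp' z0 ltac:(lra).
have [_ /(_ x0 ltac:(lra) ltac:(lra)) yu] := @range3 x y (23/20) (13/10) e xp y0 ltac:(lra).
have [xs|xs] := leP x (6/5).
  have [/(_ xs ltac:(lra)) yl _] := @range3 x y (6/5) (31/25) e xp y0 ltac:(lra).
  clear e e'.
  have : (x' - (2-x))^+2 <= (17/20)^+2 by clear -x0 x0' x1 x1' xs; apply: sqr_le; lra.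
  have : (y-z)^+2 <= (1/2)^+2 by clear -yl yu zl zu; apply: sqr_le; lra.
  by clear; lra.
have [/(_ x1 ltac:(lra)) yl _] := @range3 x y (13/10) (57/50) e xp y0 ltac:(lra).
clear e e'.
have : (x' - (2-x))^+2 <= (4/5)^+2 by clear -x0 x0' x1 x1' xs; apply: sqr_le; lra.
have : (y-z)^+2 <= (89/150)^+2 by clear -yl yu zl zu; apply: sqr_le; lra.
by clear; lra.
Qed.

Lemma row_close x y : x^+2+y^+2 = 3 -> 0 < x < 3/2 -> 0 < y -> (x - 1/2)^+2 + (y-s3)^+2 < 1.
Proof.
move=> e /andP[x0 x1] y0; have w2 := s3_sq R; have w0 := s3_gt0 R.
suff : 3 - x < 2 * s3 * y by clear -e w2; lra.
apply: lt_of_sqr; first by apply/ltW; do 2! apply: mulr_gt0 => //.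
have -> : (2*s3*y)^+2 = 4 * s3^+2 * y^+2 by ring.
rewrite w2; have : 0 < x * (3 - 2*x) by apply: mulr_gt0; lra.
by clear -e; lra.
Qed.

Lemma row_reflect K x y (c : R) : conf K -> K (c-1) 0 -> K c 0 -> K (c+1) 0 -> K x y -> (x-c)^+2+y^+2 <= 9/5 ->
  K (2*c-x) (-y).
Proof.
move=> ck k1 k2 k3 k l.
have cM : conf (move K c 0 1 0) by apply: conf_move => //; ring.
have kM : move K c 0 1 0 (x-c) y by rewrite shiftE; apply: (conv2 k); ring.
have := ball_sym cM _ _ _ l kM; rewrite !shiftE => h.
by apply: (conv2 (h _ _ _)); [apply: (conv2 k2)|apply: (conv2 k3)|apply: (conv2 k1)|..]; ring.
Qed.

(* [M] is the configuration seen from the first of the two centrally symmetric vertices. *)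
Lemma two_anti_row_upper M x y : conf M -> M 0 0 -> M 1 0 -> M (-1) 0 -> M 2 0 -> M (-3/2) s3 -> 
  M x y -> x^+2+y^+2 = 3 -> 0 < x < 3/2 -> 0 < y -> x < 13/10 /\
  (23/20 <= x -> forall x' y', M x' y' -> x'^+2+y'^+2 = 3 -> 0 < x' <= 13/10 -> 0 < y').
Proof.
move=> cM m0 m1 m2 m3 g k e /andP[x0 x1] y0.
have xl : x < 13/10.
  rewrite ltNge; apply/negP => xl.
  have k' : M (2-x) (-y).
    by apply: (conv2 (@row_reflect M x y 1 cM _ _ _ k _)); [apply: (conv2 m0)|apply: (conv2 m1)|apply: (conv2 m3)| | |]; (try ring); clear -e xl; lra.
  have k'' : M (x-2) y.
    by apply: (conv2 (@row_reflect M (2-x) (-y) 0 cM _ _ _ k' _)); [apply: (conv2 m2)|apply: (conv2 m0)|apply: (conv2 m1)| | |]; (try ring); clear -e xl; lra.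
  have bx : 0 < x < 3/2 by rewrite x0.
  have h := row_close e bx y0.
  have l : (x - 2 - (-3/2))^+2 + (y - s3)^+2 < 1 by clear -h; lra.
  by have [ex _] := near_eq cM g k'' l; lra.
split=> // xb x' y' kx' e' bx'; rewrite ltNge; apply/negP => y0'.
have k' : M (2-x) (-y).
  by apply: (conv2 (@row_reflect M x y 1 cM _ _ _ k _)); [apply: (conv2 m0)|apply: (conv2 m1)|apply: (conv2 m3)| | |]; (try ring); clear -e xb; lra.
have e'' : x'^+2+(-y')^+2 = 3 by rewrite sqrrN.
have bx : 23/20 <= x <= 13/10 by rewrite xb ltW.
have h := row_kill e e'' bx bx' (ltW y0) ltac:(by rewrite oppr_ge0).
have l : (x'-(2-x))^+2 + (y'- - y)^+2 < 1 by clear -h; lra.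
have [ex ey] := near_eq cM k' kx' l.
by rewrite ex ey in e'; clear -e e' xb; lra.
Qed.

(** Seen from [(1, 0)], the ring of squared radius 3 contains [(-3/2, s3)] and [(-3/2, -s3)], with
    abscissas adding up to [-3]. Reflections along the axis keep the points on the right below
    [x = 13/10] and, once [x >= 23/20] occurs, on one side of the axis. Cut into short arcs, the
    right part cannot reach 3. *)
Lemma two_anti_row K : conf K -> K 0 0 -> tri K -> anti (turn 1 K) -> anti (turn 2 K) -> False.
Proof.
move=> ck k0 tr a1 a2; have w2 := s3_sq R; have w0 := s3_gt0 R.
have r1 : short_arc 0 (19/20) (36/25) (26/15) by clear; split; lra.
have r2 : short_arc (19/20) (13/10) (57/50) (3/2) by clear; split; lra.
have r3 : short_arc 0 (7/20) (8/5) (26/15) by clear; split; lra.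
have r4 : short_arc (7/20) (23/20) (5/4) (17/10) by clear; split; lra.
have [k2 n1 n2] := anti_nbr tr k0 a1; have [k1 g1 g2] := tri_pts tr.
have k3 : K 3 0.
  have t1 : turn 2 K 1 0 by apply: (conv2 k1); ring.
  have e : 1^+2 + 0^+2 = 1 :> R by rewrite expr0n expr1n addr0.
  by apply: (turn_conv (a2 _ _ e t1)); ring.
have nn y : y^+2 = 3/4 -> ~ K (5/2) y.
  move=> e h; have t1 : turn 2 K (-1/2) (-y) by apply: (conv2 h); [field|rewrite opprK].
  have e' : (-1/2)^+2 + (-y)^+2 = 1 by rewrite sqrrN e; field.
  have h' : K (3/2) (-y) by apply: (turn_conv (a2 _ _ e' t1)); [field|rewrite !opprK].
  have /eqP : (-y)^+2 = s3^+2 by rewrite sqrrN e w2.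
  by rewrite eqf_sqr => /orP[] /eqP ey; rewrite ey in h'; [apply: n1|apply: n2].
pose M := move K 1 0 1 0.
have cM : conf M by apply: conf_move => //; ring.
have ME x y : M x y = K (1+x) y by rewrite /M shiftE add0r.
have m0 : M 0 0 by rewrite ME addr0.
have m1 : M 1 0 by rewrite ME; apply: (conv2 k2); ring.
have m1' : M (-1) 0 by rewrite ME; apply: (conv2 k0); ring.
have m2 : M 2 0 by rewrite ME; apply: (conv2 k3); ring.
have mg : M (-3/2) s3 by rewrite ME; apply: (conv2 g1); field.
have mg' : M (-3/2) (-s3) by rewrite ME; apply: (conv2 g2); field.
have far x y : M x y -> x^+2+y^+2 = 3 -> x < 3/2.
  by apply: turn_far => // h; [apply: (@nn s3)|apply: (@nn (-s3))]; rewrite ?sqrrN //; rewrite ME in h; apply: (conv2 h); field.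
have y0 x y : x^+2+y^+2 = 3 -> x < 3/2 -> 0 < x -> y != 0.
  move=> e xl xp; apply/eqP => y0; rewrite y0 in e.
  by have := @sqr_le _ x (3/2) ltac:(lra) ltac:(lra); clear -e; lra.
pose N := vflip M.
have cN : conf N by apply: conf_flip.
have up x y : M x y -> x^+2+y^+2 = 3 -> 0 < x -> 0 < y -> x < 13/10 /\
  (23/20 <= x -> forall x' y', M x' y' -> x'^+2+y'^+2 = 3 -> 0 < x' <= 13/10 -> 0 < y').
  by move=> k e x0; apply: two_anti_row_upper => //; rewrite x0 (far x y).
have down x y : M x y -> x^+2+y^+2 = 3 -> 0 < x -> y < 0 -> x < 13/10 /\
  (23/20 <= x -> forall x' y', M x' y' -> x'^+2+y'^+2 = 3 -> 0 < x' <= 13/10 -> y' < 0).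
  move=> k e x0 yn; have kN : N x (-y) by rewrite /N /vflip opprK.
  have := @two_anti_row_upper N x (-y) cN; rewrite {1 2 3 4 5}/N /vflip oppr0 sqrrN oppr_gt0.
  case=> // [|xl h]; first by rewrite x0 (far x y).
  split=> // xb x' y' k' e' b'; rewrite -oppr_gt0; apply: (h xb x' (-y')); rewrite ?sqrrN //.
  by rewrite /N /vflip opprK.
have [s us [ms sx sy]] := ring0 3 cM m0.
pose g : seq (R * R) := [:: (-3/2, s3); (-3/2, -s3)].
have ug : uniq g by rewrite /= inE xpair_eqE eqxx /= -subr_eq0 opprK; lra.
have hg v : v \in g -> v \in s /\ v.1 <= 0.
  by rewrite !inE => /orP[] /eqP -> /=; (split; [apply/ms; split=> //; rewrite ?sqrrN w2; field|lra]).
have sg : \sum_(v <- g) v.1 = - 3 by rewrite !big_cons big_nil /=; lra.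
have side x y : M x y -> x^+2+y^+2 = 3 -> 0 < x -> x < 13/10.
  by move=> k e x0; have := y0 x y e (far _ _ k e) x0; case: (ltrgt0P y) => // yy _; [case: (up x y)|case: (down x y)].
have close l u b d x y x' y' : M x y -> x^+2+y^+2 = 3 -> M x' y' -> x'^+2+y'^+2 = 3 -> 0 < x -> 0 < x' -> short_arc l u b d -> l <= x <= u -> l <= x' <= u ->
    (0 < y) = (0 < y') -> (x, y) = (x', y').
  move=> k e k' e' xp xp' sa hx hx' yy.
  suff : (x'-x)^+2 + (y'-y)^+2 < 1 by move=> /(near_eq cM k k')[-> ->].
  have [p|p] := ltP 0 y; rewrite ?p in yy.
    exact: arc3_close sa e e' hx hx' (ltW p) (ltW (esym yy)).
  have q : y < 0 by rewrite lt_neqAle p (y0 _ _ e (far _ _ k e) xp).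
  have q' : y' < 0.
    by rewrite lt_neqAle (y0 _ _ e' (far _ _ k' e') xp') leNgt -yy ltNge p.
  have en : x^+2+(-y)^+2 = 3 by rewrite sqrrN.
  have en' : x'^+2+(-y')^+2 = 3 by rewrite sqrrN.
  have := arc3_close sa en en' hx hx'; rewrite !oppr_ge0 => /(_ (ltW q) (ltW q')).
  by clear; lra.
pose c (T : R) (v : R * R) := ((if (v.1 < T)%R then 0 else 1) + (if (0 < v.2)%R then 0 else 2))%N.
(* With a point at [x >= 23/20] two arcs on one side remain, of total weight [13/5]. Without one,
   two arcs on each side have total weight exactly 3, and the individual bounds are strict. *)
have [[x [y [k e xb]]]|nb] := pselect (exists x y, [/\ M x y, x^+2+y^+2 = 3 & 23/20 <= x]).
  have xp : 0 < x by lra.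
  have yn := y0 _ _ e (far _ _ k e) xp.
  have [q iq] : exists q : bool, forall x' y', M x' y' -> x'^+2+y'^+2 = 3 -> 0 < x' <= 13/10 -> (0 < y') = q.
    have [yp|yp] := ltP 0 y.
      by exists true => x' y' k' e' b'; have [_ h] := up _ _ k e xp yp; rewrite (h xb x' y').
    have yq : y < 0 by rewrite lt_neqAle yn.
    exists false => x' y' k' e' b'; have [_ h] := down _ _ k e xp yq; apply/negP => y1.
    by have := h xb x' y' k' e' b'; lra.
  apply: (@balance_bound _ _ s g (fun v => if v.1 < 19/20 then 0%N else 1%N) (fun v => v.1) [:: 13/10; 13/10] us ug sx hg).
  - by rewrite sg !big_cons big_nil; lra.
  - by [].
  - by rewrite /= !divr_gt0.
  - by move=> [a b] /ms[k' e'] /= a0; have sa := side _ _ k' e' a0; case: (ltP a) => _; split.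
  move=> [a b] [a' b'] /ms[ka ea] /ms[ka' ea'] /= a0 a0' cc.
  have sa := side _ _ ka ea a0; have sa' := side _ _ ka' ea' a0'.
  have bb : (0 < b) = (0 < b') by rewrite (iq a b) ?a0 ?ltW // (iq a' b') ?a0' ?ltW.
  have hx : (a < 19/20) = (a' < 19/20) by move: cc; case: (ltP a); case: (ltP a').
  have [xl|xl] := ltP a (19/20); rewrite ?xl in hx.
    by apply: (close _ _ _ _ _ _ _ _ ka ea ka' ea' a0 a0' r1) => //; apply/andP; split; apply: ltW.
  have xl' : 19/20 <= a' by rewrite leNgt -hx -leNgt.
  by apply: (close _ _ _ _ _ _ _ _ ka ea ka' ea' a0 a0' r2) => //; apply/andP; split=> //; apply: ltW.
have sb x y : M x y -> x^+2+y^+2 = 3 -> x < 23/20.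
  by move=> k e; rewrite ltNge; apply/negP => h; apply: nb; exists x, y.
apply: (@balance_bound _ _ s g (c (7/20)) (fun v => v.1) [:: 7/20; 23/20; 7/20; 23/20] us ug sx hg).
- by rewrite sg !big_cons big_nil; lra.
- by [].
- by rewrite /= !divr_gt0.
- move=> [x y] /ms[k e] /= x0; rewrite /c /=; have xb := sb _ _ k e.
  by case: (ltP x) => xl; case: (ltP 0) => yl; split.
move=> [x y] [x' y'] /ms[k e] /ms[k' e'] /= x0 x0' cc.
have := sb _ _ k e; have := sb _ _ k' e' => xb' xb.
have [hx yy] : (x < 7/20) = (x' < 7/20) /\ (0 < y) = (0 < y').
  by move: cc; rewrite /c /=; case: (x < _); case: (x' < _); case: (0 < y); case: (0 < y').
have [xl|xl] := ltP x (7/20); rewrite ?xl in hx.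
  by apply: (close _ _ _ _ _ _ _ _ k e k' e' x0 x0' r3) => //; apply/andP; split; apply: ltW.
have xl' : 7/20 <= x' by rewrite leNgt -hx -leNgt.
by apply: (close _ _ _ _ _ _ _ _ k e k' e' x0 x0' r4) => //; apply/andP; split=> //; apply: ltW.
Qed.

End TwoAnti.

(** * The symmetries of the honeycomb and its vertex set *)

Section Reduce.
Variable R : realType.
Notation s3 := (s3 R).
Implicit Types (x y a b e : R).

Lemma int_shift (G : R -> R -> Prop) a b x y (n : int) :
  (forall x y, G x y -> G (x+a) (y+b)) -> (forall x y, G x y -> G (x-a) (y-b)) -> 
  G x y -> G (x + n%:~R*a) (y + n%:~R*b).
Proof.
move=> p m g; move: n; apply: (@int_step _ 0) => [|n h|n h].
- by apply: (conv2 g); ring.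
- by apply: (conv2 (p _ _ h)); rewrite intrD; ring.
by apply: (conv2 (m _ _ h)); rewrite intrB; ring.
Qed.

Variables (e : R) (G : R -> R -> Prop).
Hypothesis e0 : 0 < e.
Hypothesis Grot : forall x y, G x y -> G (-x/2 - s3*y) (s3*x - y/2).
Hypothesis Gturn : forall x y, G x y -> G (2*e - x) (-y).
Hypothesis Gflip : forall x y, G x y -> G x (-y).
Hypothesis Gtri : forall x y, 0 <= y -> y <= 2*s3*x -> x <= e -> G x y.

Let w2 := s3_sq R.
Let w0 := s3_gt0 R.
Let ww z : s3 * (s3 * z) = 3/4*z. Proof. by rewrite mulrA -expr2 w2. Qed.

Let Grot2 x y : G x y -> G (-x/2 + s3*y) (-s3*x - y/2).
Proof. by move=> /Grot/Grot g; apply: (conv2 g); have := ww x; have := ww y; lra. Qed.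

Let Gturn3 x y : G x y -> G (-e - x) (-2*s3*e - y).
Proof.
by move=> /Grot/Gturn/Grot2 g; apply: (conv2 g); have := ww x; have := ww y; lra.
Qed.

Let Gturn2 x y : G x y -> G (-e - x) (2*s3*e - y).
Proof. by move=> /Gflip/Gturn3/Gflip g; apply: (conv2 g); ring. Qed.

Let wedge x y : -x/2 + s3*y <= x -> -x/2 - s3*y <= x -> x <= e -> G x y.
Proof.
move=> h1 h2 xe.
have b1 : 0 <= s3 * (3/2*x - s3*y) by apply: mulr_ge0 (ltW w0) _; lra.
have b2 : 0 <= s3 * (3/2*x + s3*y) by apply: mulr_ge0 (ltW w0) _; lra.
have wy := ww y.
have [y0|y0] := leP 0 y; first by apply: Gtri => //; lra.
by rewrite -[y]opprK; apply: Gflip; apply: Gtri; lra.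
Qed.

Let dual x y : x <= e -> -x/2 + s3*y <= e -> -x/2 - s3*y <= e -> G x y.
Proof.
move=> h1 h2 h3; have wx := ww x; have wy := ww y.
have [a|a] := leP (-x/2 + s3*y) x; have [b|b] := leP (-x/2 - s3*y) x; first exact: wedge.
- have := @wedge (-x/2 - s3*y) (s3*x - y/2) ltac:(lra) ltac:(lra) h3.
  by move=> /Grot2 g; apply: (conv2 g); lra.
- have := @wedge (-x/2 + s3*y) (-s3*x - y/2) ltac:(lra) ltac:(lra) h2.
  by move=> /Grot g; apply: (conv2 g); lra.
have [c|c] := leP (-x/2 - s3*y) (-x/2 + s3*y).
- have := @wedge (-x/2 + s3*y) (-s3*x - y/2) ltac:(lra) ltac:(lra) h2.
  by move=> /Grot g; apply: (conv2 g); lra.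
have := @wedge (-x/2 - s3*y) (s3*x - y/2) ltac:(lra) ltac:(lra) h3.
by move=> /Grot2 g; apply: (conv2 g); lra.
Qed.

(** The triangle with corners a vertex, an edge midpoint and a face center is a fundamental domain
    of the symmetry group. Its mirror image and rotations fill the dual triangle around the vertex,
    two dual triangles form a cell, and products of half turns are the translations that move any
    point into that cell. *)
Lemma tri_reduce x y : G x y.
Proof.
have cell u v : -2*e <= u <= e -> -2*e <= -u/2 + s3*v <= e -> G u v.
  move=> /andP[u1 u2] /andP[v1 v2].
  have [h|h] := leP (-u/2 - s3*v) e; first exact: dual.
  have g : G (-e-u) (-2*s3*e-v) by apply: dual; have := ww e; lra.
  by apply: (conv2 (Gturn3 g)); ring.
have t1 u v : G u v -> G (u + 0) (v + 4*s3*e).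
  by move=> /Gturn3/Gturn2 g; apply: (conv2 g); ring.
have t1' u v : G u v -> G (u - 0) (v - 4*s3*e).
  by move=> /Gturn2/Gturn3 g; apply: (conv2 g); ring.
have t2 u v : G u v -> G (u + 3*e) (v + 2*s3*e).
  by move=> /Gturn3/Gturn g; apply: (conv2 g); ring.
have t2' u v : G u v -> G (u - 3*e) (v - 2*s3*e).
  by move=> /Gturn/Gturn3 g; apply: (conv2 g); ring.
have q0 : 0 < 3/2*e by apply: mulr_gt0 => //; lra.
have [n /andP[n1 n2]] := reduce_mod (x + e/2) q0.
have [m /andP[m1 m2]] := reduce_mod (-x/2 + s3*y + e/2) q0.
have g : G (x + n%:~R*(3*e) + m%:~R*0) (y + n%:~R*(2*s3*e) + m%:~R*(4*s3*e)).
  have wn := ww (n%:~R * e); have wm := ww (m%:~R * e).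
  by apply: cell; apply/andP; split; lra.
have := int_shift (-n) t2 t2' (int_shift (-m) t1 t1' g).
by rewrite !mulrNz => h; apply: (conv2 h); ring.
Qed.
End Reduce.

Section Hex.
Variable R : realType.
Notation s3 := (s3 R).
Implicit Types (K : R -> R -> Prop) (x y a b e : R) (p q : int).

(** In [hex1] the unit edges join two honeycomb vertices; in [hex2] they join a vertex to an edge
    midpoint and the next vertex is at distance 2. *)
Definition hex1 K := [/\ conf K, K 0 0, tri K & tri (turn 1 K)].
Definition hex2 K := [/\ conf K, K 0 0, tri K, anti (turn 1 K) & tri (turn 2 K)].

Lemma tri_anti K : tri K -> anti K -> False.
Proof.
move=> tr an; have [k _ _] := tri_pts tr.
have e : 1^+2 + 0^+2 = 1 :> R by rewrite expr0n expr1n addr0.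
have e' : (-1)^+2 + (-0)^+2 = 1 :> R by rewrite !sqrrN.
by have [/(_ (an _ _ e k))[[h _]|[h _]|[h _]] _] := tr _ _ e'; lra.
Qed.

Lemma turn_star1 K : conf K -> K 0 0 -> tri K -> anti (turn 1 K) \/ tri (turn 1 K).
Proof.
by move=> ck k0 /tri_pts[k1 _ _]; apply: turn_star => //; apply: (conv2 k0) => //; ring.
Qed.

Lemma hex_cases K : conf K -> K 0 0 -> tri K -> hex1 K \/ hex2 K.
Proof.
move=> ck k0 tr; have [k1 _ _] := tri_pts tr.
have [a1|t1] := turn_star1 ck k0 tr; last by left.
right; split=> //; have [k2 _ _] := anti_nbr tr k0 a1.
have k1' : K (2 - 1) 0 by apply: (conv2 k1) => //; ring.
have [a2|//] := turn_star ck k1' k2.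
by case: (two_anti_row ck k0 tr a1 a2).
Qed.

Lemma rot3 K : rot (rot (rot K)) = K.
Proof. by apply/funext => x; apply/funext => y; rewrite rot3E. Qed.

Lemma rot0 K : K 0 0 -> rot K 0 0.
Proof. by move=> k; rewrite rotE; apply: (conv2 k); ring. Qed.

(** The three neighbours of a triangular point are all of the same kind, since [one_tri_two_anti]
    and [two_tri_one_anti] exclude the mixed patterns. *)
Lemma hex1_rot K : hex1 K -> hex1 (rot K).
Proof.
move=> [ck k0 tr t1]; have c1 := conf_rot ck; have c2 := conf_rot c1.
have r1 := tri_rot tr; have r2 := tri_rot r1; have z1 := rot0 k0; have z2 := rot0 z1.
split=> //; have [a2|//] := turn_star1 c1 z1 r1.
have [a3|t3] := turn_star1 c2 z2 r2; first by case: (one_tri_two_anti ck k0 tr t1 a2 a3).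
by case: (two_tri_one_anti c1 z1 r1 a2 t3); rewrite rot3.
Qed.

Lemma hex12 K : hex1 K -> hex2 K -> False.
Proof. by move=> [_ _ _ t] [_ _ _ a _]; apply: tri_anti t a. Qed.

Lemma hex2_rot K : hex2 K -> hex2 (rot K).
Proof.
move=> h; have [ck k0 tr _ _] := h.
have [h1|//] := hex_cases (conf_rot ck) (rot0 k0) (tri_rot tr).
by move/hex1_rot/hex1_rot: h1; rewrite rot3 => h1; case: (hex12 h1 h).
Qed.

Lemma hex1_turn K : hex1 K -> hex1 (turn 1 K).
Proof.
move=> [ck k0 tr t1]; split; rewrite ?turnK //; first exact: conf_turn.
by have [k1 _ _] := tri_pts tr; rewrite /turn; apply: (conv2 k1); ring.
Qed.

Lemma hex2_turn K : hex2 K -> hex2 (turn 2 K).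
Proof.
move=> [ck k0 tr a1 t2]; have [k2 _ _] := anti_nbr tr k0 a1.
split; rewrite ?turnK //; first exact: conf_turn.
  by rewrite /turn; apply: (conv2 k2); ring.
move=> x y e k; have e' : (-x)^+2+(-y)^+2 = 1 by rewrite !sqrrN.
have k' : turn 1 K (-x) (-y) by move: k; rewrite /turn => k; apply: (conv2 k); ring.
have := a1 _ _ e' k'; rewrite !opprK => k''.
by rewrite /turn; apply: (turn_conv k''); ring.
Qed.

Lemma turn_vflip d K : turn d (vflip K) = vflip (turn d K).
Proof. by []. Qed.

Lemma anti_vflip K : anti K -> anti (vflip K).
Proof. by move=> an x y e; rewrite /vflip; apply: an; rewrite sqrrN. Qed.

Lemma vflip0 K : K 0 0 -> vflip K 0 0.
Proof. by rewrite /vflip oppr0. Qed.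

Lemma hex1_flip K : hex1 K -> hex1 (vflip K).
Proof.
move=> [ck k0 tr t1]; split; rewrite ?turn_vflip; [exact: conf_flip|exact: vflip0|exact: tri_flip..].
Qed.

Lemma hex2_flip K : hex2 K -> hex2 (vflip K).
Proof.
move=> [ck k0 tr a1 t2]; split; rewrite ?turn_vflip; [exact: conf_flip|exact: vflip0|exact: tri_flip|exact: anti_vflip|exact: tri_flip].
Qed.

(* Coordinates with respect to [e] and its rotation by [pi / 3]. *)
Definition eis e (Q : int -> int -> Prop) x y :=
  exists p q, [/\ x = e * (p%:~R + q%:~R/2), y = e * (s3 * q%:~R) & Q p q].

(** The generators used in [tri_reduce], in the coordinates of [eis]: the rotation by [2 pi / 3],
    the half turn about [(e, 0)] and the reflection in the axis. *)
Definition hex_inv (Q : int -> int -> Prop) :=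
  [/\ forall p q, Q p q -> Q (-p-q) p, forall p q, Q p q -> Q (2-p) (-q) & forall p q, Q p q -> Q (p+q) (-q)].

Lemma eis_rot e Q x y : hex_inv Q -> (eis e Q (-x/2 - s3*y) (s3*x - y/2) <-> eis e Q x y).
Proof.
have w2 := s3_sq R; have ww z : s3 * (s3 * z) = 3/4*z by rewrite mulrA -expr2 w2.
move=> [h _ _].
have fw a b : eis e Q a b -> eis e Q (-a/2 - s3*b) (s3*a - b/2).
  move=> [p [q [-> -> pq]]]; exists (-p-q), p; rewrite intrB mulrNz; split; last exact: h.
    by have := ww (e * q%:~R); lra.
  by ring.
split; last exact: fw.
by move=> /fw/fw g; apply: (conv2 g); have := ww x; have := ww y; have := ww (s3 * x); have := ww (s3 * y); lra.
Qed.

Lemma eis_turn e Q x y : hex_inv Q -> (eis e Q (2*e-x) (-y) <-> eis e Q x y).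
Proof.
move=> [_ h _].
have fw a b : eis e Q a b -> eis e Q (2*e-a) (-b).
  by move=> [p [q [-> -> pq]]]; exists (2-p), (-q); rewrite intrB mulrNz; split; [ring|ring|exact: h].
by split=> [/fw g|]; [apply: (conv2 g); ring|exact: fw].
Qed.

Lemma eis_flip e Q x y : hex_inv Q -> (eis e Q x (-y) <-> eis e Q x y).
Proof.
move=> [_ _ h].
have fw a b : eis e Q a b -> eis e Q a (-b).
  by move=> [p [q [-> -> pq]]]; exists (p+q), (-q); rewrite intrD mulrNz; split; [field|ring|exact: h].
by split=> [/fw g|]; [apply: (conv2 g); ring|exact: fw].
Qed.

(** Half the hexagon side is the unit and the origin is a vertex. Points with both coordinates even
    are vertices or face centers; [p - q] modulo 3 separates the two, and among the other points it
    singles out the edge midpoints. *)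
Definition Qv p q := [/\ modz p 2 = 0, modz q 2 = 0 & modz (p - q) 3 <> 1].
Definition Qe p q := ~ (modz p 2 = 0 /\ modz q 2 = 0) /\ modz (p - q) 3 = 1.
Definition Qf p q := [/\ modz p 2 = 0, modz q 2 = 0 & modz (p - q) 3 = 1].

Lemma Qv_inv : hex_inv Qv. Proof. by rewrite /Qv; split=> p q []; split; lia. Qed.
Lemma Qe_inv : hex_inv Qe. Proof. by rewrite /Qe; split=> p q []; split; lia. Qed.
Lemma Qf_inv : hex_inv Qf. Proof. by rewrite /Qf; split=> p q []; split; lia. Qed.

Lemma hex_inv_or Q Q' : hex_inv Q -> hex_inv Q' -> hex_inv (fun p q => Q p q \/ Q' p q).
Proof. by move=> [a b c] [a' b' c']; split=> p q []; auto. Qed.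

(* A description of all configurations of a class stable under the symmetries
   only has to be checked inside the fundamental triangle. *)
Lemma hex_reduce e (Hx : (R -> R -> Prop) -> Prop) (P : (R -> R -> Prop) -> R -> R -> Prop) : 0 < e ->
  (forall K, Hx K -> [/\ Hx (rot K), Hx (turn (2*e) K) & Hx (vflip K)]) ->
  (forall K x y, [/\ P (rot K) x y -> P K (-x/2 - s3*y) (s3*x - y/2), P (turn (2*e) K) x y -> P K (2*e-x) (-y) &
     P (vflip K) x y -> P K x (-y)]) ->
  (forall K x y, Hx K -> 0 <= y -> y <= 2*s3*x -> x <= e -> P K x y) -> forall K x y, Hx K -> P K x y.
Proof.
move=> e0 hH hP hT K x y hK.
suff : forall K, Hx K -> P K x y by exact.
apply: (@tri_reduce R e (fun x y => forall K, Hx K -> P K x y) e0) => {K hK x y} [x y g K h|x y g K h|x y g K h|x y h1 h2 h3 K h].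
- by have [h1 _ _] := hH _ h; have [p _ _] := hP K x y; apply/p/g.
- by have [_ h1 _] := hH _ h; have [_ p _] := hP K x y; apply/p/g.
- by have [_ _ h1] := hH _ h; have [_ _ p] := hP K x y; apply/p/g.
exact: hT.
Qed.

Lemma eis_reduce e (Hx : (R -> R -> Prop) -> Prop) Q : 0 < e -> hex_inv Q ->
  (forall K, Hx K -> [/\ Hx (rot K), Hx (turn (2*e) K) & Hx (vflip K)]) ->
  (forall K x y, Hx K -> 0 <= y -> y <= 2*s3*x -> x <= e -> (K x y <-> eis e Q x y)) ->
  forall K x y, Hx K -> (K x y <-> eis e Q x y).
Proof.
move=> e0 iQ hH hT; apply: (@hex_reduce e Hx (fun K x y => K x y <-> eis e Q x y)) => // K x y; split.
- by rewrite rotE eis_rot.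
- by rewrite /turn eis_turn.
by rewrite /vflip eis_flip.
Qed.

Lemma eis_triangle e Q x y : 0 < e -> 0 <= y -> y <= 2*s3*x -> x <= e -> eis e Q x y ->
  [\/ [/\ x = 0, y = 0 & Q 0 0], [/\ x = e, y = 0 & Q 1 0], [/\ x = e/2, y = e*s3 & Q 0 1] | [/\ x = e, y = 2*e*s3 & Q 0 2]].
Proof.
move=> e0 h1 h2 h3 [p [q [ex ey pq]]]; have w0 := s3_gt0 R.
have q0 : 0 <= q.
  by move: h1; rewrite ey pmulr_rge0 // pmulr_rge0 // ler0z.
have p0 : 0 <= p.
  move: h2; rewrite ey ex -subr_ge0 => h.
  have : 0 <= (2 * e * s3) * p%:~R by move: h; congr (_ <= _); field.
  rewrite pmulr_rge0; first by rewrite ler0z.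
  by apply: mulr_gt0 w0; apply: mulr_gt0.
have pq2 : 2 * p + q <= 2.
  move: h3; rewrite ex -[X in _ <= X]mulr1 ler_pM2l // => h.
  by rewrite -(ler_int R) intrD intrM; lra.
have [[ep eq]|[[ep eq]|[[ep eq]|[ep eq]]]] : (p = 0 /\ q = 0) \/ (p = 1 /\ q = 0) \/ (p = 0 /\ q = 1) \/ (p = 0 /\ q = 2) by lia.
all: rewrite ep eq in ex ey pq.
- by apply: Or41; split=> //; lra.
- by apply: Or42; split=> //; lra.
- by apply: Or43; split=> //; lra.
by apply: Or44; split=> //; lra.
Qed.

(** The fundamental triangle lies in the closed unit disc about the vertex, and it meets the unit
    circle only at a face center, which is not in the triangular unit ring. *)
Theorem hex1_class K x y : hex1 K -> (K x y <-> eis (1/2) Qv x y).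
Proof.
apply: (@eis_reduce (1/2) hex1 Qv) => {K x y} //; [by lra|exact: Qv_inv| |].
  move=> K h; have -> : 2 * (1/2) = 1 :> R by field.
  by split; [exact: hex1_rot|exact: hex1_turn|exact: hex1_flip].
move=> K x y [ck k0 tr _] h1 h2 h3; have w2 := s3_sq R; have w0 := s3_gt0 R; split=> [k|].
  have y1 : y <= s3 by apply: le_trans h2 _; rewrite -[X in _ <= X]mulr1; have : 0 <= s3 * (1/2 - x) by [apply: mulr_ge0; lra]; lra.
  have [[-> ->]|n] := sep0 ck k0 k; first by exists 0, 0; rewrite mul0r addr0 !mulr0; split=> //; split.
  have c : 0 < 2*s3 by apply: mulr_gt0 w0.
  have x0 : 0 <= x by rewrite -(pmulr_rge0 _ c); lra.
  have x2 : x^+2 <= (1/2)^+2 by apply: sqr_le; lra.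
  have y2 : y^+2 <= s3^+2 by apply: sqr_le; lra.
  have n1 : x^+2+y^+2 = 1 by lra.
  by have [/(_ k)[[h _]|[h _]|[h _]] _] := tr _ _ n1; lra.
move=> /(eis_triangle _ h1 h2 h3)[|[-> -> _]|[_ _]|[_ _]|[_ _]]; first lra.
- by [].
- by move=> [].
- by move=> [].
by move=> [].
Qed.

End Hex.

(** * The honeycomb with edge midpoints *)

Section Hex2.
Variable R : realType.
Notation s3 := (s3 R).
Implicit Types (K : R -> R -> Prop) (x y a b e m n : R) (p q : int).

Lemma hex2_pts K : hex2 K -> K 1 0 /\ K 2 0.
Proof.
by move=> [_ k0 tr a1 _]; have [k1 _ _] := tri_pts tr; have [k2 _ _] := anti_nbr tr k0 a1.
Qed.

(* [x, 2 * s3 * n] ranges over the triangle with vertices V = (0, 0), E = (1, 0) and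
   F = (1, 2 * s3); the barycentric coordinates are [1 - x], [x - n] and [n]. *)
Lemma triangle_cover x n : 0 <= n -> n <= x -> x <= 1 -> 1 <= x^+2+3*n^+2 -> 1 <= (x-1)^+2+3*n^+2 ->
  1 <= (x-1)^+2+3*(n-1)^+2 -> x = 1/2 /\ n = 1/2.
Proof.
move=> n0 nx x1 h1 h2 h3.
(* Weighted with the barycentric coordinates, the three distance conditions add up to the statement
   that a sum of squares is not positive. *)
have g1 : 0 <= (1-x) * (x^+2+3*n^+2-1) by apply: mulr_ge0; lra.
have g2 : 0 <= (x-n) * ((x-1)^+2+3*n^+2-1) by apply: mulr_ge0; lra.
have g3 : 0 <= n * ((x-1)^+2+3*(n-1)^+2-1) by apply: mulr_ge0; lra.
have g : (x-n)^+2 + (n-1+x)^+2 + (1 - 2*n)^+2 <= 0 by clear -g1 g2 g3; lra.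
have z u v w : u^+2+v^+2+w^+2 <= 0 -> (u = 0 :> R) /\ (w = 0 :> R).
  move=> l; have := sqr_ge0 u; have := sqr_ge0 v; have := sqr_ge0 w => l1 l2 l3.
  by split; apply/eqP; rewrite -sqrf_eq0; apply/eqP; lra.
by have [e1 e2] := z _ _ _ g; split; lra.
Qed.

Lemma triangle_far a m : 0 <= a -> a <= m -> m <= 1 -> 25/64 <= a^+2+3* m^+2 ->
  (1-a)^+2+3*(1-m)^+2 <= 9/4 /\ a^+2+3*(1-m)^+2 <= 9/5.
Proof.
move=> a0 am m1 h; have am2 : a^+2 <= m^+2 by apply: sqr_le; lra.
have m0 : 3/10 <= m.
  by rewrite leNgt; apply/negP => l; have := @sqr_le _ m (3/10) ltac:(lra) ltac:(lra); clear -h am2; lra.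
split; last first.
  by have : 0 <= (m - 3/10) * (6/5 - m) by [apply: mulr_ge0; lra]; clear -am2; lra.
have m2 : m^+2 <= 1^+2 by apply: sqr_le; lra.
have aa : 0 <= a * (m - a) by apply: mulr_ge0; lra.
suff : a^+2+3* m^+2+7/4 <= 2*a+6* m by clear; lra.
set r := a^+2+3* m^+2 in h *.
have r4 : r <= 4 by rewrite /r; clear -am2 m2; lra.
rewrite leNgt; apply/negP => l.
have : (2*a+6* m)^+2 < (r+7/4)^+2 by rewrite ltr_pXn2r // nnegrE; lra.
have : 0 <= (r - 25/64) * (8 - r) by apply: mulr_ge0; lra.
have : 12*r <= (2*a+6* m)^+2 by rewrite /r; have := sqr_ge0 a; clear -aa; lra.
by clear -h; lra.
Qed.

(** The unit discs about the three corners cover the triangle up to one point, which the triangular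
    unit ring excludes. A point at distance between [5/8] and 1 from the face center is turned about
    the edge midpoint and then rotated about the far vertex; the image is too close to the point
    itself. *)
Lemma hex2_triangle K x y : hex2 K -> 0 <= y -> y <= 2*s3*x -> x <= 1 -> K x y ->
  [\/ x = 0 /\ y = 0, x = 1 /\ y = 0 | (x-1)^+2+(y-2*s3)^+2 < 25/64].
Proof.
move=> h y0 yx x1 k; have w2 := s3_sq R; have w0 := s3_gt0 R.
have [ck k0 tr a1 t2] := h; have [k1 k2] := hex2_pts h.
have c : 0 < 2*s3 by apply: mulr_gt0 w0.
pose n := y / (2*s3); have ey : y = 2*s3*n by rewrite /n mulrC divfK // lt0r_neq0.
clearbody n; subst y; rewrite pmulr_rge0 // in y0; rewrite ler_pM2l // in yx.
have en z : (2*s3*z)^+2 = 3*z^+2.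
  by have -> : (2*s3*z)^+2 = 4*s3^+2*z^+2 by [ring]; rewrite w2; field.
have [h0|l0] := sep0 ck k0 k; first by apply: Or31.
have [h1|l1] := sepP ck k1 k; first by apply: Or32.
apply: Or33; rewrite subr0 en in l1; rewrite en in l0.
have eF : (x-1)^+2+(2*s3*n-2*s3)^+2 = (x-1)^+2+3*(n-1)^+2 by rewrite -en; congr (_ + _^+2); ring.
rewrite eF ltNge; apply/negP => far.
have lt1 : (x-1)^+2+3*(n-1)^+2 < 1.
  rewrite ltNge; apply/negP => l2.
  have [ex en2] := triangle_cover y0 yx x1 l0 l1 l2.
  have e1 : x^+2+(2*s3*n)^+2 = 1 by rewrite en ex en2; field.
  by have [/(_ k)[[q _]|[q _]|[q _]] _] := tr _ _ e1; clear -q ex; lra.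
have [f1 f2] := @triangle_far (1-x) (1-n) ltac:(lra) ltac:(lra) ltac:(lra) ltac:(lra).
have kt : turn 2 K x (2*s3*n).
  have -> : turn 2 K x (2*s3*n) = K (2*1-x) (-(2*s3*n)) by rewrite mulr1.
  apply: row_reflect => //; last by rewrite en; clear -f2; lra.
    by apply: (conv2 k0); ring.
have [ct c0 ctr _ _] := hex2_turn h.
have nz : x^+2+(2*s3*n)^+2 <= 9/4 by rewrite en; clear -f1; lra.
have kr := tri_ball ct c0 ctr kt nz.
have krr : rot (rot (turn 2 K)) x (2*s3*n) by apply: tri_ball (conf_rot ct) (rot0 c0) (tri_rot ctr) kr nz.
rewrite rot2E /turn in krr.
have sn z : s3 * (2*s3*z) = 3/2*z.
  by have -> : s3 * (2*s3*z) = 2*s3^+2*z by [ring]; rewrite w2; field.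
have l : ((2-(-x/2+s3*(2*s3*n)))-x)^+2+(-(-s3*x-(2*s3*n)/2)-2*s3*n)^+2 < 1.
  have -> : -(-s3*x-(2*s3*n)/2)-2*s3*n = s3*(x-n) by field.
  have -> : (s3*(x-n))^+2 = s3^+2*(x-n)^+2 by ring.
  by rewrite sn w2; clear -lt1; lra.
have [e1 e2] := near_eq ck k krr l.
rewrite sn in e1.
have e3 : s3*(x-n) = 0 by lra.
have /eqP := e3; rewrite mulf_eq0 (gt_eqF w0) /= subr_eq0 => /eqP e4.
rewrite -e4 in e1 far; have ex : x = 1 by lra.
by rewrite ex subrr expr0n /= in far; clear -far; lra.
Qed.

End Hex2.

Section Faces.
Variable R : realType.
Notation s3 := (s3 R).
Implicit Types (K : R -> R -> Prop) (x y z w a b e : R) (p q : int).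

Definition Qve p q := Qv p q \/ Qe p q.

Lemma Qve_inv : hex_inv Qve. Proof. exact: hex_inv_or Qv_inv Qe_inv. Qed.

Definition near_face x y := exists p q : int, Qf p q /\ (x - (p%:~R + q%:~R/2))^+2 + (y - s3 * q%:~R)^+2 < 25/64.

Lemma hex2_closed K : hex2 K -> [/\ hex2 (rot K), hex2 (turn (2*1) K) & hex2 (vflip K)].
Proof. by move=> h; rewrite mulr1; split; [exact: hex2_rot|exact: hex2_turn|exact: hex2_flip]. Qed.

Lemma hex2_ve K x y : hex2 K -> eis 1 Qve x y -> K x y.
Proof.
apply: (@hex_reduce _ 1 (@hex2 R) (fun K x y => eis 1 Qve x y -> K x y)) => {K x y}; first by [].
- exact: hex2_closed.
- move=> K x y; split.
  + by rewrite rotE (eis_rot _ _ _ Qve_inv).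
  + by rewrite /turn (eis_turn _ _ _ Qve_inv).
  by rewrite /vflip (eis_flip _ _ _ Qve_inv).
move=> K x y h y0 yx x1 /(eis_triangle _ y0 yx x1)[//|[-> -> _]|[-> -> _]|[_ _]|[_ _]].
- by have [] := h.
- by have [] := hex2_pts h.
- by case=> -[].
by rewrite /Qve /Qv /Qe => -[[]|[]]; lia.
Qed.

Lemma hex2_near K x y : hex2 K -> K x y -> eis 1 Qve x y \/ near_face x y.
Proof.
apply: (@hex_reduce _ 1 (@hex2 R) (fun K x y => K x y -> eis 1 Qve x y \/ near_face x y)) => {K x y}; first by [].
- exact: hex2_closed.
- have [r t f] := Qf_inv; have w2 := s3_sq R; have ww z : s3 * (s3 * z) = 3/4*z by rewrite mulrA -expr2 w2.
  move=> K x y; split=> h k.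
  + rewrite (eis_rot _ _ _ Qve_inv); rewrite rotE in h; case: (h k) => [|[p [q [pq l]]]]; [by left|right].
    exists (-p-q), p; split; first exact: r.
    rewrite -(rot_norm (x - (p%:~R + q%:~R/2)) (y - s3 * q%:~R)) in l.
    move: l; congr (_^+2 + _^+2 < _); rewrite ?intrB ?mulrNz; have := ww q%:~R; lra.
  + rewrite (eis_turn _ _ _ Qve_inv); rewrite /turn in h; case: (h k) => [|[p [q [pq l]]]]; [by left|right].
    exists (2-p), (-q); split; first exact: t.
    by rewrite -sqrrN -[X in _ + X]sqrrN in l; move: l; congr (_^+2 + _^+2 < _); rewrite ?intrB ?mulrNz; ring.
  rewrite (eis_flip _ _ _ Qve_inv); rewrite /vflip in h; case: (h k) => [|[p [q [pq l]]]]; [by left|right].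
  exists (p+q), (-q); split; first exact: f.
  by rewrite -[X in _ + X]sqrrN in l; move: l; congr (_^+2 + _^+2 < _); rewrite ?intrD ?mulrNz; field.
move=> K x y h y0 yx x1 k; case: (hex2_triangle h y0 yx x1 k) => [[-> ->]|[-> ->]|l].
- by left; exists 0, 0; split; [ring|ring|left].
- by left; exists 1, 0; split; [ring|ring|right; split=> // -[]].
by right; exists 0, 2; split=> //; move: l; congr (_^+2 + _^+2 < _); field.
Qed.

Lemma int_sqr_lt (c : int) (n : nat) : (c%:~R^+2 : R) < (n%:R)^+2 -> - (n : int) < c /\ c < (n : int).
Proof.
move=> l; have : `|c%:~R : R| < n%:R by rewrite -(@ltr_pXn2r _ 2) ?nnegrE // real_normK ?num_real.
by rewrite ltr_norml => /andP[]; rewrite -[n%:R]/(n%:Z%:~R) -mulrNz !ltr_int.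
Qed.

Lemma face_at_edge u v (p q : int) : Qf p q -> (1 + u - (p%:~R + q%:~R/2))^+2 + (v - s3 * q%:~R)^+2 < 25/64 ->
  u^+2+v^+2 <= 28/5 -> u^+2 <= 25/64.
Proof.
move=> [hp hq hpq]; have [p' ep] : exists p', p = 2 * p' by exists (divz p 2); lia.
have [q' eq] : exists q', q = 2*q' by exists (divz q 2); lia.
rewrite ep eq !intrM => l n; have w2 := s3_sq R.
pose A : int := 2 * p'+q'-1.
have eA : A%:~R = 2 * p'%:~R + q'%:~R - 1 :> R by rewrite /A intrB intrD intrM.
have l' : (u - A%:~R)^+2 + (v - 2*s3*q'%:~R)^+2 < 25/64.
  by move: l; congr (_^+2 + _^+2 < _); rewrite ?eA; field.
have e2 : (2*s3*q'%:~R)^+2 = 3*q'%:~R^+2.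
  by have -> : (2*s3*q'%:~R)^+2 = 4*s3^+2*q'%:~R^+2 by [ring]; rewrite w2; field.
have b9 : A%:~R^+2 + 3*q'%:~R^+2 < 9 :> R.
  have := sqr_ge0 (u/2 - 2*(A%:~R - u)); have := sqr_ge0 (v/2 - 2*(2*s3*q'%:~R - v)).
  by rewrite -e2; clear -l' n; lra.
have [A1 A2] := @int_sqr_lt A 3 ltac:(have := sqr_ge0 (q'%:~R : R); lra).
have [q1 q2] := @int_sqr_lt q' 2 ltac:(have := sqr_ge0 (A%:~R : R); lra).
have A0 : A = 0 by rewrite /A in A1 A2 *; lia.
by rewrite A0 in l'; have := sqr_ge0 (v - 2*s3*q'%:~R); clear -l'; lra.
Qed.

(** Seen from an edge midpoint, vertices and midpoints are symmetric, so asymmetric points lie near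
    face centers. Within this radius those are the faces straight above or below, so asymmetric
    points satisfy [|x - 1| <= 5/8] and [sym_band] applies. *)
Lemma edge_sym K x y : hex2 K -> K x y -> (x-1)^+2+y^+2 <= 28/5 -> K (2-x) (-y).
Proof.
move=> h k l; have [ck _ _ _ _] := h; have [k1 _] := hex2_pts h.
pose M := move K 1 0 1 0; have ME u v : M u v = K (1+u) v by rewrite /M shiftE add0r.
have cM : conf M by apply: conf_move => //; ring.
have M0 : M 0 0 by rewrite ME addr0.
have [t et] : exists t, (x-1)^+2+y^+2 = t by exists ((x-1)^+2+y^+2).
rewrite et in l.
have band u v : asym M t u v -> u^+2 <= 25/64.
  move=> [ku e n]; rewrite ME in ku; case: (hex2_near h ku) => [ve|[p [q [pq ll]]]].
    case: n; rewrite ME; apply: hex2_ve => //; have := eis_turn 1 (1+u) v Qve_inv => -[_ /(_ ve)] g.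
    by apply: (conv2 g); ring.
  by apply: face_at_edge pq ll _; rewrite e.
have kM : M (x-1) y by rewrite ME; apply: (conv2 k); ring.
suff na u v : ~ asym M t u v.
  by have := sym_ring na kM et; rewrite ME => k'; apply: (conv2 k'); ring.
move=> a; have t1 := asym_ge1 cM M0 a.
have h0 : 0 < t - 25/64 by lra.
apply: (@sym_band _ M t (5/8) (Num.sqrt (t - 25/64))) a => //.
- by rewrite sqrtr_gt0.
- by rewrite sqr_sqrtr; [clear -t1; lra|exact: ltW].
- move=> u' v' a; have b := band _ _ a; split; first by apply: sqr_le_abs; lra.
  have [_ e _] := a; apply: le_abs_sqr; first by rewrite sqrtr_gt0.
  by rewrite sqr_sqrtr; [clear -e b; lra|exact: ltW].
move=> u1 v1 u2 v2 e1 e2 hv vv b1 b2 b12; set r := Num.sqrt _ in hv.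
have r2 : r^+2 = t - 25/64 by rewrite /r sqr_sqrtr ?ltW.
have r0 : 3/4 <= r.
  by rewrite leNgt; apply/negP => rl; have := @sqr_le _ r (3/4) ltac:(have : 0 <= r by [exact: sqrtr_ge0]; lra) ltac:(lra); lra.
have d : (u1-u2)^+2 <= (5/8)^+2 by apply: sqr_le; lra.
have q2 : u2^+2 <= (5/8)^+2 by apply: sqr_le; lra.
have : (v1 - v2) * (3/2) <= (v1 - v2) * (v1 + v2) by apply: ler_wpM2l; lra.
have := sqr_ge0 u1 => q1 dv.
have dv1 : v1 - v2 <= 7/24 by clear -dv q1 q2 e1 e2; lra.
have : (v1 - v2)^+2 <= (7/24)^+2 by apply: sqr_le; lra.
by clear -d; lra.
Qed.

End Faces.

Section RotSum.
Variable R : realType.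
Notation s3 := (s3 R).

Lemma rot_closed_sum (f : seq (R * R)) : uniq f ->
  (forall x y, (x, y) \in f -> (-x/2 - s3*y, s3*x - y/2) \in f) ->
  \sum_(v <- f) v.1 = 0 /\ \sum_(v <- f) v.2 = 0.
Proof.
move=> uf cf; have w2 := s3_sq R; have ww z : s3 * (s3 * z) = 3/4*z by rewrite mulrA -expr2 w2.
pose r (v : R * R) := (-v.1/2 - s3*v.2, s3*v.1 - v.2/2).
have rrr v : r (r (r v)) = v.
  case: v => x y; rewrite /r /=; have := ww x; have := ww y; have := ww (s3*x); have := ww (s3*y).
  by move=> *; congr pair; lra.
have ri : injective r by move=> u v e; rewrite -[u]rrr -[v]rrr e.
have cr v : v \in f -> r v \in f by case: v => x y; apply: cf.
have p : perm_eq f (map r f).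
  apply: uniq_perm => //; first by rewrite map_inj_uniq.
  move=> v; apply/idP/mapP => [m|[u m ->]]; last exact: cr.
  by exists (r (r v)); [apply/cr/cr|rewrite rrr].
have e1 : \sum_(v <- f) v.1 = -(\sum_(v <- f) v.1)/2 - s3 * (\sum_(v <- f) v.2).
  rewrite {1}(sum_perm _ p) big_map /r /= sumrB -mulr_sumr; congr (_ - _).
  by rewrite -mulr_suml sumrN.
have e2 : \sum_(v <- f) v.2 = s3 * (\sum_(v <- f) v.1) - (\sum_(v <- f) v.2)/2.
  by rewrite {1}(sum_perm _ p) big_map /r /= sumrB -mulr_sumr -mulr_suml.
move: (\sum_(v <- f) v.1) (\sum_(v <- f) v.2) e1 e2 => X Y e1 e2.
have := ww X; have wY := ww Y; move=> wX.
have e3 : s3 * Y = - (3/2*X) by lra.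
have e4 : s3 * (s3*Y) = -(3/2*(s3*X)) by rewrite e3; ring.
have e5 : s3*X = 3/2*Y by lra.
have Y0 : Y = 0 by lra.
by split=> //; rewrite Y0 in e3; lra.
Qed.
End RotSum.

(** * A point near a face center is the center *)

Section Cores.
Variable R : realType.
Notation s3 := (s3 R).
Implicit Types (K : R -> R -> Prop) (x y z w a b e : R) (p q : int).

Lemma face_step K z w : hex2 K -> z^+2+w^+2 < 25/64 -> K (1+z) (2*s3+w) -> K (1-z) (-(2*s3)-w).
Proof.
move=> h l k; have w2 := s3_sq R; have [wl wr] := s3_bound R.
have l2 : w <= 5/8.
  by have := @sqr_le_abs _ w (5/8) ltac:(lra) ltac:(have := sqr_ge0 z; lra); lra.
have h1 : s3 * w <= 13/15*(5/8).
  have [w0|w0] := leP 0 w; first by apply: ler_pM; lra.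
  have : s3 * w <= 0 by [rewrite pmulr_rle0; lra]; lra.
have n : (1+z-1)^+2+(2*s3+w)^+2 <= 28/5 by clear -l h1 w2; lra.
by apply: (conv2 (edge_sym h k n)); ring.
Qed.

(* Reflections in the three edges at a vertex carry a point near one of the three
   surrounding faces to all of them and to its mirror image in the face centre. *)
Lemma face_copies K z w : hex2 K -> z^+2+w^+2 < 25/64 -> K (1+z) (2*s3+w) ->
  [/\ K (-2+z) w, K (-2-z) (-w), K (1-z) (2*s3-w), K (1+z) (-(2*s3)+w) & K (1-z) (-(2*s3)-w)].
Proof.
move=> h; have w2 := s3_sq R; have ww x : s3 * (s3 * x) = 3/4*x by rewrite mulrA -expr2 w2.
have s1 z' w' : z'^+2+w'^+2 < 25/64 -> K (-2+z') w' -> K (1-z') (2*s3-w').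
  move=> l k; have := @face_step (rot K) (-z'/2+s3*w') (-s3*z'-w'/2) (hex2_rot h).
  rewrite (rotN_norm z' w') => /(_ l); rewrite !rotE => g.
  have wz := ww z'; have wwp := ww w'.
  apply: (conv2 (g _)); [|lra|lra].
  by apply: (conv2 k); lra.
have s2 z' w' : z'^+2+w'^+2 < 25/64 -> K (1+z') (-(2*s3)+w') -> K (-2-z') (-w').
  move=> l k; have := @face_step (rot (rot K)) (-z'/2-s3*w') (s3*z'-w'/2) (hex2_rot (hex2_rot h)).
  rewrite (rot_norm z' w') => /(_ l); rewrite !rot2E => g.
  have wz := ww z'; have wwp := ww w'.
  apply: (conv2 (g _)); [|lra|lra].
  by apply: (conv2 k); lra.
move=> l k; have ln : (-z)^+2+(-w)^+2 < 25/64 by rewrite !sqrrN.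
have a1 := face_step h l k.
have a2 : K (-2+z) w by apply: (conv2 (s2 (-z) (-w) ln _)); rewrite ?opprK.
have a3 := s1 _ _ l a2.
have a4 : K (1+z) (-(2*s3)+w).
  by apply: (conv2 (face_step h ln _)); rewrite ?opprK.
by split=> //; apply: s2.
Qed.

End Cores.

Section Cores2.
Variable R : realType.
Notation s3 := (s3 R).
Implicit Types (K : R -> R -> Prop) (x y z w a b e : R) (p q : int).

Lemma core_pair K f g z w a b : conf K -> z^+2+w^+2 < 25/64 -> a^+2+b^+2 < 25/64 ->
  K (f+z) (g+w) -> K (f-z) (g-w) -> K (f+a) (g+b) -> (a = z /\ b = w) \/ (a = -z /\ b = -w).
Proof.
move=> ck l l' k1 k2 k.
have [[e1 e2]|h1] := sepP ck k1 k; first by left; split; lra.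
have [[e1 e2]|h2] := sepP ck k2 k; first by right; split; lra.
by exfalso; clear -l l' h1 h2; lra.
Qed.

Lemma faces_at_vertex x y p q : Qf p q -> (x - (p%:~R + q%:~R/2))^+2 + (y - s3 * q%:~R)^+2 < 25/64 ->
  x^+2+y^+2 <= 7 -> [\/ p = 0 /\ q = 2, p = -2 /\ q = 0 | p = 2 /\ q = -2].
Proof.
move=> [hp hq hpq]; have [p' ep] : exists p', p = 2 * p' by exists (divz p 2); lia.
have [q' eq] : exists q', q = 2*q' by exists (divz q 2); lia.
rewrite ep eq !intrM => l n; have w2 := s3_sq R.
pose A : int := 2 * p'+q'.
have eA : A%:~R = 2 * p'%:~R + q'%:~R :> R by rewrite /A intrD intrM.
have l' : (x - A%:~R)^+2 + (y - 2*s3*q'%:~R)^+2 < 25/64.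
  by move: l; congr (_^+2 + _^+2 < _); rewrite ?eA; field.
have e2 : (2*s3*q'%:~R)^+2 = 3*q'%:~R^+2.
  by have -> : (2*s3*q'%:~R)^+2 = 4*s3^+2*q'%:~R^+2 by [ring]; rewrite w2; field.
have b9 : A%:~R^+2 + 3*q'%:~R^+2 < 12 :> R.
  have := sqr_ge0 (x/2 - 2*(A%:~R - x)); have := sqr_ge0 (y/2 - 2*(2*s3*q'%:~R - y)).
  by rewrite -e2; clear -l' n; lra.
have [A1 A2] := @int_sqr_lt _ A 4 ltac:(have := sqr_ge0 (q'%:~R : R); lra).
have [q1 q2] := @int_sqr_lt _ q' 2 ltac:(have := sqr_ge0 (A%:~R : R); lra).
have [h|[h|h]] : (p' = 0 /\ q' = 1) \/ (p' = -1 /\ q' = 0) \/ (p' = 1 /\ q' = -1) by rewrite /A in A1 A2 *; lia.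
- by apply: Or31; lia.
- by apply: Or32; lia.
by apply: Or33; lia.
Qed.

(** In the ring of [(-2 + z, w)] the vertices and midpoints are closed under rotation by [2 pi / 3]
    and add up to zero. Since the displacement is extremal in this direction, at most one other
    point remains near the three faces, with abscissa [1 - z]. The abscissas then add up to [-2 + z]
    or [-1], never zero. *)
Lemma core_max K z w : hex2 K -> z^+2+w^+2 < 25/64 -> K (1+z) (2*s3+w) ->
  z < 0 -> 2*s3*w <= -z -> -(2*s3*w) <= -z -> False.
Proof.
move=> h l k z0 w1 w1'; have w2 := s3_sq R; have [ck k0 _ _ _] := h.
have [c1 c1' c0' c2 c2'] := face_copies h l k.
have [t et] : exists t, (-2+z)^+2+w^+2 = t by eexists.
have t7 : t <= 7.
  have z5 : -(5/8) <= z by have := @sqr_le_abs _ z (5/8) ltac:(lra) ltac:(have := sqr_ge0 w; lra); lra.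
  by rewrite -et; clear -z5 l; lra.
have [s us [ms sx sy]] := ring0 t ck k0.
pose ve (v : R * R) := `[< eis 1 Qve v.1 v.2 >].
have [fx _] : \sum_(v <- [seq v <- s | ve v]) v.1 = 0 /\ \sum_(v <- [seq v <- s | ve v]) v.2 = 0.
  apply: rot_closed_sum => [|x y]; first exact: filter_uniq.
  rewrite !mem_filter => /andP[/asboolP v m]; have [kv e] := (ms x y).1 m.
  have v' : eis 1 Qve (-x/2 - s3*y) (s3*x - y/2) by rewrite (eis_rot _ _ _ Qve_inv).
  apply/andP; split; first exact/asboolP.
  by apply/ms; split; [exact: hex2_ve|rewrite rot_norm].
pose L := [seq v <- s | ~~ ve v].
have Lx : \sum_(v <- L) v.1 = 0.
  by move: sx; rewrite (bigID ve) /= -big_filter fx add0r -big_filter.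
have mem1 : (-2+z, w) \in L.
  rewrite mem_filter; apply/andP; split; last by apply/ms.
  apply/asboolP => -[p [q [/= e1 e2 pq]]].
  pose c : int := 2 * p + q + 4.
  have ec : c%:~R = 2 * p%:~R + q%:~R + 4 :> R by rewrite /c !intrD intrM.
  have ez : z = c%:~R/2 by rewrite ec; lra.
  have ew : w^+2 = 3/4*q%:~R^+2.
    by rewrite e2; have -> : (1*(s3*q%:~R))^+2 = s3^+2*q%:~R^+2 by [ring]; rewrite w2.
  have en : c%:~R^+2 + 3*q%:~R^+2 < 25/16 :> R by rewrite ew ez in l; clear -l; lra.
  have [d1 d2] := @int_sqr_lt _ c 2 ltac:(have := sqr_ge0 (q%:~R : R); lra).
  have [q1 q2] := @int_sqr_lt _ q 1 ltac:(have := sqr_ge0 (c%:~R : R); lra).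
  by move: pq; rewrite /Qve /Qv /Qe; rewrite /c in d1 d2; clear -d1 d2 q1 q2 => -[[]|[]]; lia.
have [yP LP] : exists yP, forall v, v \in L -> v = (-2+z, w) \/ v = (1-z, yP).
  suff H x y : (x, y) \in L -> (x = -2+z /\ y = w) \/ (x = 1-z /\ ((2*s3*w = z /\ y = 2*s3-w) \/ (2*s3*w = -z /\ y = -(2*s3)-w))).
    exists (if 2*s3*w == z then 2*s3-w else -(2*s3)-w) => -[x y] /H[[-> ->]|[-> [[e ->]|[e ->]]]]; [by left|right..].
      by rewrite e eqxx.
    by case: eqP => // e'; exfalso; lra.
  rewrite mem_filter => /andP[/asboolP nv /ms[kv e]].
  case: (hex2_near h kv) => [//|[p [q [pq ll]]]].
  case: (faces_at_vertex pq ll ltac:(by rewrite e)) => -[ep eq]; rewrite ep eq in ll.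
  - have l2 : (x-1)^+2+(y-2*s3)^+2 < 25/64 by move: ll; congr (_^+2+_^+2 < _); field.
    have := @core_pair K 1 (2*s3) z w (x-1) (y-2*s3) ck l l2 k c0' ltac:(by apply: (conv2 kv); ring).
    case=> -[e1 e2]; have ex : x = 1 + (x-1) by [ring]; have ey : y = 2*s3+(y-2*s3) by [ring].
      by exfalso; rewrite ex ey e1 e2 in e; clear -e et w2 z0 w1; lra.
    right; split; first by lra.
    left; split; last by lra.
    by rewrite ex ey e1 e2 in e; clear -e et w2; lra.
  - have l2 : (x+2)^+2+y^+2 < 25/64 by move: ll; congr (_^+2+_^+2 < _); field.
    have kc : K (-2-z) (0-w) by apply: (conv2 c1') => //; ring.
    have := @core_pair K (-2) 0 z w (x+2) y ck l l2 ltac:(by rewrite add0r) kc ltac:(by apply: (conv2 kv); ring).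
    case=> -[e1 e2]; first by left; split; lra.
    exfalso; have ex : x = -2 - z by lra.
    by rewrite ex e2 in e; clear -e et z0; lra.
  have l2 : (x-1)^+2+(y+2*s3)^+2 < 25/64 by move: ll; congr (_^+2+_^+2 < _); rewrite ?mulrNz; field.
  have := @core_pair K 1 (-(2*s3)) z w (x-1) (y+2*s3) ck l l2 c2 c2' ltac:(by apply: (conv2 kv); ring).
  case=> -[e1 e2]; have ex : x = 1 + (x-1) by [ring]; have ey : y = -(2*s3)+(y+2*s3) by [ring].
    by exfalso; rewrite ex ey e1 e2 in e; clear -e et w2 z0 w1'; lra.
  right; split; first by lra.
  right; split; last by lra.
  by rewrite ex ey e1 e2 in e; clear -e et w2; lra.
have [s1|p] := size_le_pair (filter_uniq _ us) LP.
  rewrite -/L in s1; case: L s1 Lx mem1 {LP} => [|u [|? ?]] //= _ Lx; rewrite inE => /eqP eu.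
  by rewrite big_cons big_nil -eu /= in Lx; lra.
by rewrite (sum_perm _ p) !big_cons big_nil /= in Lx; lra.
Qed.

(** Applied to the coordinates of a displacement along the three face directions, which add up to
    zero: the one of largest absolute value meets the hypotheses of [core_max] up to a half turn. *)
Lemma max_of_three a b (c : R) : a + b + c = 0 ->
  [\/ a = 0 /\ b = 0, [/\ a != 0, b - c <= `|a| & c - b <= `|a|],
      [/\ b != 0, c - a <= `|b| & a - c <= `|b|] | [/\ c != 0, a - b <= `|c| & b - a <= `|c|]].
Proof.
move=> s0; have [[a0 b0]|n] := pselect (a = 0 /\ b = 0); first by apply: Or41.
have nz (d d' d'' : R) : d + d' + d'' = 0 -> `|d'| <= `|d| -> `|d''| <= `|d| -> (d = 0 -> d' = 0 -> d'' = 0 -> False) ->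
    [/\ d != 0, d' - d'' <= `|d| & d'' - d' <= `|d|].
  move=> sd l1 l2 nn; have dn : d != 0.
    apply/eqP => e; rewrite e normr0 !normr_le0 in l1 l2; exact: nn e (eqP l1) (eqP l2).
  split=> //; move: l1 l2; case: (ger0P d) => ?; case: (ger0P d') => ?; case: (ger0P d'') => ? ? ?; lra.
have [ab|ab] := leP `|b| `|a|.
  have [ac|ac] := leP `|c| `|a|; first by apply: Or42; apply: nz => // *; apply: n; split.
  by apply: Or44; apply: nz; [lra|lra|lra|move=> *; apply: n].
have [bc|bc] := leP `|c| `|b|.
  by apply: Or43; apply: nz; [lra|lra|lra|move=> *; apply: n].
by apply: Or44; apply: nz; [lra|lra|lra|move=> *; apply: n].
Qed.

Lemma no_core K z w : hex2 K -> z^+2+w^+2 < 25/64 -> K (1+z) (2*s3+w) -> z = 0 /\ w = 0.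
Proof.
have w2 := s3_sq R; have ww x : s3 * (s3 * x) = 3/4*x by rewrite mulrA -expr2 w2.
have sgn K' z' w' : hex2 K' -> z'^+2+w'^+2 < 25/64 -> K' (1+z') (2*s3+w') -> 
    z' != 0 -> 2*s3*w' <= `|z'| -> -(2*s3*w') <= `|z'| -> False.
  move=> h l k zn; have [z0|z0] := ltP z' 0.
    by rewrite ltr0_norm // => b1 b2; exact: core_max h l k z0 b1 b2.
  rewrite ger0_norm // => b1 b2; have zp : 0 < z' by rewrite lt_neqAle eq_sym zn.
  have [_ _ k' _ _] := face_copies h l k.
  by apply: (@core_max K' (-z') (-w')); rewrite ?sqrrN //; lra.
move=> h l k; have [f1 _ _ f2 _] := face_copies h l k.
have kr : rot K (1+(-z/2+s3*w)) (2*s3+(-s3*z-w/2)).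
  by rewrite rotE; apply: (conv2 f1); have := ww z; have := ww w; lra.
have krr : rot (rot K) (1+(-z/2-s3*w)) (2*s3+(s3*z-w/2)).
  by rewrite rot2E; apply: (conv2 f2); have := ww z; have := ww w; lra.
have n1 : (-z/2+s3*w)^+2+(-s3*z-w/2)^+2 < 25/64 by rewrite (rotN_norm z w).
have n2 : (-z/2-s3*w)^+2+(s3*z-w/2)^+2 < 25/64 by rewrite (rot_norm z w).
have wz := ww z; have wwp := ww w.
have s0 : z + (-z/2+s3*w) + (-z/2-s3*w) = 0 by field.
case: (max_of_three s0) => [[z0 e]|[zn b1 b2]|[zn b1 b2]|[zn b1 b2]].
- split=> //; have w0 := s3_gt0 R; have /eqP : s3 * w = 0 by lra.
  by rewrite mulf_eq0 (gt_eqF w0) /= => /eqP.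
- by exfalso; apply: (sgn K z w) => //; lra.
- by exfalso; apply: (sgn _ _ _ (hex2_rot h) n1 kr zn); lra.
by exfalso; apply: (sgn _ _ _ (hex2_rot (hex2_rot h)) n2 krr zn); lra.
Qed.

Definition Qvef p q := Qve p q \/ Qf p q.

Lemma Qvef_inv : hex_inv Qvef. Proof. exact: hex_inv_or Qve_inv Qf_inv. Qed.

Definition hex2f K := hex2 K /\ K 1 (2*s3).

Lemma hex2f_closed K : hex2f K -> [/\ hex2f (rot K), hex2f (turn (2*1) K) & hex2f (vflip K)].
Proof.
move=> [h k]; have [h1 h2 h3] := hex2_closed h; have w2 := s3_sq R.
have l : 0^+2 + 0^+2 < 25/64 :> R by rewrite expr0n /=; lra.
have [] := @face_copies _ K 0 0 h l ltac:(by apply: (conv2 k); ring); rewrite ?oppr0 !addr0 => f1 _ _ f2 _.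
split; split=> //.
- by rewrite rotE; apply: (conv2 f1); lra.
by rewrite /turn; apply: (conv2 f2); ring.
Qed.

Lemma hex2nf_closed K : hex2 K /\ ~ K 1 (2*s3) ->
  [/\ hex2 (rot K) /\ ~ rot K 1 (2*s3), hex2 (turn (2*1) K) /\ ~ turn (2*1) K 1 (2*s3) & hex2 (vflip K) /\ ~ vflip K 1 (2*s3)].
Proof.
move=> [h n]; have [h1 h2 h3] := hex2_closed h; split; split=> // k; apply: n.
- have [r1 _ _] := hex2f_closed (conj h1 k); have [[_ r2] _ _] := hex2f_closed r1.
  by rewrite rot3 in r2.
- by have [_ [_ r1] _] := hex2f_closed (conj h2 k); rewrite turnK in r1.
have [_ _ [_ r1]] := hex2f_closed (conj h3 k).
by move: r1; rewrite /vflip opprK.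
Qed.

Theorem hex2_class K : hex2 K -> (forall x y, K x y <-> eis 1 Qve x y) \/ (forall x y, K x y <-> eis 1 Qvef x y).
Proof.
move=> h; have w2 := s3_sq R; have w0 := s3_gt0 R.
have tri_in K' x y : hex2 K' -> 0 <= y -> y <= 2*s3*x -> x <= 1 -> K' x y -> eis 1 Qve x y \/ (x = 1 /\ y = 2*s3).
  move=> h' y0 yx x1 k; case: (hex2_triangle h' y0 yx x1 k) => [[-> ->]|[-> ->]|l].
  - by left; exists 0, 0; split; [ring|ring|left].
  - by left; exists 1, 0; split; [ring|ring|right; split=> // -[]].
  right; have [] := no_core h' l; last by move=> e1 e2; split; lra.
  by apply: (conv2 k); ring.
have [k|n] := pselect (K 1 (2*s3)); [right|left] => x y.
  apply: (@eis_reduce _ 1 hex2f Qvef ltr01 Qvef_inv hex2f_closed) => // {h k x y} K' x y [h k] y0 yx x1.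
  split=> [k'|].
    case: (tri_in _ _ _ h y0 yx x1 k') => [[p [q [ex ey pq]]]|[-> ->]]; first by exists p, q; split=> //; left.
    by exists 0, 2; split; [field|ring|right].
  move=> [p [q [ex ey [pq|pq]]]]; first by apply: hex2_ve => //; exists p, q.
  have e : eis 1 Qf x y by exists p, q.
  case: (eis_triangle ltr01 y0 yx x1 e) => -[-> -> qf]; try by case: qf.
  by rewrite mulr1; apply: (conv2 k).
apply: (@eis_reduce _ 1 (fun K => hex2 K /\ ~ K 1 (2*s3)) Qve ltr01 Qve_inv hex2nf_closed) => // {h n x y} K' x y [h n] y0 yx x1.
split=> [k|]; last exact: hex2_ve.
by case: (tri_in _ _ _ h y0 yx x1 k) => // -[ex ey]; case: n; apply: (conv2 k).
Qed.

End Cores2.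

(** * The classification in coordinates *)

Section Normal.
Variable R : realType.
Notation s3 := (s3 R).
Implicit Types (K : R -> R -> Prop) (x y a b c t s h : R).

Lemma moveM K a b c t : move (move K a b 1 0) 0 0 c t = move K a b c t.
Proof. by apply/funext => x; apply/funext => y; rewrite /move; congr K; ring. Qed.

(** If all unit rings are symmetric, the pair [(0, 0)], [(1, 0)] propagates to all integer points
    and [line_class] applies. Otherwise the frame is moved to a point with triangular unit ring. *)
Theorem conf_class K : conf K -> K 0 0 -> K 1 0 -> (exists x y, K x y /\ y != 0) ->
  (exists s h, 0 < h /\ (lat K s h \/ lat34 K s h)) \/
  exists a b c t, c^+2+t^+2 = 1 /\
   [\/ forall x y, move K a b c t x y <-> eis (1/2) Qv x y,
       forall x y, move K a b c t x y <-> eis 1 Qve x y |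
       forall x y, move K a b c t x y <-> eis 1 Qvef x y].
Proof.
move=> ck k0 k1 ex; have [an|] := pselect (forall a b, K a b -> anti (move K a b 1 0)).
  left; apply: line_class => // i.
  suff [] : K i%:~R 0 /\ K (i%:~R + 1) 0 by [].
  have e1 : 1^+2 + 0^+2 = 1 :> R by rewrite expr0n expr1n addr0.
  have e2 : (-1)^+2 + 0^+2 = 1 :> R by rewrite sqrrN.
  move: i; apply: (@int_step _ 0) => [|i [h1 h2]|i [h1 h2]]; first by split; [|rewrite add0r].
    have h3 : K (i%:~R + 1 + 1) 0.
      have := an _ _ h2 _ _ e2; rewrite !shiftE => /(_ (conv2 h1 _ _)) h.
      by apply: (conv2 (h _ _)); ring.
    by split; [apply: (conv2 h2)|apply: (conv2 h3)]; rewrite ?intrD //.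
  have h3 : K (i%:~R - 1) 0.
    have := an _ _ h1 _ _ e1; rewrite !shiftE => /(_ (conv2 h2 _ _)) h.
    by apply: (conv2 (h _ _)); ring.
  by split; [apply: (conv2 h3)|apply: (conv2 h1)]; rewrite ?intrB //; ring.
move=> /existsNP[a /existsNP[b /not_implyP[kab nan]]]; right.
have cM : conf (move K a b 1 0) by apply: conf_move => //; ring.
have M0 : move K a b 1 0 0 0 by rewrite shiftE !addr0.
have [//|[c [t [ct tr]]]] := star cM M0.
rewrite moveM in tr; exists a, b, c, t; split=> //.
have cN : conf (move K a b c t) by apply: conf_move.
have N0 : move K a b c t 0 0 by apply: (conv2 kab); ring.
case: (hex_cases cN N0 tr) => h; first by apply: Or31 => x y; exact: hex1_class.
by case: (hex2_class h) => g; [apply: Or32|apply: Or33].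
Qed.

End Normal.

(** * From sets of points of the plane to coordinates *)

Section Plane.
Variable R : realType.
Notation s3 := (s3 R).
Implicit Types (C : set (plane R)) (P Q u v w : plane R) (x y a b c t d : R) (p q i j : int).

Lemma plane_eq P Q : P 0 0 = Q 0 0 -> P 0 1 = Q 0 1 -> P = Q.
Proof.
move=> e0 e1; apply/rowP => j.
by case: j => -[|[|//]] l; [have -> : Ordinal l = 0 by apply: val_inj|have -> : Ordinal l = 1 by apply: val_inj].
Qed.

Definition perp u : plane R := \row_(j < 2) if j == 0 then - u 0 1 else u 0 0.

Lemma perp0 u : perp u 0 0 = - u 0 1. Proof. by rewrite mxE. Qed.
Lemma perp1 u : perp u 0 1 = u 0 0. Proof. by rewrite mxE. Qed.

Definition sqn u : R := u 0 0 ^+ 2 + u 0 1 ^+ 2.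

Lemma distE P Q : dist P Q = Num.sqrt (sqn (Q - P)).
Proof. by rewrite /dist !big_ord_recl big_ord0 addr0 /sqn !mxE; congr (Num.sqrt (_ + (Q 0 _ - P 0 _)^+2)); exact: val_inj. Qed.

Lemma sqn_ge0 u : 0 <= sqn u.
Proof. by rewrite addr_ge0 ?sqr_ge0. Qed.

Lemma sqn_eq0 u : (sqn u == 0) = (u == 0).
Proof.
rewrite /sqn paddr_eq0 ?sqr_ge0 // !sqrf_eq0; apply/andP/eqP => [[/eqP e0 /eqP e1]|->]; last by rewrite !mxE eqxx.
by apply: plane_eq; rewrite ?e0 ?e1 mxE.
Qed.

Definition aff P u x y : plane R := P + x *: u + y *: perp u.

Lemma aff_sub P u a b x y : aff P u a b - aff P u x y = (a - x) *: u + (b - y) *: perp u.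
Proof. by apply: plane_eq; rewrite /aff !mxE /=; ring. Qed.

Lemma sqn_aff u a b : sqn (a *: u + b *: perp u) = (a^+2+b^+2) * sqn u.
Proof. by rewrite /sqn !mxE /=; ring. Qed.

Lemma aff_onto P u Q : u != 0 -> exists x y, Q = aff P u x y.
Proof.
move=> u0; have n0 : sqn u != 0 by rewrite sqn_eq0.
exists (((Q - P) 0 0 * u 0 0 + (Q - P) 0 1 * u 0 1) / sqn u), ((- (Q - P) 0 0 * u 0 1 + (Q - P) 0 1 * u 0 0) / sqn u).
by apply: plane_eq; rewrite /aff !mxE /= /sqn in n0 *; field.
Qed.

Lemma aff_move P u a b c t x y : aff P u (a + c*x - t*y) (b + t*x + c*y) = aff (aff P u a b) (c *: u + t *: perp u) x y.
Proof. by apply: plane_eq; rewrite /aff !mxE /=; ring. Qed.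

Lemma s3E : s3 = Num.sqrt 3 / 2. Proof. by []. Qed.

Lemma rot60E u : rot60 u = 2^-1 *: u + s3 *: perp u.
Proof. by apply: plane_eq; rewrite !mxE /= s3E; ring. Qed.

Lemma finite_uniq (T : choiceType) (A : set T) : finite_set A -> exists2 s : seq T, uniq s &
  (forall z : T, z \in s <-> A z) /\ forall (V : nmodType) (F : T -> V), \sum_(x \in A) F x = \sum_(x <- s) F x.
Proof.
move=> fA; exists (finmap.enum_fset (fset_set A)); first exact: finmap.fset_uniq.
split=> [z|V F]; last exact: fsbig_finite.
by have := in_fset_set fA z => ->; rewrite inE.
Qed.

Definition frame C P u x y := C (aff P u x y).

Lemma sep_sqr d r : 0 < d -> d <= Num.sqrt (r * d^+2) -> 1 <= r.
Proof.
move=> d0 l; have d2 : 0 < d^+2 by rewrite exprn_gt0.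
have r0 : 0 <= r * d^+2 by rewrite leNgt; apply/negP => n; rewrite ltr0_sqrtr // leNgt d0 in l.
have : d^+2 <= r * d^+2 by rewrite -[leRHS](sqr_sqrtr r0) ler_pXn2r // nnegrE; [exact: ltW|exact: sqrtr_ge0].
by rewrite -[X in X <= _]mul1r ler_pM2r.
Qed.

Lemma conf_frame C P u d : balanced C -> 0 < d -> sqn u = d^+2 ->
  (forall P Q, C P -> C Q -> P != Q -> d <= dist P Q) -> conf (frame C P u).
Proof.
move=> bal d0 eu sep; have u0 : u != 0 by rewrite -sqn_eq0 eu expf_neq0 // gt_eqF.
have inj a b x y : aff P u a b = aff P u x y -> a = x /\ b = y.
  move=> e; have : sqn (aff P u a b - aff P u x y) = 0 by rewrite e subrr; apply/eqP; rewrite sqn_eq0.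
  rewrite aff_sub sqn_aff => /eqP; rewrite mulf_eq0 sqn_eq0 (negbTE u0) orbF paddr_eq0 ?sqr_ge0 //.
  by rewrite !sqrf_eq0 !subr_eq0 => /andP[/eqP ? /eqP ?].
split=> [a b x y k k' l|a b t k].
  apply: contrapT => n; have ne : aff P u a b != aff P u x y by apply/eqP => /inj[? ?]; apply: n.
  have := sep _ _ k k' ne; rewrite distE aff_sub sqn_aff eu => /(sep_sqr d0) h.
  by move: l; rewrite ltNge h.
(* A negative [t] needs its own case: the ring is empty, but [Num.sqrt] would send it to radius
   0. *)
have [t0|t0] := ltP t 0.
  exists [::]; last by rewrite !big_nil.
  by split=> // -[x y]; split=> //= -[_ e]; have := sqr_ge0 x; have := sqr_ge0 y; lra.
have [fin sum0] := bal _ (Num.sqrt (t * d^+2)) k.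
have [s us [ms sumE]] := finite_uniq fin.
pose cx (Q : plane R) := ((Q - aff P u a b) 0 0 * u 0 0 + (Q - aff P u a b) 0 1 * u 0 1) / d^+2.
pose cy (Q : plane R) := ((Q - aff P u a b) 0 1 * u 0 0 - (Q - aff P u a b) 0 0 * u 0 1) / d^+2.
have d20 : d^+2 != 0 by rewrite expf_neq0 // gt_eqF.
have cE Q : Q = aff P u (a + cx Q) (b + cy Q).
  rewrite /sqn in eu.
  by apply: plane_eq; rewrite /aff /cx /cy !mxE /= -eu; field; rewrite eu.
have Ec x y : cx (aff P u (a+x) (b+y)) = x /\ cy (aff P u (a+x) (b+y)) = y.
  by have [e1 e2] := inj _ _ _ _ (cE (aff P u (a+x) (b+y))); split; lra.
exists (map (fun Q => (cx Q, cy Q)) s).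
  split.
    rewrite map_inj_uniq // => Q Q' [e1 e2]; by rewrite [Q]cE [Q']cE e1 e2.
  move=> [x y] /=; split=> [/mapP[Q /ms[kQ dQ] [-> ->]]|[kq e]].
    rewrite /frame -cE; split=> //.
    have eQ : Q - aff P u a b = cx Q *: u + cy Q *: perp u.
      transitivity (aff P u (a + cx Q) (b + cy Q) - aff P u a b); first by rewrite -cE.
      by rewrite aff_sub; congr (_ *: _ + _ *: _); ring.
    move: dQ; rewrite distE eQ sqn_aff eu => /eqP.
    rewrite eqr_sqrt; last 2 first.
    - by rewrite mulr_ge0 ?addr_ge0 ?sqr_ge0.
    - by rewrite mulr_ge0 ?sqr_ge0.
    by move=> /eqP /(mulIf d20).
  apply/mapP; exists (aff P u (a+x) (b+y)); last by have [-> ->] := Ec x y.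
  apply/ms; split=> //; rewrite distE aff_sub sqn_aff eu -e; congr (Num.sqrt ((_^+2 + _^+2) * _)); ring.
move: sum0; rewrite sumE => sum0.
have sj (j : 'I_2) : \sum_(Q <- s) (Q - aff P u a b) 0 j = 0 by rewrite -summxE sum0 mxE.
by rewrite !big_map /cx /cy /= -!mulr_suml sumrB big_split /= -!mulr_suml !sj; split; ring.
Qed.


End Plane.

(** * Subsets of lattices and their balance *)

Section Lattice.
Variable R : realType.
Notation s3 := (s3 R).
Implicit Types (C : set (plane R)) (P u v w X : plane R) (x y a b c t d : R) (p q i j : int) (Q : int -> int -> Prop).

Definition lattice_pts P u w Q : set (plane R) :=
  [set X | exists i j, X = P + i%:~R *: u + j%:~R *: w /\ Q i j]%classic.

Lemma lattice_pts_ext P u w Q Q' : (forall i j, Q i j <-> Q' i j) -> lattice_pts P u w Q = lattice_pts P u w Q'.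
Proof.
by move=> h; apply/seteqP; split=> X [i [j [-> q]]]; exists i, j; split=> //; apply/h.
Qed.

Definition det2 u w : R := u 0 0 * w 0 1 - u 0 1 * w 0 0.

Lemma free_det u w : free [:: u; w] = (det2 u w != 0).
Proof.
rewrite free_cons span_seq1 seq1_free.
apply/andP/idP => [[/negP n w0]|d0]; last first.
  split; last by apply: contra_neq d0 => ->; rewrite /det2 !mxE; ring.
  by apply/negP => /vlineP[k e]; move: d0; rewrite e /det2 !mxE => /eqP; apply; ring.
apply/eqP => d0; apply: n; apply/vlineP.
have n0 : sqn w != 0 by rewrite sqn_eq0.
exists ((u 0 0 * w 0 0 + u 0 1 * w 0 1) / sqn w); rewrite /det2 /sqn in d0 n0 *.
have e0 : (u 0 0 * w 0 1 - u 0 1 * w 0 0) * w 0 0 = 0 by rewrite d0 mul0r.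
have e1 : (u 0 0 * w 0 1 - u 0 1 * w 0 0) * w 0 1 = 0 by rewrite d0 mul0r.
by apply: plane_eq; rewrite !mxE; apply: (mulIf n0); rewrite mulrAC divfK //; lra.
Qed.

(** The rotation permutes the sequence, so it fixes the sum; a rotation with [a != 1] fixes only the
    zero vector. *)
Lemma sum_turn_closed (s : seq (plane R)) a b : uniq s -> a^+2+b^+2 = 1 -> a != 1 ->
  (forall X, X \in s -> a *: X + b *: perp X \in s) -> \sum_(X <- s) X = 0.
Proof.
move=> us ab an cl; pose r X := a *: X + b *: perp X.
have ri : injective r.
  move=> X Y e; apply/eqP; rewrite -subr_eq0 -sqn_eq0.
  have : sqn (r X - r Y) = (a^+2+b^+2) * sqn (X - Y) by rewrite /r /sqn !mxE /=; ring.
  by rewrite e subrr ab mul1r => <-; rewrite sqn_eq0.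
have um : uniq (map r s) by rewrite map_inj_uniq.
have sub : {subset map r s <= s} by move=> _ /mapP[X m ->]; exact: cl.
have [_ es] := uniq_min_size um sub ltac:(by rewrite size_map).
have p := uniq_perm um us es.
have e : \sum_(X <- s) X = r (\sum_(X <- s) X).
  rewrite -[LHS](perm_big _ p) /= big_map /r big_split /= -!scaler_sumr; congr (_ + _ *: _).
  by apply: plane_eq; rewrite ?perp0 ?perp1 !summxE -?sumrN; apply: eq_bigr => X _; rewrite mxE.
move: (\sum_(X <- s) X) e => S e; apply/eqP; rewrite -sqn_eq0.
have z : sqn (r S - S) = ((a-1)^+2+b^+2) * sqn S by rewrite /r /sqn !mxE /=; ring.
have s0 : sqn (0 : plane R) = 0 by apply/eqP; rewrite sqn_eq0.
move: z; rewrite -e subrr s0 => /esym/eqP; rewrite mulf_eq0 => /orP[|//]; rewrite paddr_eq0 ?sqr_ge0 // sqrf_eq0 subr_eq0 => /andP[/eqP a1].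
by rewrite a1 eqxx in an.
Qed.

Lemma int_box (c : R) : exists N : nat, forall i : int, `|i%:~R| <= c -> (`|i| <= N)%N.
Proof.
exists (Num.bound c) => i l; rewrite -(ler_nat R); apply: ltW; apply: le_lt_trans (archi_boundP _); last first.
  by apply: le_trans l; exact: normr_ge0.
by apply: le_trans l; rewrite natr_absz intr_norm.
Qed.

(** By Cramer's rule the two integer coordinates of a point at given distance are bounded. *)
Lemma lattice_discrete P u w Q X d : det2 u w != 0 -> finite_set (at_dist (lattice_pts P u w Q) X d).
Proof.
move=> d0; have nd : 0 < `|det2 u w| by rewrite normr_gt0.
have bd (V : plane R) Z : dist X Z = d -> `|det2 (Z - X) V| <= `|d| * (`|V 0 1| + `|V 0 0|).
  rewrite distE => e; have dd : sqn (Z - X) = d^+2 by rewrite -e sqr_sqrtr ?sqn_ge0.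
  have c k : k^+2 <= sqn (Z - X) -> `|k| <= `|d|.
    by rewrite dd -[k^+2]real_normK ?num_real // -[d^+2]real_normK ?num_real // ler_pXn2r ?nnegrE.
  rewrite /det2 mulrDr; apply: le_trans (ler_normB _ _) _; rewrite !normrM; apply: lerD; apply: ler_wpM2r => //; apply: c.
    by rewrite /sqn lerDl sqr_ge0.
  by rewrite /sqn lerDr sqr_ge0.
have [N1 h1] := int_box ((`|d| * (`|w 0 1| + `|w 0 0|) + `|det2 (X - P) w|) / `|det2 u w|).
have [N2 h2] := int_box ((`|d| * (`|u 0 1| + `|u 0 0|) + `|det2 (X - P) u|) / `|det2 u w|).
pose sg (b : bool) n : int := if b then - (n : int) else n.
pose f (k : 'I_N1.+1 * bool * ('I_N2.+1 * bool)) := P + (sg k.1.2 k.1.1)%:~R *: u + (sg k.2.2 k.2.1)%:~R *: w.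
apply: (@sub_finite_set _ _ (f @` setT)%classic); last by apply: finite_image; exact: finite_finset.
have sgE i N : (`|i| <= N)%N -> exists (k : 'I_N.+1) (e : bool), i = sg e k.
  move=> l; case: i l => n l; first by exists (Ordinal (l : n < N.+1)%N), false.
  by exists (Ordinal (l : n.+1 < N.+1)%N), true; rewrite NegzE.
move=> Z [[i [j [eZ _]]] dZ].
have li : (`|i| <= N1)%N.
  apply: h1; rewrite ler_pdivlMr // -normrM.
  have -> : i%:~R * det2 u w = det2 (Z - X) w + det2 (X - P) w by rewrite eZ /det2 !mxE; ring.
  by apply: le_trans (ler_normD _ _) _; rewrite lerD2r bd.
have lj : (`|j| <= N2)%N.
  apply: h2; rewrite ler_pdivlMr // -normrM -normrN.
  have -> : - (j%:~R * det2 u w) = det2 (Z - X) u + det2 (X - P) u by rewrite eZ /det2 !mxE; ring.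
  by apply: le_trans (ler_normD _ _) _; rewrite lerD2r bd.
have [k1 [b1 e1]] := sgE _ _ li; have [k2 [b2 e2]] := sgE _ _ lj.
by exists (k1, b1, (k2, b2)) => //; rewrite /f /= -e1 -e2 eZ.
Qed.

(** It is enough to exhibit, for each point separately, one nontrivial rotation about it that
    preserves the set. The rotation has matrix [a + b * perp], in complex notation [a + i b]. *)
Lemma lattice_balanced P u w Q : det2 u w != 0 -> 
  (forall i0 j0, Q i0 j0 -> exists a b, [/\ a^+2+b^+2 = 1, a != 1 & forall i j, Q (i0+i) (j0+j) ->
     exists i' j', Q (i0+i') (j0+j') /\ 
       a *: (i%:~R *: u + j%:~R *: w) + b *: perp (i%:~R *: u + j%:~R *: w) = i'%:~R *: u + j'%:~R *: w]) ->
  balanced (lattice_pts P u w Q).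
Proof.
move=> d0 h X d [i0 [j0 [eX q0]]]; have fin := lattice_discrete P Q X d d0; split=> //.
have [s us [ms ->]] := finite_uniq fin.
have [a [b [ab an cl]]] := h _ _ q0.
have -> : \sum_(Y <- s) (Y - X) = \sum_(V <- map (fun Y => Y - X) s) V by rewrite big_map.
apply: (@sum_turn_closed _ a b) => //; first by rewrite map_inj_uniq //; exact: addIr.
move=> V /mapP[Y /ms[[i [j [eY q]]] dY] ->].
have eV : Y - X = (i-i0)%:~R *: u + (j-j0)%:~R *: w.
  by rewrite eY eX !intrB; apply: plane_eq; rewrite !mxE; ring.
have [i' [j' [q' e]]] := cl (i-i0) (j-j0) ltac:(by rewrite !subrKC).
apply/mapP; exists (X + (a *: (Y - X) + b *: perp (Y - X))); last by rewrite [RHS]addrAC subrr add0r.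
apply/ms; split.
  by exists (i0+i'), (j0+j'); split=> //; rewrite eV e eX !intrD; apply: plane_eq; rewrite !mxE; ring.
have -> : dist X (X + (a *: (Y - X) + b *: perp (Y - X))) = dist X Y; last by [].
by rewrite !distE [X in sqn X]addrAC subrr add0r sqn_aff ab mul1r.
Qed.

End Lattice.

(** * Centers of tiles and the features of both tilings *)

Section Centers.
Variable R : realType.
Notation s3 := (s3 R).
Implicit Types (p : polygon R) (c x : plane R).

(** A point reflection permuting the vertices maps convex combinations to convex combinations, with
    the weights permuted. *)
Lemma center_exists p c (f : 'I_(size p) -> 'I_(size p)) : involutive f ->
  (forall i, p`_(f i) = 2 *: c - p`_i) -> center_of_symmetry p c.
Proof.
move=> fK fp; suff h x : region p x -> region p (2 *: c - x).
  by move=> x; split=> [/h//|/h]; rewrite opprB addrCA subrr addr0.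
move=> [w [w0 w1 ->]]; exists (fun i => w (f i)); split=> [i|| ]; first exact: w0.
  by rewrite -w1 [RHS](reindex_inj (inv_inj fK)).
have {1}-> : 2 *: c = \sum_i w i *: (2 *: c) by rewrite -scaler_suml w1 scale1r.
rewrite [RHS](reindex_inj (inv_inj fK)) /= -sumrB.
by apply: eq_bigr => i _; rewrite fK fp scalerBr.
Qed.

(** Two centers compose to the translation by [2 * (c' - c)], which cannot preserve a nonempty
    bounded region unless it is zero. *)
Lemma center_unique p c c' : p != [::] -> center_of_symmetry p c -> center_of_symmetry p c' -> c = c'.
Proof.
move=> pn h h'; have [v ev] : exists v, v = 2 *: (c' - c) by eexists.
have step x : region p x -> region p (x + v).
  move=> /h/h'; congr region; rewrite ev; apply/rowP => j; rewrite !mxE; ring.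
have x0 : region p p`_0.
  case: p pn {h h' step} => [//|y p] _; exists (fun i => (i == ord0)%:R); split=> [i||].
  - by case: (i == ord0).
  - by rewrite (bigD1 ord0) //= big1 ?addr0 // => i /negbTE ->.
  by rewrite (bigD1 ord0) //= scale1r big1 ?addr0 // => i /negbTE ->; rewrite scale0r.
have it n : region p (p`_0 + n%:R *: v).
  elim: n => [|n ih]; first by rewrite scale0r addr0.
  by rewrite -natr1 scalerDl scale1r addrA; exact: step.
have bd x j : region p x -> `|x 0 j| <= \sum_(i < size p) `|p`_i 0 j|.
  move=> [w [w0 w1 ->]]; rewrite summxE; apply: le_trans (ler_norm_sum _ _ _) _.
  apply: ler_sum => i _; rewrite mxE normrM ger0_norm //; rewrite -[leRHS]mul1r; apply: ler_wpM2r => //.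
  by rewrite -w1 (bigD1 i) //= lerDl; apply: sumr_ge0.
suff vj j : v 0 j = 0.
  apply/rowP => j; have := vj j; rewrite ev !mxE; clear; lra.
apply/eqP; apply: contraT => vn; have v0 : 0 < `|v 0 j| by rewrite normr_gt0.
set M := \sum_(i < size p) `|p`_i 0 j| in bd.
have M0 : 0 <= M by apply: sumr_ge0.
have Mv : 0 <= 2 * M / `|v 0 j| by rewrite divr_ge0 // mulr_ge0.
have := archi_boundP Mv; set n := Num.bound _; rewrite ltr_pdivrMr // => l.
have := bd _ j (it n); rewrite !mxE => b1; have b2 := bd _ j x0.
have : `|n%:R * v 0 j| <= M + M.
  have -> : n%:R * v 0 j = (p`_0 0 j + n%:R * v 0 j) - p`_0 0 j by ring.
  by apply: le_trans (ler_normB _ _) _; apply: lerD.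
by rewrite normrM normr_nat => b3; exfalso; clear -b3 l; lra.
Qed.

Lemma center_iff p c x : p != [::] -> center_of_symmetry p c -> (center_of_symmetry p x <-> x = c).
Proof. by move=> pn h; split=> [h'|->//]; exact: center_unique pn h' h. Qed.

End Centers.

Section Features.
Variable R : realType.
Notation s3 := (s3 R).
Implicit Types (a c e u v x : plane R) (i j : int) (T : set (polygon R)).

(* Parities of the coordinates of the features with respect to half the sides. *)
Definition Qp (k : feature) i j : Prop :=
  match k with
  | Vertices => modz i 2 = 0 /\ modz j 2 = 0
  | EdgeMidpoints => modz i 2 <> modz j 2
  | FaceCenters => modz i 2 = 1 /\ modz j 2 = 1
  end.

Lemma parallelogram_center a u v x :
  center_of_symmetry (parallelogram a u v) x <-> x = a + 2^-1 *: u + 2^-1 *: v.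
Proof.
apply: center_iff => //.
pose f (i : 'I_(size (parallelogram a u v))) : 'I_(size (parallelogram a u v)) :=
  Ordinal (ltn_pmod (i + 2) (isT : 0 < 4)%N).
apply: (@center_exists _ _ _ f) => [i|].
  by apply: val_inj => /=; case: i => -[|[|[|[|//]]]].
by case=> -[|[|[|[|//]]]] l /=; apply: plane_eq; rewrite !mxE; field.
Qed.

Ltac lattice_point i j := exists i, j; split;
  [apply: plane_eq; rewrite /midpoint /= !mxE ?(intrD, intrB, intrM); field|rewrite /= /Qv /Qe /Qf; first [lia | split; lia]].

Lemma parallelogram_features a u v k :
  feature_points (parallelogram_tiles a u v) k = lattice_pts a (2^-1 *: u) (2^-1 *: v) (Qp k).
Proof.
apply/seteqP; split=> x; case: k => /=.
- move=> [_ [i [j ->]]]; rewrite !inE => /or4P[] /eqP ->.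
  + by lattice_point (2*i) (2*j).
  + by lattice_point (2*i+1+1) (2*j).
  + by lattice_point (2*i+1+1) (2*j+1+1).
  + by lattice_point (2*i) (2*j+1+1).
- move=> [_ [i [j ->]]]; rewrite !inE => /or4P[] /eqP ->.
  + by lattice_point (2*i+1) (2*j).
  + by lattice_point (2*i+1+1) (2*j+1).
  + by lattice_point (2*i+1) (2*j+1+1).
  + by lattice_point (2*i) (2*j+1).
- move=> [_ [i [j ->]]] /parallelogram_center ->.
  by lattice_point (2*i+1) (2*j+1).
- move=> [i [j [-> [hi hj]]]]; have [i' ei] : exists i', i = 2*i' by exists (divz i 2); lia.
  have [j' ej] : exists j', j = 2*j' by exists (divz j 2); lia.
  exists (parallelogram (a + i'%:~R *: u + j'%:~R *: v) u v); first by exists i', j'.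
  rewrite inE; apply/orP; left; apply/eqP.
  by apply: plane_eq; rewrite !mxE ei ej ?intrM; field.
- move=> [i [j [-> h]]]; rewrite /Qp in h.
  have [[hi hj]|[hi hj]] : (modz i 2 = 1 /\ modz j 2 = 0) \/ (modz i 2 = 0 /\ modz j 2 = 1) by lia.
    have [i' ei] : exists i', i = 2*i'+1 by exists (divz i 2); lia.
    have [j' ej] : exists j', j = 2*j' by exists (divz j 2); lia.
    exists (parallelogram (a + i'%:~R *: u + j'%:~R *: v) u v); first by exists i', j'.
    rewrite inE; apply/orP; left; apply/eqP.
    by apply: plane_eq; rewrite /midpoint /= !mxE ei ej ?intrD ?intrM; field.
  have [i' ei] : exists i', i = 2*i' by exists (divz i 2); lia.
  have [j' ej] : exists j', j = 2*j'+1 by exists (divz j 2); lia.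
  exists (parallelogram (a + i'%:~R *: u + j'%:~R *: v) u v); first by exists i', j'.
  rewrite !inE; apply/or4P; apply: Or44; apply/eqP.
  by apply: plane_eq; rewrite /midpoint /= !mxE ei ej ?intrD ?intrM; field.
move=> [i [j [-> [hi hj]]]]; have [i' ei] : exists i', i = 2*i'+1 by exists (divz i 2); lia.
have [j' ej] : exists j', j = 2*j'+1 by exists (divz j 2); lia.
exists (parallelogram (a + i'%:~R *: u + j'%:~R *: v) u v); first by exists i', j'.
by apply/parallelogram_center; apply: plane_eq; rewrite !mxE ei ej ?intrD ?intrM; field.
Qed.

Definition Qh (k : feature) : int -> int -> Prop :=
  match k with Vertices => Qv | EdgeMidpoints => Qe | FaceCenters => Qf end.

Lemma rot60_2 (u : plane R) : rot60 (rot60 u) = rot60 u - u.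
Proof.
have ww z : s3 * (s3 * z) = 3/4*z by rewrite mulrA -expr2 s3_sq.
by rewrite !rot60E; apply: plane_eq; rewrite !mxE /=; have := ww (u 0 0); have := ww (u 0 1); lra.
Qed.

Lemma rot60_3 (u : plane R) : rot60 (rot60 (rot60 u)) = - u.
Proof. by rewrite 2!rot60_2 addrAC subrr add0r. Qed.

Lemma hexagonE c (e : plane R) : hexagon c e = [:: c + e; c + rot60 e; c + (rot60 e - e); c - e; c - rot60 e; c - (rot60 e - e)].
Proof.
have rN (u : plane R) : rot60 (- u) = - rot60 u by rewrite !rot60E; apply: plane_eq; rewrite !mxE /=; ring.
by rewrite /hexagon /= !rot60_3 !rN rot60_2.
Qed.

Lemma hexagon_center c (e x : plane R) : center_of_symmetry (hexagon c e) x <-> x = c.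
Proof.
apply: center_iff => //; rewrite hexagonE; set p := (X in center_of_symmetry X).
pose f (i : 'I_(size p)) : 'I_(size p) := Ordinal (ltn_pmod (i + 3) (isT : 0 < 6)%N).
apply: (@center_exists _ _ _ f) => [i|].
  by apply: val_inj => /=; case: i => -[|[|[|[|[|[|//]]]]]].
by case=> -[|[|[|[|[|[|//]]]]]] l /=; apply: plane_eq; rewrite !mxE; ring.
Qed.

(** The base point [c - rot60 e] is a vertex, as the residues in [Qv], [Qe], [Qf] require; the face
    center [c] then has coordinates [(0, 2)]. *)
Lemma hexagon_features c (e : plane R) k :
  feature_points (hexagon_tiles c e) k = lattice_pts (c - rot60 e) (2^-1 *: e) (2^-1 *: rot60 e) (Qh k).
Proof.
have r2 := rot60_2 e.
have tileE (i j : int) : c + i%:~R *: (e + rot60 e) + j%:~R *: (rot60 e + rot60 (rot60 e)) =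
    c - rot60 e + (2*i-2*j)%:~R *: (2^-1 *: e) + (2+2*i+4*j)%:~R *: (2^-1 *: rot60 e).
  by rewrite r2; move: (rot60 e) => r; apply: plane_eq; rewrite !mxE ?(intrD, intrB, intrM); field.
have hE d : hexagon d e = [:: d + e; d + rot60 e; d + (rot60 e - e); d - e; d - rot60 e; d - (rot60 e - e)] := hexagonE d e.
have cE x d : center_of_symmetry (hexagon d e) x <-> x = d := hexagon_center d e x.
have -> : hexagon_tiles c e =
  [set p | exists i j : int, p = hexagon (c - rot60 e + (2*i-2*j)%:~R *: (2^-1 *: e) + (2+2*i+4*j)%:~R *: (2^-1 *: rot60 e)) e]%classic.
  by apply/seteqP; split=> p [i [j ->]]; exists i, j; rewrite tileE.
clear tileE r2; move: (rot60 e) hE cE => r hE cE.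
apply/seteqP; split=> x; case: k => /=.
- move=> [_ [i [j ->]]]; rewrite hE !inE => /or4P[/eqP->|/eqP->|/eqP->|/or3P[]/eqP->].
  + by lattice_point (2*i-2*j+2) (2+2*i+4*j).
  + by lattice_point (2*i-2*j) (2+2*i+4*j+2).
  + by lattice_point (2*i-2*j-2) (2+2*i+4*j+2).
  + by lattice_point (2*i-2*j-2) (2+2*i+4*j).
  + by lattice_point (2*i-2*j) (2+2*i+4*j-2).
  + by lattice_point (2*i-2*j+2) (2+2*i+4*j-2).
- move=> [_ [i [j ->]]]; rewrite hE !inE => /or4P[/eqP->|/eqP->|/eqP->|/or3P[]/eqP->].
  + by lattice_point (2*i-2*j+1) (2+2*i+4*j+1).
  + by lattice_point (2*i-2*j-1) (2+2*i+4*j+2).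
  + by lattice_point (2*i-2*j-2) (2+2*i+4*j+1).
  + by lattice_point (2*i-2*j-1) (2+2*i+4*j-1).
  + by lattice_point (2*i-2*j+1) (2+2*i+4*j-2).
  + by lattice_point (2*i-2*j+2) (2+2*i+4*j-1).
- move=> [_ [i [j ->]]] /cE ->.
  by lattice_point (2*i-2*j) (2+2*i+4*j).
- move=> [p [q [-> [hp hq hpq]]]].
  have [p' ep] : exists p', p = 2 * p' by exists (divz p 2); lia.
  have [q' eq] : exists q', q = 2 * q' by exists (divz q 2); lia.
  have [[j ej]|[j ej]] : (exists j, q' = p' + 3*j) \/ (exists j, q' = p' + 2 + 3*j).
    have [h|h] : modz (q' - p') 3 = 0 \/ modz (q' - p') 3 = 2 by lia.
      by left; exists (divz (q' - p') 3); lia.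
    by right; exists (divz (q' - p') 3); lia.
    exists (hexagon (c - r + (2*(p' - 1 + j)-2*j)%:~R *: (2^-1 *: e) + (2+2*(p' - 1 + j)+4*j)%:~R *: (2^-1 *: r)) e); first by exists (p' - 1 + j), j.
    rewrite hE !inE; apply/orP; left; apply/eqP.
    by (apply: plane_eq; rewrite /midpoint /= !mxE ep eq ej ?(intrD, intrB, intrM); field).
  exists (hexagon (c - r + (2*(p' + 1 + j)-2*j)%:~R *: (2^-1 *: e) + (2+2*(p' + 1 + j)+4*j)%:~R *: (2^-1 *: r)) e); first by exists (p' + 1 + j), j.
  rewrite hE !inE; apply/or4P; apply: Or44; apply/orP; left; apply/eqP.
  by (apply: plane_eq; rewrite /midpoint /= !mxE ep eq ej ?(intrD, intrB, intrM); field).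
- move=> [p [q [-> [npq hpq]]]].
  have [[hp hq]|[[hp hq]|[hp hq]]] : (modz p 2 = 1 /\ modz q 2 = 1) \/ (modz p 2 = 1 /\ modz q 2 = 0) \/ (modz p 2 = 0 /\ modz q 2 = 1) by lia.
  + have [p' ep] : exists p', p = 2 * p' + 1 by exists (divz p 2); lia.
    have [q' eq] : exists q', q = 2 * q' + 1 by exists (divz q 2); lia.
    have [j ej] : exists j, q' = p' + 1 + 3*j by exists (divz (q' - p') 3); lia.
    exists (hexagon (c - r + (2*(p' + j)-2*j)%:~R *: (2^-1 *: e) + (2+2*(p' + j)+4*j)%:~R *: (2^-1 *: r)) e); first by exists (p' + j), j.
    rewrite hE !inE; apply/orP; left; apply/eqP.
    by (apply: plane_eq; rewrite /midpoint /= !mxE ep eq ej ?(intrD, intrB, intrM); field).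
  + have [p' ep] : exists p', p = 2 * p' + 1 by exists (divz p 2); lia.
    have [q' eq] : exists q', q = 2 * q' by exists (divz q 2); lia.
    have [j ej] : exists j, q' = p' + 3 + 3*j by exists (divz (q' - p') 3 - 1); lia.
    exists (hexagon (c - r + (2*(p' + 1 + j)-2*j)%:~R *: (2^-1 *: e) + (2+2*(p' + 1 + j)+4*j)%:~R *: (2^-1 *: r)) e); first by exists (p' + 1 + j), j.
    rewrite hE !inE; apply/orP; right; apply/orP; left; apply/eqP.
    by (apply: plane_eq; rewrite /midpoint /= !mxE ep eq ej ?(intrD, intrB, intrM); field).
  + have [p' ep] : exists p', p = 2 * p' by exists (divz p 2); lia.
    have [q' eq] : exists q', q = 2 * q' + 1 by exists (divz q 2); lia.
    have [j ej] : exists j, q' = p' + 2 + 3*j by exists (divz (q' - p') 3); lia.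
    exists (hexagon (c - r + (2*(p' + 1 + j)-2*j)%:~R *: (2^-1 *: e) + (2+2*(p' + 1 + j)+4*j)%:~R *: (2^-1 *: r)) e); first by exists (p' + 1 + j), j.
    rewrite hE !inE; apply/or3P; apply: Or33; apply/orP; left; apply/eqP.
    by (apply: plane_eq; rewrite /midpoint /= !mxE ep eq ej ?(intrD, intrB, intrM); field).
move=> [p [q [-> [hp hq hpq]]]].
have [p' ep] : exists p', p = 2 * p' by exists (divz p 2); lia.
have [q' eq] : exists q', q = 2 * q' by exists (divz q 2); lia.
have [j ej] : exists j, q' = p' + 1 + 3*j by exists (divz (q' - p') 3); lia.
exists (hexagon (c - r + (2*(p' + j)-2*j)%:~R *: (2^-1 *: e) + (2+2*(p' + j)+4*j)%:~R *: (2^-1 *: r)) e); first by exists (p' + j), j.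
apply/cE.
by (apply: plane_eq; rewrite /midpoint /= !mxE ep eq ej ?(intrD, intrB, intrM); field).
Qed.

End Features.

(** * Both directions for the tilings *)

Section Final.
Variable R : realType.
Notation s3 := (s3 R).
Implicit Types (C : set (plane R)) (a c e u v w x P : plane R) (i j : int) (T : set (polygon R)) (S : set feature).

Lemma features_union_lattice T S P u w (Q : feature -> int -> int -> Prop) :
  (forall k, feature_points T k = lattice_pts P u w (Q k)) ->
  features_union T S = lattice_pts P u w (fun i j => exists2 k, S k & Q k i j).
Proof.
move=> h; apply/seteqP; split=> x.
  by move=> [k Sk]; rewrite h => -[i [j [-> q]]]; exists i, j; split=> //; exists k.
by move=> [i [j [-> [k Sk q]]]]; exists k => //; rewrite h; exists i, j.
Qed.

Lemma det2_half u v : det2 u v != 0 -> det2 (2^-1 *: u) (2^-1 *: v) != 0.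
Proof.
move=> d0; have -> : det2 (2^-1 *: u) (2^-1 *: v) = 4^-1 * det2 u v by rewrite /det2 !mxE; field.
by rewrite mulf_neq0 // invr_eq0 pnatr_eq0.
Qed.

Lemma parallelogram_balanced T S : parallelogram_tiling T -> balanced (features_union T S).
Proof.
move=> [a [u [v [uv ->]]]]; rewrite free_det in uv.
rewrite (features_union_lattice S (parallelogram_features a u v)).
apply: lattice_balanced => [|i0 j0 [k0 Sk0 q0]]; first exact: det2_half.
exists (-1), 0; split; [ring|by apply/eqP; lra|move=> i j [k Sk q]].
exists (-i), (-j); split; last by rewrite scale0r addr0 !mulrNz; apply: plane_eq; rewrite !mxE; ring.
exists k => //; move: q q0; clear; case: k; case: k0; rewrite /Qp; lia.
Qed.

Lemma det2_rot60 (e : plane R) : e != 0 -> det2 e (rot60 e) != 0.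
Proof.
move=> e0; have -> : det2 e (rot60 e) = s3 * sqn e by rewrite rot60E /det2 /sqn !mxE /=; ring.
by rewrite mulf_neq0 ?sqn_eq0 // gt_eqF ?s3_gt0.
Qed.

(** About an edge midpoint or a face center one has [i0 - j0 = 1] modulo 3, so the half turn
    respects all residues; about a vertex it does not, and [Qh_rotate] takes over. *)
Lemma Qh_reflect (k k0 : feature) i0 j0 i j : k0 <> Vertices -> Qh k0 i0 j0 -> Qh k (i0+i) (j0+j) -> Qh k (i0-i) (j0-j).
Proof.
move=> kn q0; have c : modz (i0 - j0) 3 = 1 by move: q0 kn; case: k0 => //= -[].
case: k => /=; rewrite /Qv /Qe /Qf.
- by move=> [h1 h2 h3]; split; lia.
- by move=> [h1 h2]; split; lia.
by move=> [h1 h2 h3]; split; lia.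
Qed.

Lemma Qh_rotate (k : feature) i0 j0 i j : Qv i0 j0 -> Qh k (i0+i) (j0+j) -> Qh k (i0+(-i-j)) (j0+i).
Proof.
move=> [e1 e2 e3]; case: k => /=; rewrite /Qv /Qe /Qf.
- by move=> [h1 h2 h3]; split; lia.
- by move=> [h1 h2]; split; lia.
by move=> [h1 h2 h3]; split; lia.
Qed.

Lemma hexagon_balanced T S : hexagonal_tiling T -> balanced (features_union T S).
Proof.
move=> [c [e [e0 ->]]]; rewrite (features_union_lattice S (hexagon_features c e)).
apply: lattice_balanced => [|i0 j0 [k0 Sk0 q0]]; first exact/det2_half/det2_rot60.
have [k0v|k0v] := pselect (k0 = Vertices); last first.
  exists (-1), 0; split; [ring|by apply/eqP; lra|move=> i j [k Sk q]].
  exists (-i), (-j); split; last by rewrite scale0r addr0 !mulrNz; move: (rot60 e) => r; apply: plane_eq; rewrite !mxE; ring.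
  by exists k => //; exact: Qh_reflect k0v q0 q.
rewrite k0v /= in q0; exists (-1/2), s3; split; [by rewrite s3_sq; field|by apply/eqP; lra|move=> i j [k Sk q]].
exists (-i-j), i; split.
  by exists k => //; exact: Qh_rotate q0 q.
have ww z : s3 * (s3 * z) = 3/4*z by rewrite mulrA -expr2 s3_sq.
rewrite rot60E intrB mulrNz; have := ww (j%:~R * e 0 0); have := ww (j%:~R * e 0 1) => h1 h0.
by apply: plane_eq; rewrite !mxE /=; clear -h1 h0; lra.
Qed.

Lemma union_tiling C P u w (Q : int -> int -> Prop) T S (Qk : feature -> int -> int -> Prop) :
  C = lattice_pts P u w Q -> (forall k, feature_points T k = lattice_pts P u w (Qk k)) ->
  (forall i j, Q i j <-> exists2 k, S k & Qk k i j) -> C = features_union T S.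
Proof. by move=> -> h e; rewrite (features_union_lattice S h); exact: lattice_pts_ext. Qed.

Lemma parallelogram_points P u w k :
  feature_points (parallelogram_tiles P (2 *: u) (2 *: w)) k = lattice_pts P u w (Qp k).
Proof. by rewrite parallelogram_features !scalerA mulVf ?scale1r ?pnatr_eq0. Qed.

Lemma hexagon_points P (e : plane R) k :
  feature_points (hexagon_tiles (P + rot60 (2 *: e)) (2 *: e)) k = lattice_pts P e (rot60 e) (Qh k).
Proof.
rewrite hexagon_features addrK scalerA mulVf ?scale1r ?pnatr_eq0 //; congr lattice_pts.
by rewrite !rot60E; apply: plane_eq; rewrite !mxE /=; field.
Qed.

Lemma offline C P u : u != 0 -> ~ contained_in_line C -> exists x y : R, frame C P u x y /\ y != 0.
Proof.
move=> u0 nl; apply: contrapT => n; apply: nl; exists P, u; split=> // X CX.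
have [x [y e]] := aff_onto P X u0; exists x => //; rewrite e /aff.
suff -> : y = 0 by rewrite scale0r addr0.
by apply/eqP; apply: contraT => y0; case: n; exists x, y; split; rewrite /frame -?e.
Qed.

Lemma frame_lattice C P u (v w : plane R) (Q : int -> int -> Prop) (f g : int -> int -> R) : u != 0 ->
  (forall x y : R, frame C P u x y <-> exists i j, [/\ x = f i j, y = g i j & Q i j]) ->
  (forall i j, f i j *: u + g i j *: perp u = i%:~R *: v + j%:~R *: w) -> C = lattice_pts P v w Q.
Proof.
move=> u0 h e; have aE i j : aff P u (f i j) (g i j) = P + i%:~R *: v + j%:~R *: w.
  by rewrite /aff -!addrA e.
apply/seteqP; split=> X.
  have [x [y ->]] := aff_onto P X u0 => /h[i [j [-> -> q]]].
  by exists i, j; rewrite aE.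
by move=> [i [j [-> q]]]; rewrite -aE; apply/h; exists i, j.
Qed.

Lemma hex_lattice C P u (e : R) (Q : int -> int -> Prop) : u != 0 ->
  (forall x y : R, frame C P u x y <-> eis e Q x y) -> C = lattice_pts P (e *: u) (rot60 (e *: u)) Q.
Proof.
move=> u0 h; apply: (frame_lattice u0 h) => i j.
by rewrite rot60E; apply: plane_eq; rewrite !mxE /=; field.
Qed.

Lemma hexagon_union C P (v : plane R) (Q : int -> int -> Prop) S : v != 0 -> C = lattice_pts P v (rot60 v) Q ->
  (forall i j, Q i j <-> exists2 k, S k & Qh k i j) -> (S !=set0)%classic ->
  exists (T : set (polygon R)) (S : set feature),
    [/\ hexagonal_tiling T \/ parallelogram_tiling T, (S !=set0)%classic & C = features_union T S].
Proof.
move=> v0 eC h S0; exists (hexagon_tiles (P + rot60 (2 *: v)) (2 *: v)), S; split=> //.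
  by left; exists (P + rot60 (2 *: v)), (2 *: v); split=> //; rewrite scaler_eq0 pnatr_eq0.
exact: union_tiling eC (hexagon_points P v) h.
Qed.

Lemma parallelogram_union C P (u w : plane R) (Q : int -> int -> Prop) S : det2 u w != 0 -> C = lattice_pts P u w Q ->
  (forall i j, Q i j <-> exists2 k, S k & Qp k i j) -> (S !=set0)%classic ->
  exists (T : set (polygon R)) (S : set feature),
    [/\ hexagonal_tiling T \/ parallelogram_tiling T, (S !=set0)%classic & C = features_union T S].
Proof.
move=> d0 eC h S0; exists (parallelogram_tiles P (2 *: u) (2 *: w)), S; split=> //.
  right; exists P, (2 *: u), (2 *: w); split=> //; rewrite free_det.
  have -> : det2 (2 *: u) (2 *: w) = 4 * det2 u w by rewrite /det2 !mxE; ring.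
  by rewrite mulf_neq0 // pnatr_eq0.
exact: union_tiling eC (parallelogram_points P u w) h.
Qed.

End Final.

Local Open Scope classical_set_scope.

Theorem theorem1p2 (R : realType) :
  (forall (T : set (polygon R)) (S : set feature),
      hexagonal_tiling T \/ parallelogram_tiling T -> S !=set0 ->
      balanced (features_union T S)) /\
  (forall C : set (plane R),
      balanced C -> minimal_distance_property C -> ~ contained_in_line C ->
      exists (T : set (polygon R)) (S : set feature),
        [/\ hexagonal_tiling T \/ parallelogram_tiling T, S !=set0 &
            C = features_union T S]).
Proof.
split=> [T S [hT|hT] _|C bal [d d0 [sep [P [P' [CP CP' dP]]]]] nl].
- exact: hexagon_balanced.
- exact: parallelogram_balanced.
pose u := P' - P; have eu : sqn u = d^+2 by rewrite -dP distE sqr_sqrtr ?sqn_ge0.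
have u0 : u != 0 by rewrite -sqn_eq0 eu expf_neq0 // gt_eqF.
have ck := conf_frame P bal d0 eu sep.
have k0 : frame C P u 0 0 by rewrite /frame /aff !scale0r !addr0.
have k1 : frame C P u 1 0 by rewrite /frame /aff scale0r scale1r addr0 /u subrKC.
case: (conf_class ck k0 k1 (offline P u0 nl)) => [[s [h [h0 l]]]|[a [b [c [t [ct hx]]]]]].
  pose w := s *: u + h *: perp u.
  have dw : det2 u w != 0.
    have -> : det2 u w = h * sqn u by rewrite /det2 /sqn !mxE /=; ring.
    by rewrite mulf_neq0 ?gt_eqF // eu exprn_gt0.
  have fE (i j : int) : (i%:~R + j%:~R * s) *: u + (j%:~R * h) *: perp u = i%:~R *: u + j%:~R *: w.
    by apply: plane_eq; rewrite !mxE /=; ring.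
  (* The full lattice is the union of all three features of the tiling with doubled sides; the
     lattice without its odd-odd class lacks precisely the face centers. *)
  case: l => l.
    apply: (@parallelogram_union _ C P u w (fun _ _ => True) setT dw) => [|i j|]; last by exists Vertices.
      apply: (frame_lattice u0 _ fE) => x y; rewrite l; split=> -[i [j]]; first by move=> [? ?]; exists i, j.
      by move=> [? ? _]; exists i, j.
    split=> // _; have : (modz i 2 = 0 /\ modz j 2 = 0) \/ (modz i 2 <> modz j 2) \/ (modz i 2 = 1 /\ modz j 2 = 1) by lia.
    by move=> [|[]] ?; [exists Vertices|exists EdgeMidpoints|exists FaceCenters].
  apply: (@parallelogram_union _ C P u w (fun i j => (exists k : int, i = 2*k) \/ (exists k : int, j = 2*k))
    [set Vertices; EdgeMidpoints] dw) => [|i j|]; last by exists Vertices; left.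
    exact: (frame_lattice u0 l fE).
  split=> [ij|[k [->|->] /= q]].
  - have : (modz i 2 = 0 /\ modz j 2 = 0) \/ (modz i 2 <> modz j 2).
      by case: ij => -[k ek]; lia.
    by case=> ?; [exists Vertices; [left|]|exists EdgeMidpoints; [right|]].
  - by left; exists (divz i 2); lia.
  have [hi|hj] : modz i 2 = 0 \/ modz j 2 = 0 by lia.
    by left; exists (divz i 2); lia.
  by right; exists (divz j 2); lia.
pose v := c *: u + t *: perp u; pose A := aff P u a b.
have v0 : v != 0 by rewrite -sqn_eq0 sqn_aff ct mul1r sqn_eq0.
have fE (x y : R) : move (frame C P u) a b c t x y = frame C A v x y by rewrite /frame -aff_move.
have nz (e : R) : e != 0 -> e *: v != 0 by move=> e0; rewrite scaler_eq0 negb_or e0.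
(* Only these three unions occur here: vertices alone, vertices with midpoints, and all features,
   since the point taken as origin has a triangular unit ring and is a vertex. *)
case: hx => hx.
- have hx' (x y : R) : frame C A v x y <-> eis (1/2) Qv x y by rewrite -fE.
  apply: (hexagon_union (S := [set Vertices]) _ (hex_lattice v0 hx')) => [|i j|]; [|by split=> [|[k ->]]; [exists Vertices|]|by exists Vertices].
  by apply: nz; apply/eqP; lra.
- have hx' (x y : R) : frame C A v x y <-> eis 1 Qve x y by rewrite -fE.
  apply: (hexagon_union (S := [set Vertices; EdgeMidpoints]) _ (hex_lattice v0 hx')) => [|i j|]; last by exists Vertices; left.
    by apply: nz; apply/eqP; lra.
  split=> [[q|q]|[k [->|->] q]]; [by exists Vertices; [left|]|by exists EdgeMidpoints; [right|]|by left|by right].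
have hx' (x y : R) : frame C A v x y <-> eis 1 Qvef x y by rewrite -fE.
apply: (hexagon_union (S := setT) _ (hex_lattice v0 hx')) => [|i j|]; last by exists Vertices.
  by apply: nz; apply/eqP; lra.
split=> [[[q|q]|q]|[[] _ q]]; [by exists Vertices|by exists EdgeMidpoints|by exists FaceCenters|by left; left|by left; right|by right].
Qed.
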